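(* Let $(M,g)$ be a complete Riemannian manifold whose sectional curvatures satisfy $\sec_M<K$ for a constant $K\in\mathbb{R}$. Let $\ell>0$, with $\ell<\pi/\sqrt{K}$ if $K>0$, and let $\gamma:[0,\mathcal{L}(\gamma)]\to M$ be a regular tractrix, parametrized by arc length $s$, with pole length $\ell$ and tractor $\eta$. Let $\mathcal{K}(\gamma)=\int_0^{\mathcal{L}(\gamma)}\kappa(s)\,ds$. Then $$\mathcal{L}(\eta)\;\geq\;\int_0^{\mathcal{L}(\gamma)}\sqrt{1+\left(\kappa(s)\,J^K(\ell)\right)^2}\,ds\;\geq\;\sqrt{\mathcal{L}^2(\gamma)+\left(J^K(\ell)\,\mathcal{K}(\gamma)\right)^2}\;\geq\;\mathcal{L}(\gamma),$$ and the area $\mathcal{A}$ swept out by the pole satisfies $$\mathcal{A}\;\geq\;\mathcal{K}(\gamma)\cdot\int_0^{\ell}J^K(u)\,du ,$$ where $$\int_0^\ell J^K(u)\,du=\begin{cases}\frac{1}{k^2}(1-\cos(k\ell)) & \text{for } K=k^2>0,\\[2pt] \frac12\ell^2 & \text{for } K=0,\\[2pt] \frac{1}{k^2}(\cosh(k\ell)-1)&\text{for } K=-k^2<0\end{cases}$$ (with $k>0$). Equalities (throughout the chain for the lengths, respectively in the area inequality) occur if and only if $\gamma$ and $\eta$ are geodesics.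
   Context: $(M,g)$ has Levi-Civita covariant derivative $D$. A tractor curve is a smooth piecewise regular curve $\eta(t)$ in $M$. A pulled tractrix (put $\varepsilon=+1$), respectively pushed tractrix (put $\varepsilon=-1$), of $\eta$ with pole length $\ell>0$ is a curve $\gamma$ such that, in an arc length parameter $s$, the unit speed geodesic $\lambda_s(u)$ with $\lambda_s(0)=\gamma(s)$ and $\lambda_s'(0)=\varepsilon\gamma'(s)$ satisfies $\lambda_s(\ell)=\eta(t(s))$ for some $t=t(s)$. The geodesic segment $\lambda_s(u)$, $u\in[0,\ell]$, is the (wagon) pole at $s$. The relevant tractor is the curve $s\mapsto\lambda_s(\ell)=\eta(t(s))$, $s\in[0,\mathcal{L}(\gamma)]$, and $\mathcal{L}(\cdot)$ denotes length. The geodesic curvature of $\gamma$ is $\kappa(s)=\|D_{\gamma'(s)}\gamma'(s)\|$. The area $\mathcal{A}$ swept out by the pole is the area, counted with multiplicity, of the map $r(s,u)=\lambda_s(u)$ on $[0,\mathcal{L}(\gamma)]\times[0,\ell]$, i.e. the integral over this rectangle of the area of the parallelogram spanned by $\partial_s r$ and $\partial_u r$. The space form Jacobi function is $J^K(u)=\frac1k\sin(ku)$ for $K=k^2>0$, $J^K(u)=u$ for $K=0$, and $J^K(u)=\frac1k\sinh(ku)$ for $K=-k^2<0$ (with $k>0$). *)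

(* Defs.v *)
From HB Require Import structures.
From mathcomp Require Import all_boot all_order all_algebra.
From mathcomp Require Import all_classical all_reals all_analysis.

Set Implicit Arguments.
Unset Strict Implicit.
Unset Printing Implicit Defensive.

Import Order.TTheory GRing.Theory Num.Theory.
Import numFieldNormedType.Exports.

Local Open Scope classical_set_scope.
Local Open Scope ring_scope.

(* Between finite-dimensional spaces and on an open set [U], continuity of all
   iterated directional derivatives is the usual class C^k. *)
Fixpoint Ck (R : realType) (k : nat) (V W : normedModType R) (U : set V)
    (f : V -> W) : Prop :=
  (forall x, U x -> {for x, continuous f}) /\
  match k with
  | 0%N => True
  | k'.+1 => forall v : V,
      (forall x, U x -> derivable f x v) /\ Ck k' U (fun x => 'D_v f x)
  end.

Definition smooth_on (R : realType) (V W : normedModType R) (U : set V)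
  (f : V -> W) : Prop := forall k, Ck k U f.

(* As the atlas need not be maximal, a preferred chart [chart_at p] around each
   point is part of the data.  A tangent vector at [p] is represented by its
   coordinate row vector in that chart. *)
Record smooth_manifold (R : realType) (n : nat) (M : topologicalType) := {
  mfd_hausdorff : hausdorff_space M;
  mfd_second_countable : @second_countable M;
  chart_index : Type;
  chart_dom : chart_index -> set M;
  chart_cod : chart_index -> set 'rV[R]_n;
  chart : chart_index -> M -> 'rV[R]_n;
  chart_inv : chart_index -> 'rV[R]_n -> M;
  chart_at : M -> chart_index;
  chart_atP : forall p, chart_dom (chart_at p) p;
  chart_dom_open : forall i, open (chart_dom i);
  chart_cod_open : forall i, open (chart_cod i);
  chart_in_cod : forall i p, chart_dom i p -> chart_cod i (chart i p);
  chart_inv_in_dom :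
    forall i x, chart_cod i x -> chart_dom i (chart_inv i x);
  chartK : forall i p, chart_dom i p -> chart_inv i (chart i p) = p;
  chart_invK : forall i x, chart_cod i x -> chart i (chart_inv i x) = x;
  chart_continuous :
    forall i p, chart_dom i p -> {for p, continuous (chart i)};
  chart_inv_continuous :
    forall i x, chart_cod i x -> {for x, continuous (chart_inv i)};
  transition_smooth : forall i j,
    smooth_on [set x | chart_cod i x /\ chart_dom j (chart_inv i x)]
      (chart j \o chart_inv i) }.

Record riemannian_metric (R : realType) (n : nat) (M : topologicalType)
    (A : smooth_manifold R n M) := {
  gram : chart_index A -> 'rV[R]_n -> 'M[R]_n;
  gram_smooth : forall i a b, smooth_on (chart_cod i) (fun x => gram i x a b);
  gram_sym : forall i x, chart_cod i x -> (gram i x)^T = gram i x;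
  gram_pos : forall i x (v : 'rV[R]_n), chart_cod i x -> v != 0 ->
    0 < (v *m gram i x *m v^T) 0 0;
  gram_transition : forall i j x (v w : 'rV[R]_n),
    chart_cod i x -> chart_dom j (chart_inv i x) ->
    let tau : 'rV[R]_n -> 'rV[R]_n := chart j \o chart_inv i in
    (v *m gram i x *m w^T) 0 0 =
    ('D_v tau x *m gram j (tau x) *m ('D_w tau x)^T) 0 0 }.

Section Geometry.
Context {R : realType} {n : nat} {M : topologicalType}.
Context {A : smooth_manifold R n M} (g : riemannian_metric A).
Implicit Types (i : chart_index A) (x v w z : 'rV[R]_n) (c : R -> M) (p : M).

Definition inner i x v w : R := (v *m gram g i x *m w^T) 0 0.

(* Gamma_x(v, w), from the Koszul formula for constant coordinate fields:
   g(Gamma(v, w), z) = (D_v g(w, z) + D_w g(v, z) - D_z g(v, w)) / 2. *)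
Definition christoffel i x v w : 'rV[R]_n :=
  (\row_d (2^-1 * ('D_v (fun y => inner i y w (delta_mx 0 d)) x
                 + 'D_w (fun y => inner i y v (delta_mx 0 d)) x
                 - 'D_(delta_mx 0 d) (fun y => inner i y v w) x)))
  *m invmx (gram g i x).

(* R(v, w)z = D_v D_w z - D_w D_v z; the coordinate fields commute. *)
Definition curvature i x v w z : 'rV[R]_n :=
  ('D_v (fun y => christoffel i y w z) x
     + christoffel i x v (christoffel i x w z))
  - ('D_w (fun y => christoffel i y v z) x
     + christoffel i x w (christoffel i x v z)).

Definition sectional i x v w : R :=
  inner i x (curvature i x v w w) v
  / (inner i x v v * inner i x w w - inner i x v w ^+ 2).

(* [row_free] says that [v] and [w] span a tangent plane. *)
Definition sectional_lt (K : R) : Prop :=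
  forall i x v w, chart_cod i x -> row_free (col_mx v w) ->
    sectional i x v w < K.

Definition inner_at p v w : R := inner (chart_at A p) (chart (chart_at A p) p) v w.

Definition norm_at p v : R := Num.sqrt (inner_at p v v).

(* Meant for open [U]; then so is the set below, by continuity of [c]. *)
Definition smooth_curve (U : set R) c : Prop :=
  (forall t, U t -> {for t, continuous c}) /\
  (forall i, smooth_on [set t | U t /\ chart_dom i (c t)] (chart i \o c)).

Definition velocity c (t : R) : 'rV[R]_n :=
  derive1 (chart (chart_at A (c t)) \o c) t.

(* D_{c'} c' *)
Definition acceleration c (t : R) : 'rV[R]_n :=
  let i := chart_at A (c t) in
  derive1 (derive1 (chart i \o c)) t
  + christoffel i (chart i (c t)) (velocity c t) (velocity c t).

Definition speed c (t : R) : R := norm_at (c t) (velocity c t).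

Definition geodesic_curvature c (s : R) : R := norm_at (c s) (acceleration c s).

Definition curve_length c (a b : R) : R :=
  \int[lebesgue_measure]_(t in `[a, b]) speed c t.

Definition geodesic_on (U : set R) c : Prop :=
  smooth_curve U c /\ (forall t, U t -> acceleration c t = 0).

(* The values of [c] outside [a, b] are irrelevant. *)
Definition geodesic_segment c (a b : R) : Prop :=
  exists (U : set R) (c' : R -> M),
    [/\ open U, `[a, b] `<=` U, geodesic_on U c' &
        forall t, t \in `[a, b] -> c t = c' t].

(* Geodesic completeness. *)
Definition complete_metric : Prop :=
  forall p v, exists c, [/\ geodesic_on setT c, c 0 = p & velocity c 0 = v].

(* A smooth curve on an interval [T] is one with a smooth extension to a
   neighbourhood of [T]. *)
Definition tractor_curve (T : set R) (eta : R -> M) : Prop :=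
  [/\ is_interval T,
      exists U : set R, [/\ open U, T `<=` U & smooth_curve U eta] &
      forall a b : R, `[a, b] `<=` T ->
        finite_set (`[a, b] `&` [set t | velocity eta t = 0])].

Definition arclength_curve (L : R) (gamma : R -> M) : Prop :=
  (exists U : set R, [/\ open U, `[0, L] `<=` U & smooth_curve U gamma]) /\
  (forall s, s \in `[0, L] -> speed gamma s = 1).

(* [gamma] on [0, L] is a tractrix of [eta] with pole length [ell] and poles
   [lambda s], pulled for [eps = 1] and pushed for [eps = -1].  The poles have
   unit speed since [gamma] has. *)
Definition tractrix (eps ell L : R) (T : set R) (gamma eta : R -> M)
    (lambda : R -> R -> M) : Prop :=
  [/\ eps = 1 \/ eps = -1, arclength_curve L gamma, tractor_curve T eta &
      forall s, s \in `[0, L] ->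
        [/\ geodesic_on setT (lambda s), lambda s 0 = gamma s,
            velocity (lambda s) 0 = eps *: velocity gamma s &
            exists t, T t /\ lambda s ell = eta t]].

(* |d_s r /\ d_u r| for r(s, u) = lambda s u. *)
Definition area_density (lambda : R -> R -> M) (su : R * R) : R :=
  let p := lambda su.1 su.2 in
  let ds := velocity (fun s => lambda s su.2) su.1 in
  let du := velocity (lambda su.1) su.2 in
  Num.sqrt (inner_at p ds ds * inner_at p du du - inner_at p ds du ^+ 2).

Definition swept_area (lambda : R -> R -> M) (L ell : R) : R :=
  \int[(lebesgue_measure \x lebesgue_measure)%E]_(su in `[0, L] `*` `[0, ell])
    area_density lambda su.

End Geometry.

Section SpaceForm.
Context {R : realType}.

Definition sinh (x : R) : R := (expR x - expR (- x)) / 2.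
Definition cosh (x : R) : R := (expR x + expR (- x)) / 2.

Definition jacobi (K u : R) : R :=
  if 0 < K then sin (Num.sqrt K * u) / Num.sqrt K
  else if K == 0 then u
  else sinh (Num.sqrt (- K) * u) / Num.sqrt (- K).

End SpaceForm.

(* Main.v *)
Require Import Defs.
From HB Require Import structures.
From mathcomp Require Import all_boot all_order all_algebra.
From mathcomp Require Import all_classical all_reals all_analysis.
From mathcomp Require Import measurable_realfun simple_functions.
From mathcomp Require Import ring lra.

(** Fix an arc length parameter s. The poles r(s, u) = lambda_s(u) form a
    variation by unit speed geodesics, so J = d_s r is a Jacobi field along
    each pole. By the Gauss lemma (pole_Jv_const) its component along the pole
    is the constant eps, and its normal part X = J - eps lambda_s' satisfies
    X(0) = 0 and |X'(0)| = kappa(s), because J = gamma' and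
    J' = eps D_gamma' gamma' at u = 0 (jD0). Hence the tractor has speed
    sqrt (1 + |X(ell)|^2) and the area density is |X|.

    The comparison needs only the function p = |X|^2 and q = p' / 2.
    Cauchy-Schwarz and the bound sec < K turn the Jacobi equation into
    q^2 - K p^2 < p q' where p > 0 (jacobi_scalars), that is, |X|'' > - K |X|.
    The Wronskian of |X| and J^K then increases, so sturm gives
    |X(u)| > kappa J^K(u) on ]0, ell] if kappa > 0; if kappa = 0 the weak
    inequality is trivial. Integration gives the first inequality for the
    length (length_comparison) and, by Fubini, the one for the area
    (area_comparison). The second inequality for the length is Jensen's
    inequality for the norm of (1, kappa J^K(ell)) (sqrt_mean), and the third
    one is immediate.

    Equality. If the last two lengths in the chain agree, the total curvature
    vanishes, hence kappa = 0 (mass_equality); if the areas agree, the strict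
    comparison forces kappa = 0 (area_equality). Then gamma is a geodesic, and
    by uniqueness of geodesics all poles lie on one complete geodesic c0, with
    lambda_s(u) = c0 (s + eps u) (poles_unroll), so that the tractor is a
    geodesic as well, X = 0 and all quantities take their extremal values
    (flat_unroll). Conversely a geodesic gamma has kappa = 0 (geodesic_flat).

    The poles are given one by one, so their smooth dependence on s has to be
    proved before J makes sense. In a chart they solve a first order system.
    Gronwall's inequality, applied to difference quotients in s, shows that
    these are Cauchy at one time if they are at another (flow_strict), and that
    the limit solves the linearized system (flow_derive). All poles have unit
    speed, so the poles near a given one stay for a common time in one chart
    (tube), and real induction carries differentiability from the base curve
    along the whole pole (sdiff_all, family_local). Differentiability in s is
    taken in the strict sense, which is stable under change of charts and
    yields joint continuity of J. Poles beyond the ends of [0, L] are supplied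
    by completeness; the two end poles themselves are negligible in the
    integrals. *)

Set Implicit Arguments.
Unset Strict Implicit.
Unset Printing Implicit Defensive.

Import Order.TTheory GRing.Theory Num.Theory.
Import numFieldNormedType.Exports.

Local Open Scope classical_set_scope.
Local Open Scope ring_scope.

(** * Epsilon-delta forms of limits and derivatives *)

Section EpsDelta.
Context {R : realType}.

Lemma continuous_epsP (V W : normedModType R) (f : V -> W) x :
  {for x, continuous f} <->
  forall e, 0 < e -> exists2 d, 0 < d &
    forall y, `|y - x| < d -> `|f y - f x| < e.
Proof.
split=> [/cvgrPdist_lt fx e e0|fx].
  have := fx _ e0; rewrite -[nbhs _]/(nbhs x).
  move=> /nbhs_ballP[d /= d0 dx]; exists d => // y yx.
  by rewrite distrC; apply: dx; rewrite -ball_normE /ball_/= distrC.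
apply/cvgrPdist_lt => e e0; have [d d0 dx] := fx _ e0.
apply/nbhs_ballP; exists d => //= y; rewrite -ball_normE /ball_/= => yx.
by rewrite distrC; apply: dx; rewrite distrC.
Qed.

Lemma nbhs_epsP (V : normedModType R) (x : V) (P : set V) :
  nbhs x P <-> exists2 d, 0 < d & forall y, `|y - x| < d -> P y.
Proof.
split=> [/nbhs_ballP[d /= d0 dx]|[d d0 dx]].
  by exists d => // y yx; apply: dx; rewrite -ball_normE /ball_/= distrC.
apply/nbhs_ballP; exists d => //= y; rewrite -ball_normE /ball_/= => yx.
by apply: dx; rewrite distrC.
Qed.

(** The bound e * |h| absorbs the quotient, so that the value at h = 0 needs no
    separate treatment. *)
Lemma is_derive_epsP (V W : normedModType R) (f : V -> W) x v df :
  is_derive x v f df <->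
  forall e, 0 < e -> exists2 d, 0 < d &
    forall h, `|h| < d -> `|f (h *: v + x) - f x - h *: df| <= e * `|h|.
Proof.
have E (l : W) (h : R) : h != 0 ->
    `|f (h *: v + x) - f x - h *: l| = `|h| * `|h^-1 *: (f (h *: v + x) - f x) - l|.
  by move=> h0; rewrite -normrZ scalerBr scalerA divff// scale1r.
split=> [[fx <-] e e0|fx].
  have /cvgrPdist_le/(_ _ e0) := fx.
  move=> /nbhs_ballP[d /= d0 dx]; exists d => // h hd.
  have [->|h0] := eqVneq h 0; first by rewrite !scale0r add0r !subrr !normr0 mulr0.
  rewrite (E _ _ h0) mulrC ler_wpM2r// distrC.
  by apply: (dx h) => //; rewrite -ball_normE /ball_/= sub0r normrN.
have L : h^-1 *: ((f \o shift x) (h *: v) - f x) @[h --> 0^'] --> df.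
  apply/cvgrPdist_le => e e0; have [d d0 dx] := fx _ e0.
  apply/nbhs_ballP; exists d => //= h; rewrite -ball_normE /ball_/= sub0r normrN => hd h0.
  have := dx _ hd; rewrite (E _ _ h0) mulrC ler_pM2r ?normr_gt0// distrC.
  exact.
apply: DeriveDef; first by apply/cvg_ex; exists df.
exact/cvg_lim.
Qed.

Lemma fin_eps m (P : 'I_m -> R -> Prop) :
  (forall j d d', d' <= d -> P j d -> P j d') ->
  (forall j, exists2 d, 0 < d & P j d) -> exists2 d, 0 < d & forall j, P j d.
Proof.
move=> Pm HP; suff [d d0 H] : exists2 d, 0 < d & forall j, j \in enum 'I_m -> P j d.
  by exists d => // j; apply: H; rewrite mem_enum.
elim: (enum 'I_m) => [|j r [d d0 H]]; first by exists 1.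
have [d' d'0 H'] := HP j; exists (Num.min d d'); first by rewrite lt_min d0.
move=> k; rewrite inE => /orP[/eqP->|kr].
  by apply: Pm H'; rewrite ge_min lexx orbT.
by apply: Pm (H _ kr); rewrite ge_min lexx.
Qed.

Lemma ler_scale_ratio (a c N h : R) : 0 <= a -> 0 < c -> N <= c * h -> a / c * N <= a * h.
Proof.
by move=> a0 c0 Nh; rewrite -mulrA ler_wpM2l// mulrC ler_pdivrMr// mulrC.
Qed.

Lemma ler_scale_ratioS (a c h : R) : 0 <= a -> 0 <= c -> 0 <= h -> c * (a / (c + 1) * h) <= a * h.
Proof.
move=> a0 c0 h0; have c1 : 0 < c + 1 by rewrite ltr_wpDl.
rewrite mulrA ler_wpM2r// mulrA ler_pdivrMr// mulrC ler_wpM2l//.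
by rewrite lerDl.
Qed.

Lemma derive_congr (V W : normedModType R) (f g : V -> W) x v (U : set V) :
  open U -> U x -> (forall y, U y -> f y = g y) -> 'D_v f x = 'D_v g x.
Proof.
move=> oU Ux fg; have [->|v0] := eqVneq v 0; first by rewrite !derive0.
by apply: near_eq_derive => //; apply: filterS (open_nbhs_nbhs (conj oU Ux)).
Qed.

Lemma derivable_congr (V W : normedModType R) (f g : V -> W) x v (U : set V) :
  open U -> U x -> (forall y, U y -> f y = g y) ->
  derivable f x v -> derivable g x v.
Proof.
move=> oU Ux fg; have [->|v0] := eqVneq v 0; first by move=> _; exact: derivable0.
by apply: near_eq_derivable => //; apply: filterS (open_nbhs_nbhs (conj oU Ux)).
Qed.

End EpsDelta.

(** * Closure properties of the class C^k *)

Section CkTheory.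
Context {R : realType} {V : normedModType R}.
Implicit Types (U : set V) (k : nat).

Lemma Ck_ext k (W : normedModType R) U (f g : V -> W) : open U ->
  (forall x, U x -> f x = g x) -> Ck k U f -> Ck k U g.
Proof.
move=> oU; have H (f0 g0 : V -> W) : (forall x, U x -> f0 x = g0 x) ->
    (forall x, U x -> {for x, continuous f0}) ->
    forall x, U x -> {for x, continuous g0}.
  move=> fg cf x Ux; apply/continuous_epsP => e e0.
  have [d d0 dx] := (continuous_epsP f0 x).1 (cf x Ux) e e0.
  have [d' d'0 d'x] := (nbhs_epsP x U).1 (open_nbhs_nbhs (conj oU Ux)).
  exists (Num.min d d') => [|y]; rewrite lt_min ?d0// => /andP[yd yd'].
  by rewrite -(fg y (d'x y yd')) -(fg x Ux) dx.
elim: k f g => [|k IH] f g fg /= [cf Hf]; split => //; try exact: H fg cf.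
- move=> v; have [df Df] := Hf v; split.
    by move=> x Ux; apply: (derivable_congr oU Ux fg); exact: df.
  apply: (IH ('D_v f)) => // x Ux; exact: (derive_congr _ oU Ux fg).
Qed.

Lemma Ck_sub k (W : normedModType R) U U' (f : V -> W) :
  U' `<=` U -> Ck k U f -> Ck k U' f.
Proof.
move=> UU; elim: k f => [|k IH] f /= [cf Hf]; split; auto.
by move=> v; have [df Df] := Hf v; split; auto.
Qed.

Lemma CkW k (W : normedModType R) U (f : V -> W) : Ck k.+1 U f -> Ck k U f.
Proof.
elim: k f => [|k IH] f [cf Hf]; first by split.
by split => // v; have [df Df] := Hf v; split => //; exact: IH.
Qed.

Lemma Ck_cst k (W : normedModType R) U (a : W) : Ck k U (cst a).
Proof.
elim: k a => [|k IH] a /=; split => //; try by move=> x _; exact: cst_continuous.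
move=> v; split; first by move=> x _; exact: derivable_cst.
by under eq_fun do rewrite derive_cst; exact: IH.
Qed.

Lemma Ck_cont k (W : normedModType R) U (f : V -> W) :
  Ck k U f -> forall x, U x -> {for x, continuous f}.
Proof. by case: k => [|k] []. Qed.

Lemma CkD k (W : normedModType R) U (f g : V -> W) : open U ->
  Ck k U f -> Ck k U g -> Ck k U (fun x => f x + g x).
Proof.
move=> oU; elim: k f g => [|k IH] f g Hf Hg; split => //.
- by move=> x Ux; apply: cvgD; [exact: (Ck_cont Hf)|exact: (Ck_cont Hg)].
- by move=> x Ux; apply: cvgD; [exact: (Ck_cont Hf)|exact: (Ck_cont Hg)].
- move=> v; have [df Df] := Hf.2 v; have [dg Dg] := Hg.2 v; split.
    by move=> x Ux; exact: (derivableD (df x Ux) (dg x Ux)).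
  apply: (Ck_ext oU _ (IH _ _ Df Dg)) => x Ux.
  by rewrite (deriveD (df x Ux) (dg x Ux)).
Qed.

Lemma CkM k U (f g : V -> R) : open U ->
  Ck k U f -> Ck k U g -> Ck k U (fun x => f x * g x).
Proof.
move=> oU; elim: k f g => [|k IH] f g Hf Hg; split => //.
- by move=> x Ux; apply: cvgM; [exact: (Ck_cont Hf)|exact: (Ck_cont Hg)].
- by move=> x Ux; apply: cvgM; [exact: (Ck_cont Hf)|exact: (Ck_cont Hg)].
- move=> v; have [df Df] := Hf.2 v; have [dg Dg] := Hg.2 v; split.
    by move=> x Ux; exact: (derivableM (df x Ux) (dg x Ux)).
  apply: (Ck_ext oU _ (CkD oU (IH _ _ (CkW Hf) Dg) (IH _ _ (CkW Hg) Df))) => x Ux.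
  by rewrite (deriveM (df x Ux) (dg x Ux)).
Qed.

Lemma CkV k U (f : V -> R) : open U -> (forall x, U x -> f x != 0) ->
  Ck k U f -> Ck k U (fun x => (f x)^-1).
Proof.
move=> oU f0; elim: k => [|k IH] Hf; split => //.
- by move=> x Ux; apply: cvgV; [exact: f0|exact: (Ck_cont Hf)].
- by move=> x Ux; apply: cvgV; [exact: f0|exact: (Ck_cont Hf)].
- move=> v; have [df Df] := Hf.2 v; split.
    by move=> x Ux; exact: (derivableV (f0 x Ux) (df x Ux)).
  have H := IH (CkW Hf).
  have H2 := CkM oU (@Ck_cst k R U (-1)) (CkM oU (CkM oU H H) Df).
  apply: (Ck_ext oU _ H2) => x Ux.
  by rewrite (deriveV (f0 x Ux) (df x Ux)) /cst mulN1r -exprVn expr2 scaleNr.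
Qed.

Lemma Ck_sum k U (I : Type) (r : seq I) (P : pred I) (f : I -> V -> R) : open U ->
  (forall i, P i -> Ck k U (f i)) -> Ck k U (fun x => \sum_(i <- r | P i) f i x).
Proof.
move=> oU H; elim: r => [|i r IH].
  by under eq_fun do rewrite big_nil; exact: Ck_cst.
under eq_fun do rewrite big_cons.
by case: (boolP (P i)) => // Pi; apply: CkD => //; exact: H.
Qed.

Lemma Ck_prod k U (I : Type) (r : seq I) (P : pred I) (f : I -> V -> R) : open U ->
  (forall i, P i -> Ck k U (f i)) -> Ck k U (fun x => \prod_(i <- r | P i) f i x).
Proof.
move=> oU H; elim: r => [|i r IH].
  by under eq_fun do rewrite big_nil; exact: Ck_cst.
under eq_fun do rewrite big_cons.
by case: (boolP (P i)) => // Pi; apply: CkM => //; exact: H.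
Qed.

Lemma CkN k U (f : V -> R) : open U -> Ck k U f -> Ck k U (fun x => - f x).
Proof.
move=> oU Hf; apply: (Ck_ext oU _ (CkM oU (@Ck_cst k R U (-1)) Hf)) => x _.
by rewrite /cst mulN1r.
Qed.

Lemma CkB k U (f g : V -> R) : open U ->
  Ck k U f -> Ck k U g -> Ck k U (fun x => f x - g x).
Proof. by move=> oU Hf Hg; apply: CkD => //; exact: CkN. Qed.

Lemma Ck_coord k m U (f : V -> 'rV[R]_m) (j : 'I_m) : open U ->
  Ck k U f -> Ck k U (fun x => f x 0 j).
Proof.
move=> oU; elim: k f => [|k IH] f Hf; split => //.
- move=> x Ux; apply: (@continuous_comp _ _ _ f (fun y : 'rV_m => y 0 j)).
    exact: (Ck_cont Hf).
  exact: coord_continuous.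
- move=> x Ux; apply: (@continuous_comp _ _ _ f (fun y : 'rV_m => y 0 j)).
    exact: (Ck_cont Hf).
  exact: coord_continuous.
- move=> v; have [df Df] := Hf.2 v; split.
    by move=> x Ux; exact: (derivable_mxP _ _ _).1 (df x Ux) 0 j.
  apply: (Ck_ext oU _ (IH _ Df)) => x Ux.
  by rewrite (derive_mx (df x Ux)) mxE.
Qed.

(** As l is linear, the derivative of f \o l in the direction v is the
    derivative of f in the direction l v, composed with l; the claim follows by
    induction on k. *)
Lemma Ck_complin k (V' : normedModType R) (l : V' -> V) U (f : V -> R) :
  linear l -> continuous l -> Ck k U f -> Ck k (l @^-1` U) (f \o l).
Proof.
move=> ll cl.
have lD x y : l (x + y) = l x + l y by have := ll 1 x y; rewrite !scale1r.
have l0 : l 0 = 0 by apply: (@addrI _ (l 0)); rewrite -lD !addr0.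
have lZ (a : R) x : l (a *: x) = a *: l x by have := ll a x 0; rewrite l0 !addr0.
have E (g : V -> R) x v : (fun h : R => h^-1 *: (((g \o l) \o shift x) (h *: v) - (g \o l) x))
    = (fun h : R => h^-1 *: ((g \o shift (l x)) (h *: l v) - g (l x))).
  by apply/funext => h /=; rewrite lD lZ.
elim: k f => [|k IH] f Hf; split => //.
- by move=> x Ux; apply: continuous_comp; [exact: cl|exact: (Ck_cont Hf)].
- by move=> x Ux; apply: continuous_comp; [exact: cl|exact: (Ck_cont Hf)].
- move=> v; have [df Df] := Hf.2 (l v); split.
    by move=> x Ux; rewrite /derivable E; exact: df.
  have -> : (fun x => 'D_v (f \o l) x) = 'D_(l v) f \o l.
    by apply/funext => x /=; rewrite /derive E.
  exact: IH.
Qed.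

End CkTheory.

(** * Strict differentiability, chain rules and symmetry of second derivatives *)

Section Strict.
Context {R : realType}.

Lemma mx_norm_le m (x : 'rV[R]_m) e : 0 <= e ->
  (`|x| <= e) <-> (forall j, `|x 0 j| <= e).
Proof.
move=> e0; rewrite /Num.Def.normr/= mx_normrE; split=> [xe j|xe].
  by apply: le_trans xe; exact: (@le_bigmax _ _ _ 0 (fun i : 'I_1 * 'I_m => `|x i.1 i.2|) (0, j)).
by apply: bigmax_le => // -[i j] _ /=; rewrite (ord1 i); exact: xe.
Qed.

Lemma coord_le_norm m (x : 'rV[R]_m) j : `|x 0 j| <= `|x|.
Proof. by move: j; apply/mx_norm_le. Qed.

Lemma is_derive_line (V W : normedModType R) (f : V -> W) y v t :
  derivable f (y + t *: v) v ->
  is_derive t 1 (fun t : R => f (y + t *: v)) ('D_v f (y + t *: v)).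
Proof.
move=> df; set phi := (fun t : R => _).
have E : (fun h : R => h^-1 *: ((phi \o shift t) (h *: (1:R)) - phi t)) =
   (fun h : R => h^-1 *: ((f \o shift (y + t *: v)) (h *: v) - f (y + t *: v))).
  apply/funext => h /=; rewrite /phi; congr (_ *: (f _ - _)).
  by rewrite [h *: 1]mulr1 scalerDl addrCA.
by apply: DeriveDef; rewrite /derivable /derive E.
Qed.

Lemma mvt (f df : R -> R) (a b : R) : a <= b ->
  (forall t, a <= t <= b -> is_derive t (1:R) f (df t)) ->
  exists2 c, a <= c <= b & f b - f a = df c * (b - a).
Proof.
move=> ab H; have H1 t : t \in `]a, b[ -> is_derive t (1:R) f (df t).
  by rewrite in_itv/= => /andP[t1 t2]; apply: H; rewrite !ltW.
have H2 : {within `[a, b], continuous f}.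
  apply: derivable_within_continuous => t; rewrite in_itv/= => /H.
  by case.
by have [c] := MVT_segment ab H1 H2; rewrite in_itv/=; exists c.
Qed.

Lemma dir_mvt (V : normedModType R) (f : V -> R) y v :
  (forall t : R, 0 <= t <= 1 -> derivable f (y + t *: v) v) ->
  exists2 t : R, 0 <= t <= 1 & f (y + v) - f y = 'D_v f (y + t *: v).
Proof.
move=> df; pose phi (t : R) : R := f (y + t *: v).
pose D (t : R) : R := 'D_v f (y + t *: v).
have dphi (t : R) : 0 <= t <= 1 -> is_derive t (1:R) phi (D t).
  by move=> t01; apply: is_derive_line; exact: df.
have [t t01 E] := mvt ler01 dphi; exists t => //.
by move: E; rewrite /phi /D scale1r scale0r addr0 subr0 mulr1.
Qed.

Lemma is_deriveZdir (V W : normedModType R) (f : V -> W) x v (a : R) :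
  derivable f x v -> is_derive x (a *: v) f (a *: 'D_v f x).
Proof.
move=> /derivableP/is_derive_epsP dfx; apply/is_derive_epsP => e e0.
have a1 : 0 < `|a| + 1 by rewrite ltr_wpDl.
have [d d0 dx] := dfx (e / (`|a| + 1)) (divr_gt0 e0 a1).
exists (d / (`|a| + 1)) => [|h]; first exact: divr_gt0.
rewrite ltr_pdivlMr// => hd; rewrite !scalerA.
have ha : `|h * a| < d.
  by apply: le_lt_trans hd; rewrite normrM ler_wpM2l// lerDl.
apply: le_trans (dx _ ha) _; rewrite -mulrA ler_wpM2l ?(ltW e0)//.
by rewrite normrM mulrC -mulrA ler_piMr// mulrC ler_pdivrMl// mulr1 lerDl.
Qed.

Lemma deriveZdir (V W : normedModType R) (f : V -> W) x v (a : R) :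
  derivable f x v -> 'D_(a *: v) f x = a *: 'D_v f x.
Proof. by move=> /is_deriveZdir -/(_ a)[]. Qed.

Lemma derivable_shift (V W : normedModType R) (f : V -> W) x v a :
  is_derive (x + a) v f ('D_v f (x + a)) ->
  is_derive x v (fun y => f (y + a)) ('D_v f (x + a)).
Proof.
have E : (fun h : R => h^-1 *: (((fun y => f (y + a)) \o shift x) (h *: v) - f (x + a))) =
   (fun h : R => h^-1 *: ((f \o shift (x + a)) (h *: v) - f (x + a))).
  by apply/funext => h /=; rewrite -addrA.
by move=> [df _]; apply: DeriveDef; rewrite /derivable /derive E.
Qed.

Section C1.
Context {V : normedModType R} (U : set V) (oU : open U).
Implicit Type f : V -> R.

Lemma open_eps x : U x -> exists2 d, 0 < d & forall y, `|y - x| < d -> U y.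
Proof. by move=> Ux; apply/(nbhs_epsP x U)/open_nbhs_nbhs. Qed.

(** Mean value theorem on the segment from y to y + t v: the base point y is
    allowed to move, which is what additivity in the direction and strict
    differentiability require. *)
Lemma C1_near f x v e : Ck 1 U f -> U x -> 0 < e ->
  exists2 d, 0 < d & forall y (t : R), `|y - x| < d -> `|t| < d ->
   `|f (y + t *: v) - f y - t * 'D_v f x| <= e * `|t|.
Proof.
move=> [_ /(_ v)[df [cD _]]] Ux e0.
have [d1 d10 d1U] := open_eps Ux.
have [d2 d20 d2D] := (continuous_epsP _ _).1 (cD x Ux) e e0.
pose m := Num.min d1 d2.
have m0 : 0 < m by rewrite lt_min d10.
have v1 : 0 < `|v| + 1 by rewrite ltr_wpDl.
exists (Num.min (m / 2) (m / 2 / (`|v| + 1))).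
  by rewrite lt_min !divr_gt0.
move=> y t; rewrite lt_min => /andP[ym _]; rewrite lt_min => /andP[_ tm].
have key (th : R) : 0 <= th <= 1 -> `|y + th *: (t *: v) - x| < m.
  move=> /andP[th0 th1]; rewrite addrAC (le_lt_trans (ler_normD _ _))//.
  rewrite (splitr m) ltr_leD// !normrZ (ger0_norm th0).
  move: tm; rewrite ltr_pdivlMr// => /ltW; apply: le_trans.
  apply: (@le_trans _ _ (`|t| * `|v|)); first by rewrite ler_piMl// mulr_ge0.
  by rewrite ler_wpM2l// lerDl.
have [th th01 ->] : exists2 th : R, 0 <= th <= 1 &
    f (y + t *: v) - f y = 'D_(t *: v) f (y + th *: (t *: v)).
  apply: dir_mvt => th /key; rewrite lt_min => /andP[h1 _].
  by case: (is_deriveZdir t (df _ (d1U _ h1))).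
have := key _ th01; rewrite lt_min => /andP[h1 h2].
rewrite (deriveZdir _ (df _ (d1U _ h1))) -[_ *: _]/(_ * _) -mulrBr normrM mulrC.
by rewrite ler_wpM2r// ltW// d2D.
Qed.

(** Move first along v and then along w; the second step starts at a moving
    point, whence the uniformity in C1_near. *)
Lemma deriveDdir f x v w : Ck 1 U f -> U x ->
  'D_(v + w) f x = 'D_v f x + 'D_w f x.
Proof.
move=> Hf Ux; suff [] : is_derive x (v + w) f ('D_v f x + 'D_w f x) by [].
apply/is_derive_epsP => e e0.
have e2 : 0 < e / 2 by rewrite divr_gt0.
have [d1 d10 h1] := C1_near v Hf Ux e2.
have [d2 d20 h2] := C1_near w Hf Ux e2.
have v1 : 0 < `|v| + 1 by rewrite ltr_wpDl.
exists (Num.min d1 (Num.min d2 (d2 / (`|v| + 1)))).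
  by rewrite !lt_min d10 d20 divr_gt0.
move=> h; rewrite !lt_min => /and3P[hd1 hd2]; rewrite ltr_pdivlMr// => hd3.
have a1 := h1 x h; rewrite subrr normr0 in a1; have {}a1 := a1 d10 hd1.
have a2 : `|x + h *: v - x| < d2.
  rewrite addrC addKr normrZ; apply: le_lt_trans hd3.
  by rewrite ler_wpM2l// lerDl.
have {}a2 := h2 _ h a2 hd2.
have -> : f (h *: (v + w) + x) - f x - h *: ('D_v f x + 'D_w f x) =
   (f (x + h *: v + h *: w) - f (x + h *: v) - h * 'D_w f x) +
   (f (x + h *: v) - f x - h * 'D_v f x).
  by rewrite scalerDr [_ + x]addrC addrA -[h *: (_ + _)]/(h * (_ + _)); ring.
by rewrite (le_trans (ler_normD _ _))// [e]splitr mulrDl lerD.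
Qed.

(** Two applications of the mean value theorem to the second difference of f
    over the parallelogram spanned by h v and h w. *)
Lemma second_difference f x v w e : Ck 2 U f -> U x -> 0 < e ->
  exists2 d, 0 < d & forall h : R, 0 < h < d ->
   `|(f (x + h *: v + h *: w) - f (x + h *: v) - f (x + h *: w) + f x)
     - h ^+ 2 * 'D_w ('D_v f) x| <= e * h ^+ 2.
Proof.
move=> [_ /(_ v)[df [_ /(_ w)[dDf [cDD _]]]]] Ux e0.
have [d1 d10 d1U] := open_eps Ux.
have [d2 d20 d2D] := (continuous_epsP _ _).1 (cDD x Ux) e e0.
pose m := Num.min d1 d2.
have m0 : 0 < m by rewrite lt_min d10.
have v1 : 0 < `|v| + `|w| + 1 by rewrite ltr_wpDl// addr_ge0.
exists (m / (`|v| + `|w| + 1)); first exact: divr_gt0.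
move=> h /andP[h0]; rewrite ltr_pdivlMr// => hm.
have key (s t : R) : 0 <= s <= 1 -> 0 <= t <= 1 ->
    `|x + s *: (h *: v) + t *: (h *: w) - x| < m.
  move=> /andP[s0 s1] /andP[t0 t1].
  rewrite -[x + _ + _]addrA [x + _]addrC addrK.
  rewrite (le_lt_trans (ler_normD _ _))// !normrZ (gtr0_norm h0).
  rewrite !ger0_norm//; apply: le_lt_trans hm.
  rewrite -addrA mulrDr mulrDr; apply: lerD.
    by rewrite ler_piMl// mulr_ge0// ltW.
  rewrite (@le_trans _ _ (h * `|w|))//; last by rewrite lerDl mulr1 ltW.
  by rewrite ler_piMl// mulr_ge0// ltW.
have keyU (s t : R) : 0 <= s <= 1 -> 0 <= t <= 1 ->
    U (x + s *: (h *: v) + t *: (h *: w)).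
  by move=> s1 t1; apply: d1U; have := key s t s1 t1; rewrite lt_min => /andP[].
pose g y := f (y + h *: w) - f y.
have i1 : ((0 : R) <= 1) && ((1 : R) <= 1) by rewrite ler01 lexx.
have i0 : ((0 : R) <= 0) && ((0 : R) <= 1) by rewrite ler01 lexx.
have dg (s : R) : 0 <= s <= 1 -> is_derive (x + s *: (h *: v)) (h *: v) g
   (h *: ('D_v f (x + s *: (h *: v) + h *: w) - 'D_v f (x + s *: (h *: v)))).
  move=> s1; have := keyU s 1 s1 i1; rewrite scale1r => u1.
  have := keyU s 0 s1 i0; rewrite scale0r addr0 => u0.
  rewrite scalerBr; apply: is_deriveB.
    rewrite -(deriveZdir _ (df _ u1)); apply: derivable_shift.
    by apply: derivableP; case: (is_deriveZdir h (df _ u1)).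
  exact: is_deriveZdir (df _ u0).
have [s s01] : exists2 s : R, 0 <= s <= 1 &
   g (x + h *: v) - g x = 'D_(h *: v) g (x + s *: (h *: v)).
  by apply: dir_mvt => s /dg[].
case: (dg _ s01) => _ -> E1.
have [t t01 E2] : exists2 t : R, 0 <= t <= 1 &
   'D_v f (x + s *: (h *: v) + h *: w) - 'D_v f (x + s *: (h *: v)) =
   'D_(h *: w) ('D_v f) (x + s *: (h *: v) + t *: (h *: w)).
  apply: (@dir_mvt V ('D_v f : V -> R) _ (h *: w)) => t t01.
  by case: (is_deriveZdir h (dDf _ (keyU _ _ s01 t01))).
rewrite (deriveZdir _ (dDf _ (keyU _ _ s01 t01))) in E2.
have -> : f (x + h *: v + h *: w) - f (x + h *: v) - f (x + h *: w) + f x =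
   g (x + h *: v) - g x by rewrite /g; ring.
rewrite E1 E2 -![_ *: (_ : R)]/(_ * _) mulrA -expr2 -mulrBr normrM mulrC.
rewrite (ger0_norm (sqr_ge0 h)) ler_wpM2r ?sqr_ge0// ltW// d2D//.
by have := key _ _ s01 t01; rewrite lt_min => /andP[].
Qed.

(** The second difference is symmetric in v and w, so both iterated derivatives
    are its limit after division by h^2. *)
Lemma schwarz f x v w : Ck 2 U f -> U x -> 'D_w ('D_v f) x = 'D_v ('D_w f) x.
Proof.
move=> Hf Ux; apply/eqP; rewrite -subr_eq0 -normr_le0.
apply/ler_addgt0Pl => e e0; rewrite addr0.
have e2 : 0 < e / 2 by rewrite divr_gt0.
have [d1 d10 h1] := second_difference v w Hf Ux e2.
have [d2 d20 h2] := second_difference w v Hf Ux e2.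
pose h := Num.min d1 d2 / 2.
have m0 : 0 < Num.min d1 d2 by rewrite lt_min d10.
have h0 : 0 < h by rewrite divr_gt0.
have hm : h < Num.min d1 d2 by rewrite ltr_pdivrMr// ltr_pMr// ltr1n.
move: (hm); rewrite lt_min => /andP[hd1 hd2].
have := h1 h; rewrite h0 hd1 => /(_ isT).
have := h2 h; rewrite h0 hd2 => /(_ isT).
rewrite [x + h *: w + h *: v]addrAC.
set a := f (_ + _ + _); set b := f _; set c := f _.
set A := 'D_w _ x; set B := 'D_v _ x => H2 H1.
rewrite -(ler_pM2l (exprn_gt0 2 h0)) -{1}(ger0_norm (sqr_ge0 h)) -normrM.
have -> : h ^+ 2 * (A - B) = (a - b - c + f x - h ^+ 2 * B) - (a - c - b + f x - h ^+ 2 * A) by ring.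
apply: le_trans (ler_normB _ _) _.
have -> : h ^+ 2 * e = e / 2 * h ^+ 2 + e / 2 * h ^+ 2 by field.
exact: (lerD H2 H1).
Qed.

End C1.

Section C1row.
Context {m : nat} (U : set 'rV[R]_m) (oU : open U).
Implicit Type f : 'rV[R]_m -> R.

Lemma derive_sumE f x v : Ck 1 U f -> U x ->
  'D_v f x = \sum_j v 0 j * 'D_(delta_mx 0 j) f x.
Proof.
move=> Hf Ux; rewrite {1}(row_sum_delta v).
have H : forall r : seq 'I_m,
  'D_(\sum_(j <- r) v 0 j *: delta_mx 0 j) f x =
  \sum_(j <- r) v 0 j * 'D_(delta_mx 0 j) f x.
  elim=> [|j r IH]; first by rewrite !big_nil derive0.
  rewrite !big_cons (deriveDdir oU _ _ Hf Ux) IH deriveZdir//.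
  by have [_ /(_ (delta_mx 0 j))[df _]] := Hf; exact: df.
exact: H.
Qed.

End C1row.

(** Strict differentiability: the increment is compared at two moving points.
    Unlike plain differentiability it yields local Lipschitz bounds, and it is
    the form in which differentiability is propagated along a flow. *)
Definition strict (V W : normedModType R) (f : V -> W) x (df : V -> W) :=
  forall e, 0 < e -> exists2 d, 0 < d & forall y z,
    `|y - x| < d -> `|z - x| < d -> `|f y - f z - df (y - z)| <= e * `|y - z|.

Lemma strict_congr (V W : normedModType R) (f g : V -> W) x df :
  (\forall y \near x, f y = g y) -> strict f x df -> strict g x df.
Proof.
move=> /nbhs_epsP[d1 d10 fg] sf e e0; have [d d0 H] := sf e e0.
exists (Num.min d1 d) => [|y z]; first by rewrite lt_min d10.
by rewrite !lt_min => /andP[y1 y2] /andP[z1 z2]; rewrite -!fg// H.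
Qed.

Lemma strict_mx (V : normedModType R) m (f : V -> 'rV[R]_m) x (df : V -> 'rV[R]_m) :
  strict f x df <-> forall j, strict (fun y => f y 0 j) x (fun y => df y 0 j).
Proof.
split=> [sf j e e0|sf e e0].
  have [d d0 H] := sf e e0; exists d => // y z yd zd.
  by apply: le_trans (H y z yd zd); have := coord_le_norm (f y - f z - df (y - z)) j; rewrite !mxE.
have [|j|d d0 H] := @fin_eps R m (fun j d => forall y z, `|y - x| < d -> `|z - x| < d ->
    `|f y 0 j - f z 0 j - df (y - z) 0 j| <= e * `|y - z|).
- by move=> j d d' dd H y z yd zd; apply: H; [exact: lt_le_trans yd dd|exact: lt_le_trans zd dd].
- exact: sf.
exists d => // y z yd zd; apply/mx_norm_le; first by rewrite mulr_ge0// ltW.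
by move=> j; rewrite !mxE; exact: H.
Qed.

Lemma is_derive_mx (V : normedModType R) m (f : V -> 'rV[R]_m) x v (df : 'rV[R]_m) :
  is_derive x v f df <-> forall j, is_derive x v (fun y => f y 0 j) (df 0 j).
Proof.
split=> [[H <-] j|H].
  by rewrite (derive_mx H) mxE; apply: derivableP; move/derivable_mxP : H.
have H0 : derivable f x v by apply/derivable_mxP => i j; rewrite (ord1 i); case: (H j).
apply: DeriveDef => //; rewrite (derive_mx H0); apply/rowP => j; rewrite mxE.
by case: (H j).
Qed.

Lemma strict_derive (V W : normedModType R) (f : V -> W) x v (df : V -> W) :
  (forall h : R, df (h *: v) = h *: df v) -> strict f x df -> is_derive x v f (df v).
Proof.
move=> dfh sf; apply/is_derive_epsP => e e0.
have v1 : 0 < `|v| + 1 by rewrite ltr_wpDl.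
have [d d0 H] := sf (e / (`|v| + 1)) (divr_gt0 e0 v1).
exists (d / (`|v| + 1)) => [|h]; first exact: divr_gt0.
rewrite ltr_pdivlMr// => hd.
have hv : `|h *: v| < d.
  by apply: le_lt_trans hd; rewrite normrZ ler_wpM2l// lerDl.
have := H (h *: v + x) x; rewrite addrK subrr normr0 => /(_ hv d0).
rewrite dfh => /le_trans; apply; rewrite normrZ -mulrA ler_wpM2l ?(ltW e0)//.
by rewrite mulrCA ler_piMr// mulrC ler_pdivrMr// mul1r lerDl.
Qed.

Lemma strict_lip (V W : normedModType R) (f : V -> W) x df C : 0 <= C ->
  (forall w, `|df w| <= C * `|w|) -> strict f x df ->
  forall e, 0 < e -> exists2 d, 0 < d & forall y z,
    `|y - x| < d -> `|z - x| < d -> `|f y - f z| <= (C + e) * `|y - z|.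
Proof.
move=> C0 dfC sf e e0; have [d d0 H] := sf e e0.
exists d => // y z yd zd; rewrite -(subrK (df (y - z)) (f y - f z)).
apply: le_trans (ler_normD _ _) _; rewrite addrC mulrDl; apply: lerD => //.
exact: H.
Qed.

Lemma strict_cont (V W : normedModType R) (f : V -> W) x df C : 0 <= C ->
  (forall w, `|df w| <= C * `|w|) -> strict f x df -> {for x, continuous f}.
Proof.
move=> C0 dfC sf; have [d d0 H] := strict_lip C0 dfC sf ltr01.
apply/continuous_epsP => e e0.
have C1 : 0 < C + 1 by rewrite ltr_wpDl.
exists (Num.min d (e / (C + 1))); first by rewrite lt_min d0 divr_gt0.
move=> y; rewrite lt_min => /andP[yd ye]; apply: le_lt_trans (H y x yd _) _.
  by rewrite subrr normr0.
by move: ye; rewrite ltr_pdivlMr// mulrC.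
Qed.

Lemma strict_comp (U V W : normedModType R) (f : U -> V) (g : V -> W) x df dg C C' :
  0 <= C -> 0 <= C' ->
  (forall w, `|df w| <= C * `|w|) -> (forall w, `|dg w| <= C' * `|w|) ->
  (forall a b, dg (a - b) = dg a - dg b) ->
  strict f x df -> strict g (f x) dg -> strict (g \o f) x (dg \o df).
Proof.
move=> C0 C'0 dfC dgC dgB sf sg e e0.
have C1 : 0 < C + 1 by rewrite ltr_wpDl.
have C'1 : 0 < C' + 1 by rewrite ltr_wpDl.
have e2 : 0 < e / 2 by rewrite divr_gt0.
have [d1 d10 H1] := sg (e / 2 / (C + 1)) (divr_gt0 e2 C1).
have [d2 d20 H2] := sf (e / 2 / (C' + 1)) (divr_gt0 e2 C'1).
have [d3 d30 H3] := strict_lip C0 dfC sf ltr01.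
have m0 : 0 < Num.min d2 d3 by rewrite lt_min d20.
exists (Num.min (Num.min d2 d3) (d1 / (C + 1))); first by rewrite lt_min m0 divr_gt0.
move=> y z; rewrite !lt_min ltr_pdivlMr// => /andP[/andP[y2 y3] y1].
rewrite ltr_pdivlMr// => /andP[/andP[z2 z3] z1].
have x3 : `|x - x| < d3 by rewrite subrr normr0.
have fy : `|f y - f x| < d1.
  by apply: le_lt_trans (H3 _ _ y3 x3) _; rewrite mulrC.
have fz : `|f z - f x| < d1.
  by apply: le_lt_trans (H3 _ _ z3 x3) _; rewrite mulrC.
have -> : (g \o f) y - (g \o f) z - (dg \o df) (y - z) =
   (g (f y) - g (f z) - dg (f y - f z)) + dg (f y - f z - df (y - z)).
  by rewrite /= [dg (_ - df _)]dgB addrA subrK.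
apply: le_trans (ler_normD _ _) _; rewrite [e in leRHS]splitr mulrDl; apply: lerD.
  apply: le_trans (H1 _ _ fy fz) _; apply: ler_scale_ratio => //; first exact: ltW.
  exact: H3.
apply: le_trans (dgC _) _; apply: le_trans (ler_wpM2l C'0 (H2 _ _ y2 z2)) _.
by apply: ler_scale_ratioS => //; exact: ltW.
Qed.

(** The increment h l + o(h) of f falls under the strict estimate of g at f x,
    and the boundedness of dg absorbs its error term. *)
Lemma is_derive_strict (U V W : normedModType R) (f : U -> V) (g : V -> W) x v l dg C' :
  0 <= C' -> (forall w, `|dg w| <= C' * `|w|) ->
  (forall a b, dg (a - b) = dg a - dg b) -> (forall (h : R) w, dg (h *: w) = h *: dg w) ->
  is_derive x v f l -> strict g (f x) dg -> is_derive x v (g \o f) (dg l).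
Proof.
move=> C'0 dgC dgB dgZ /is_derive_epsP df sg; apply/is_derive_epsP => e e0.
have C1 : 0 < `|l| + 1 by rewrite ltr_wpDl.
have C'1 : 0 < C' + 1 by rewrite ltr_wpDl.
have e2 : 0 < e / 2 by rewrite divr_gt0.
have [d1 d10 H1] := sg (e / 2 / (`|l| + 1)) (divr_gt0 e2 C1).
have [d2 d20 H2] := df (e / 2 / (C' + 1)) (divr_gt0 e2 C'1).
have [d3 d30 H3] := df 1 ltr01.
have m0 : 0 < Num.min d2 d3 by rewrite lt_min d20.
exists (Num.min (Num.min d2 d3) (d1 / (`|l| + 1))); first by rewrite lt_min m0 divr_gt0.
move=> h; rewrite !lt_min ltr_pdivlMr// => /andP[/andP[h2 h3] h1].
have L : `|f (h *: v + x) - f x| <= (`|l| + 1) * `|h|.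
  rewrite -(subrK (h *: l) (_ - _)) (le_trans (ler_normD _ _))//.
  rewrite addrC mulrDl; apply: lerD; last exact: H3.
  by rewrite normrZ mulrC.
have fy : `|f (h *: v + x) - f x| < d1 by apply: le_lt_trans L _; rewrite mulrC.
have fz : `|f x - f x| < d1 by rewrite subrr normr0.
have -> : (g \o f) (h *: v + x) - (g \o f) x - h *: dg l =
   (g (f (h *: v + x)) - g (f x) - dg (f (h *: v + x) - f x)) + dg (f (h *: v + x) - f x - h *: l).
  by rewrite /= [dg (_ - _ *: l)]dgB dgZ addrA subrK.
apply: le_trans (ler_normD _ _) _; rewrite [e in leRHS]splitr mulrDl; apply: lerD.
  by apply: le_trans (H1 _ _ fy fz) _; apply: ler_scale_ratio => //; exact: ltW.
apply: le_trans (dgC _) _; apply: le_trans (ler_wpM2l C'0 (H2 _ h2)) _.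
by apply: ler_scale_ratioS => //; exact: ltW.
Qed.

Section C1strict.
Context {m : nat} (U : set 'rV[R]_m) (oU : open U).
Implicit Type f : 'rV[R]_m -> R.

Lemma C1_derivable f x v : Ck 1 U f -> U x -> derivable f x v.
Proof. by move=> [_ /(_ v)[df _]] Ux; exact: df. Qed.

Lemma deriveBdir f x v w : Ck 1 U f -> U x -> 'D_(v - w) f x = 'D_v f x - 'D_w f x.
Proof.
move=> Hf Ux; rewrite (deriveDdir oU _ _ Hf Ux) -scaleN1r deriveZdir ?scaleN1r//.
exact: C1_derivable.
Qed.

Lemma derive_bound f x : Ck 1 U f -> U x ->
  exists2 C, 0 <= C & forall w, `|'D_w f x| <= C * `|w|.
Proof.
move=> Hf Ux; exists (\sum_j `|'D_(delta_mx 0 j) f x|); first exact: sumr_ge0.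
move=> w; rewrite (derive_sumE oU _ Hf Ux) mulr_suml (le_trans (ler_norm_sum _ _ _))//.
by apply: ler_sum => j _; rewrite normrM mulrC ler_wpM2l// coord_le_norm.
Qed.

(** Telescoping over the coordinates reduces the increment of f to increments
    along the axes, where C1_near applies. *)
Lemma C1_strict f x : Ck 1 U f -> U x -> strict f x (fun v => 'D_v f x).
Proof.
move=> Hf Ux e e0; have [d1 d10 d1U] := open_eps oU Ux.
have m1 : 0 < (m%:R + 1 : R) by rewrite ltr_wpDl.
have e1 : 0 < e / (m%:R + 1) by rewrite divr_gt0.
have [|j|d2 d20 H2] := @fin_eps R m (fun j d => forall y, `|y - x| < d ->
    `|'D_(delta_mx 0 j) f y - 'D_(delta_mx 0 j) f x| < e / (m%:R + 1)).
- by move=> j d d' dd H y yd; apply: H; exact: lt_le_trans yd dd.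
- have [_ /(_ (delta_mx 0 j))[_ [cD _]]] := Hf.
  exact: (continuous_epsP _ _).1 (cD x Ux) _ e1.
exists (Num.min d1 d2) => [|y z]; first by rewrite lt_min d10.
move=> yd zd; have seg (t : R) : 0 <= t <= 1 -> `|z + t *: (y - z) - x| < Num.min d1 d2.
  move=> /andP[t0 t1].
  have -> : z + t *: (y - z) - x = t *: (y - x) + (1 - t) *: (z - x).
    rewrite scalerBl scale1r addrCA -scalerBr opprB addrA subrK.
    by rewrite addrAC.
  apply: le_lt_trans (ler_normD _ _) _; rewrite !normrZ (ger0_norm t0) ger0_norm ?subr_ge0//.
  have [->|tn0] := eqVneq t 0; first by rewrite mul0r subr0 mul1r add0r.
  have -> : Num.min d1 d2 = t * Num.min d1 d2 + (1 - t) * Num.min d1 d2 by ring.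
  apply: ltr_leD; first by rewrite ltr_pM2l// lt_neqAle eq_sym tn0.
  by rewrite ler_wpM2l ?subr_ge0// ltW.
have [t t01] : exists2 t : R, 0 <= t <= 1 &
    f (z + (y - z)) - f z = 'D_(y - z) f (z + t *: (y - z)).
  apply: dir_mvt => t /seg; rewrite lt_min => /andP[/d1U s1 _].
  exact: C1_derivable.
rewrite [z + (y - z)]addrC subrK => ->; have := seg _ t01; rewrite lt_min => /andP[/d1U U1 /H2 H].
rewrite !(derive_sumE oU _ Hf)// -sumrB (le_trans (ler_norm_sum _ _ _))//.
apply: (@le_trans _ _ (\sum_(j < m) (e / (m%:R + 1)) * `|y - z|)).
  apply: ler_sum => j _; rewrite -mulrBr normrM mulrC ler_pM//; first exact: ltW.
  exact: coord_le_norm.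
rewrite sumr_const card_ord -[leLHS]mulr_natl mulrA ler_wpM2r// mulrCA.
by rewrite ler_piMr ?(ltW e0)// ler_pdivrMr// mul1r lerDl.
Qed.

Lemma C1_chain (V : normedModType R) (c : V -> 'rV[R]_m) x v l f : Ck 1 U f -> U (c x) ->
  is_derive x v c l -> is_derive x v (f \o c) ('D_l f (c x)).
Proof.
move=> Hf Ux dc; have [C C0 HC] := derive_bound Hf Ux.
apply: (is_derive_strict C0 HC _ _ dc (C1_strict Hf Ux)) => [a b|h w].
  exact: deriveBdir.
by apply: deriveZdir; exact: C1_derivable.
Qed.


Definition segment_closed (V : normedModType R) (B : set V) :=
  forall x y (t : R), B x -> B y -> 0 <= t <= 1 -> B (y + t *: (x - y)).

Lemma compact_bound (V : normedModType R) (B : set V) (f : V -> R) : compact B ->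
  (forall x, B x -> {for x, continuous f}) -> exists2 C, 0 <= C & forall x, B x -> `|f x| <= C.
Proof.
move=> cB cf; have [B0|/set0P B0] := eqVneq B set0; first by exists 0 => // x; rewrite B0.
have cf' : {within B, continuous (fun x => `|f x|)}.
  apply: continuous_in_subspaceT => x /[1!inE] Bx.
  apply: (@continuous_comp _ _ _ f (fun y : R => `|y|)); first exact: cf.
  exact: norm_continuous.
have [c _ H] := compact_EVT_max B0 cB cf'.
by exists `|f c| => // x Bx; apply: H; rewrite inE.
Qed.

Section Compact.
Context (B : set 'rV[R]_m) (BU : B `<=` U)
  (cB : compact B) (vB : segment_closed B).

Lemma C1_compact f : Ck 1 U f -> exists2 C, 0 <= C &
  (forall x w, B x -> `|'D_w f x| <= C * `|w|) /\
  (forall x y, B x -> B y -> `|f x - f y| <= C * `|x - y|).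
Proof.
move=> Hf; have HD j : exists2 C, 0 <= C & forall x, B x -> `|'D_(delta_mx 0 j) f x| <= C.
  apply: compact_bound => // x Bx.
  by have [_ /(_ (delta_mx 0 j))[_ [cD _]]] := Hf; apply: cD; exact: BU.
have [C HC] := @choice 'I_m R (fun j C => 0 <= C /\ forall x, B x -> `|'D_(delta_mx 0 j) f x| <= C)
  (fun j => let: ex_intro2 C C0 H := HD j in ex_intro _ C (conj C0 H)).
have C0 : 0 <= \sum_j C j by apply: sumr_ge0 => j _; case: (HC j).
have H1 x w : B x -> `|'D_w f x| <= (\sum_j C j) * `|w|.
  move=> Bx; rewrite (derive_sumE oU _ Hf (BU Bx)) mulr_suml (le_trans (ler_norm_sum _ _ _))//.
  apply: ler_sum => j _; rewrite normrM mulrC ler_pM//; last exact: coord_le_norm.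
  by case: (HC j) => _; apply.
exists (\sum_j C j) => //; split => // x y Bx By.
have [t t01] : exists2 t : R, 0 <= t <= 1 &
    f (y + (x - y)) - f y = 'D_(x - y) f (y + t *: (x - y)).
  by apply: dir_mvt => t t01; apply: C1_derivable Hf _; apply: BU; exact: vB.
by rewrite [y + (x - y)]addrC subrK => ->; apply: H1; exact: vB.
Qed.

(** Bounds of the first and second order Taylor remainders that are uniform on
    a compact convex set; the last one is the estimate that makes difference
    quotients of a flow approximate solutions of the linearized equation. *)
Lemma C2_compact f : Ck 2 U f -> exists2 C, 0 <= C &
  [/\ forall x w, B x -> `|'D_w f x| <= C * `|w|,
      forall x y, B x -> B y -> `|f x - f y| <= C * `|x - y|,
      forall x y w, B x -> B y -> `|'D_w f x - 'D_w f y| <= C * `|x - y| * `|w| &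
      forall x y z, B x -> B y -> B z ->
       `|f x - f y - 'D_(x - y) f z| <= C * (`|x - z| + `|y - z|) * `|x - y|].
Proof.
move=> Hf; have [C1 C10 [H1 H2]] := C1_compact (CkW Hf).
have HD j : exists2 C, 0 <= C & forall x y, B x -> B y ->
    `|'D_(delta_mx 0 j) f x - 'D_(delta_mx 0 j) f y| <= C * `|x - y|.
  have [_ /(_ (delta_mx 0 j))[_ H]] := Hf.
  by have [C C0 [_ HC]] := C1_compact H; exists C.
have [C HC] := @choice 'I_m R (fun j C => 0 <= C /\ forall x y, B x -> B y ->
    `|'D_(delta_mx 0 j) f x - 'D_(delta_mx 0 j) f y| <= C * `|x - y|)
  (fun j => let: ex_intro2 C C0 H := HD j in ex_intro _ C (conj C0 H)).
pose D := C1 + \sum_j C j.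
have S0 : 0 <= \sum_j C j by apply: sumr_ge0 => j _; case: (HC j).
have D0 : 0 <= D by rewrite addr_ge0.
have C1D : C1 <= D by rewrite lerDl.
have H3 x y w : B x -> B y -> `|'D_w f x - 'D_w f y| <= D * `|x - y| * `|w|.
  move=> Bx By; rewrite !(derive_sumE oU _ (CkW Hf)); [|exact: BU..].
  rewrite -sumrB (le_trans (ler_norm_sum _ _ _))//.
  apply: (@le_trans _ _ (\sum_j C j * `|x - y| * `|w|)); last first.
    by rewrite -!mulr_suml !ler_wpM2r// lerDr.
  apply: ler_sum => j _; rewrite -mulrBr normrM mulrC ler_pM//; last exact: coord_le_norm.
  by case: (HC j) => _; apply.
exists D => //; split => //.
- by move=> x w Bx; apply: le_trans (H1 x w Bx) _; rewrite ler_wpM2r.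
- by move=> x y Bx By; apply: le_trans (H2 x y Bx By) _; rewrite ler_wpM2r.
move=> x y z Bx By Bz.
have [t t01] : exists2 t : R, 0 <= t <= 1 &
    f (y + (x - y)) - f y = 'D_(x - y) f (y + t *: (x - y)).
  by apply: dir_mvt => t t01; apply: C1_derivable (CkW Hf) _; apply: BU; exact: vB.
rewrite [y + (x - y)]addrC subrK => ->; apply: le_trans (H3 _ _ _ (vB _ _ t01) Bz) _ => //.
rewrite ler_wpM2r// ler_wpM2l//; case/andP: t01 => t0 t1.
have -> : y + t *: (x - y) - z = t *: (x - z) + (1 - t) *: (y - z).
  rewrite scalerBl scale1r addrCA -scalerBr opprB addrA subrK.
  by rewrite addrAC.
apply: le_trans (ler_normD _ _) _; rewrite !normrZ (ger0_norm t0) ger0_norm ?subr_ge0//.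
by apply: lerD; rewrite ler_piMl// lerBlDr lerDl.
Qed.

(** The differential of F at z applied to w, as a row of directional
    derivatives of the coordinates. *)
Definition jac p (F : 'rV[R]_m -> 'rV[R]_p) z w : 'rV[R]_p :=
  \row_k 'D_w (fun x => F x 0 k) z.

Lemma jacB p (F : 'rV[R]_m -> 'rV[R]_p) z v w : (forall k, Ck 1 U (fun x => F x 0 k)) -> U z ->
  jac F z (v - w) = jac F z v - jac F z w.
Proof.
by move=> HF Uz; apply/rowP => k; rewrite !mxE (deriveBdir _ _ (HF k) Uz).
Qed.

Lemma jacZ p (F : 'rV[R]_m -> 'rV[R]_p) z (a : R) w : (forall k, Ck 1 U (fun x => F x 0 k)) -> U z ->
  jac F z (a *: w) = a *: jac F z w.
Proof.
move=> HF Uz; apply/rowP => k; rewrite !mxE deriveZdir//.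
exact: C1_derivable (HF k) Uz.
Qed.

Lemma C2_compact_mx p (F : 'rV[R]_m -> 'rV[R]_p) : (forall k, Ck 2 U (fun x => F x 0 k)) ->
  exists2 C, 0 <= C &
  [/\ forall x w, B x -> `|jac F x w| <= C * `|w|,
      forall x y, B x -> B y -> `|F x - F y| <= C * `|x - y|,
      forall x y w, B x -> B y -> `|jac F x w - jac F y w| <= C * `|x - y| * `|w| &
      forall x y z, B x -> B y -> B z ->
       `|F x - F y - jac F z (x - y)| <= C * (`|x - z| + `|y - z|) * `|x - y|].
Proof.
move=> HF.
pose P (f : 'rV[R]_m -> R) C :=
  [/\ forall x w, B x -> `|'D_w f x| <= C * `|w|,
      forall x y, B x -> B y -> `|f x - f y| <= C * `|x - y|,
      forall x y w, B x -> B y -> `|'D_w f x - 'D_w f y| <= C * `|x - y| * `|w| &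
      forall x y z, B x -> B y -> B z ->
       `|f x - f y - 'D_(x - y) f z| <= C * (`|x - z| + `|y - z|) * `|x - y|].
have [C HC] := @choice 'I_p R (fun j C => 0 <= C /\ P (fun x => F x 0 j) C)
  (fun j => let: ex_intro2 C C0 H := C2_compact (HF j) in ex_intro _ C (conj C0 H)).
have S0 : 0 <= \sum_j C j by apply: sumr_ge0 => j _; case: (HC j).
have CS j : C j <= \sum_j C j.
  by rewrite (bigD1 j)//= lerDl; apply: sumr_ge0 => k _; case: (HC k).
exists (\sum_j C j) => //; split.
- move=> x w Bx; apply/mx_norm_le => [|j]; first by rewrite mulr_ge0.
  by rewrite mxE; case: (HC j) => _ [/(_ x w Bx)/le_trans + _ _ _]; apply; rewrite ler_wpM2r.
- move=> x y Bx By; apply/mx_norm_le => [|j]; first by rewrite mulr_ge0.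
  by rewrite !mxE; case: (HC j) => _ [_ /(_ x y Bx By)/le_trans + _ _]; apply; rewrite ler_wpM2r.
- move=> x y w Bx By; apply/mx_norm_le => [|j]; first by rewrite !mulr_ge0.
  by rewrite !mxE; case: (HC j) => _ [_ _ /(_ x y w Bx By)/le_trans + _]; apply; rewrite !ler_wpM2r.
- move=> x y z Bx By Bz; apply/mx_norm_le => [|j]; first by rewrite !mulr_ge0// addr_ge0.
  by rewrite !mxE; case: (HC j) => _ [_ _ _ /(_ x y z Bx By Bz)/le_trans]; apply; rewrite !ler_wpM2r// addr_ge0.
Qed.

End Compact.
End C1strict.

End Strict.

(** * Gronwall estimates and differentiability of flows *)

Section Gronwall.
Context {R : realType}.

(** Both directions of time at once: (E + d) exp(-C t) decreases and (E + d)
    exp(C t) increases. *)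
Lemma gronwall (E dE : R -> R) (C d a b : R) : a <= b ->
  (forall t, a <= t <= b -> is_derive t (1:R) E (dE t)) ->
  (forall t, a <= t <= b -> `|dE t| <= C * (E t + d)) ->
  E b + d <= (E a + d) * expR (C * (b - a)) /\
  E a + d <= (E b + d) * expR (C * (b - a)).
Proof.
move=> ab HE HC; split.
- have [t tab] := @mvt R (fun t => (E t + d) * expR (- C * t))
    (fun t => dE t * expR (- C * t) + (E t + d) * (- C * expR (- C * t))) a b ab
    ltac:(by move=> t /HE H; apply: is_derive_eq;
             rewrite -![_ *: _]/(_ * _) addr0 mulr1; ring).
  move=> H; have : (E b + d) * expR (- C * b) <= (E a + d) * expR (- C * a).
    rewrite -subr_le0 H mulr_le0_ge0 ?subr_ge0//.
    have -> : dE t * expR (- C * t) + (E t + d) * (- C * expR (- C * t)) =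
      (dE t - C * (E t + d)) * expR (- C * t) by ring.
    rewrite mulr_le0_ge0 ?expR_ge0// subr_le0 (le_trans (ler_norm _))//.
    exact: HC.
  rewrite -(ler_pM2r (expR_gt0 (C * b))) -!mulrA -!expRD.
  have -> : - C * b + C * b = 0 by ring.
  have -> : - C * a + C * b = C * (b - a) by ring.
  by rewrite expR0 mulr1.
- have [t tab] := @mvt R (fun t => (E t + d) * expR (C * t))
    (fun t => dE t * expR (C * t) + (E t + d) * (C * expR (C * t))) a b ab
    ltac:(by move=> t /HE H; apply: is_derive_eq;
             rewrite -![_ *: _]/(_ * _) addr0 mulr1; ring).
  move=> H; have : (E a + d) * expR (C * a) <= (E b + d) * expR (C * b).
    rewrite -subr_ge0 H mulr_ge0 ?subr_ge0//.
    have -> : dE t * expR (C * t) + (E t + d) * (C * expR (C * t)) =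
      (dE t + C * (E t + d)) * expR (C * t) by ring.
    rewrite mulr_ge0 ?expR_ge0//; have := HC _ tab.
    by rewrite ler_norml => /andP[+ _]; rewrite lerNl -subr_ge0 opprK addrC.
  rewrite -(ler_pM2r (expR_gt0 (- (C * a)))) -!mulrA -!expRD.
  have -> : C * b + - (C * a) = C * (b - a) by ring.
  have -> : C * a + - (C * a) = 0 by ring.
  by rewrite expR0 mulr1.
Qed.

(** The factor m + 1 comes from comparing the norm with the sum of the squares
    of the coordinates, the exponent from the growth rate of that sum. *)
Definition gK (m : nat) (C l : R) : R := (m%:R + 1) * expR (2 * m%:R * (C + 1) * l).

Lemma gK_ge0 m C l : 0 <= gK m C l.
Proof. by rewrite mulr_ge0 ?expR_ge0. Qed.

(** The sup norm is not differentiable, so the scalar estimate is applied to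
    the sum of the squares of the coordinates, which is equivalent to the
    square of the norm. *)
Lemma gronwall_vec m (z dz : R -> 'rV[R]_m) (C d a b : R) :
  0 <= C -> 0 <= d -> a <= b ->
  (forall t, a <= t <= b -> is_derive t (1:R) z (dz t)) ->
  (forall t, a <= t <= b -> `|dz t| <= C * `|z t| + d) ->
  forall t u, a <= t <= b -> a <= u <= b -> `|z u| <= gK m C (b - a) * (`|z t| + d).
Proof.
move=> C0 d0 ab Hz HC.
pose E t := \sum_j (z t 0 j) ^+ 2.
pose dE t := \sum_j (2 * (z t 0 j * dz t 0 j)).
have HE t : a <= t <= b -> is_derive t (1:R) E (dE t).
  move=> /Hz/is_derive_mx H.
  have -> : E = \sum_j (fun t => (z t 0 j) ^+ 2) by apply/funext => y; rewrite fct_sumE.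
  apply: is_derive_sum => j; have := H j => Hj.
  have -> : (fun t0 => z t0 0 j ^+ 2) = (fun y => z y 0 j) * (fun y => z y 0 j).
    by apply/funext => y; rewrite expr2.
  apply: (is_derive_eq (is_deriveM Hj Hj)).
  by rewrite -![_ *: (_ : R)]/(_ * _); ring.
have E0 t : 0 <= E t by apply: sumr_ge0 => j _; exact: sqr_ge0.
have zE t : `|z t| ^+ 2 <= E t.
  have : `|z t| <= Num.sqrt (E t).
    apply/mx_norm_le; first exact: sqrtr_ge0.
    move=> j; rewrite -sqrtr_sqr ler_wsqrtr// /E (bigD1 j)//= lerDl.
    by apply: sumr_ge0 => k _; exact: sqr_ge0.
  by rewrite -(@ler_pXn2r _ 2)// ?nnegrE ?sqrtr_ge0// sqr_sqrtr.
have Ez t : E t <= m%:R * `|z t| ^+ 2.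
  rewrite /E; apply: (@le_trans _ _ (\sum_(j < m) `|z t| ^+ 2)).
    apply: ler_sum => j _; rewrite -[z t 0 j ^+ 2]ger0_norm ?sqr_ge0// normrX.
    by rewrite ler_pXn2r ?nnegrE// coord_le_norm.
  by rewrite sumr_const card_ord mulr_natl.
have HdE t : a <= t <= b -> `|dE t| <= 2 * m%:R * (C + 1) * (E t + d ^+ 2).
  move=> /HC Ht; apply: (@le_trans _ _ (\sum_(j < m) 2 * (`|z t| * (C * `|z t| + d)))).
    apply: le_trans (ler_norm_sum _ _ _) _; apply: ler_sum => j _.
    rewrite normrM ger0_norm// ler_wpM2l// normrM ler_pM// ?coord_le_norm//.
    exact: le_trans (coord_le_norm _ _) Ht.
  rewrite sumr_const card_ord -[leLHS]mulr_natl mulrCA -!mulrA ler_wpM2l// ler_wpM2l//.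
  have h1 := zE t; have h2 : 0 <= `|z t| by [].
  have h3 : `|z t| * d <= `|z t| ^+ 2 + d ^+ 2.
    by have := sqr_ge0 (`|z t| - d); have := mulr_ge0 h2 d0; nra.
  have h4 : C * `|z t| ^+ 2 <= C * E t by rewrite ler_wpM2l.
  have h5 : 0 <= C * d ^+ 2 by rewrite mulr_ge0// sqr_ge0.
  by lra.
move=> t u tab uab.
pose X := expR (2 * m%:R * (C + 1) * (b - a)).
have K0 : 0 <= 2 * m%:R * (C + 1) by rewrite !mulr_ge0// addr_ge0.
have key : E u + d ^+ 2 <= (E t + d ^+ 2) * X.
  have Xle x : 0 <= x -> x <= b - a -> expR (2 * m%:R * (C + 1) * x) <= X.
    by move=> x0 xb; rewrite ler_expR ler_wpM2l.
  have Ed t' : 0 <= E t' + d ^+ 2 by rewrite addr_ge0 ?sqr_ge0.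
  case/andP: tab => at_ tb; case/andP: uab => au ub.
  have [tu|ut] := leP t u.
    have [+ _] := @gronwall E dE (2 * m%:R * (C + 1)) (d ^+ 2) t u tu
      (fun x H => HE x ltac:(case/andP: H => h1 h2; rewrite (le_trans at_ h1) (le_trans h2 ub)//))
      (fun x H => HdE x ltac:(case/andP: H => h1 h2; rewrite (le_trans at_ h1) (le_trans h2 ub)//)).
    move=> /le_trans; apply; rewrite ler_wpM2l// Xle ?subr_ge0//.
    by rewrite lerB.
  have [_ +] := @gronwall E dE (2 * m%:R * (C + 1)) (d ^+ 2) u t (ltW ut)
      (fun x H => HE x ltac:(case/andP: H => h1 h2; rewrite (le_trans au h1) (le_trans h2 tb)//))
      (fun x H => HdE x ltac:(case/andP: H => h1 h2; rewrite (le_trans au h1) (le_trans h2 tb)//)).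
  move=> /le_trans; apply; rewrite ler_wpM2l// Xle ?subr_ge0 ?(ltW ut)//.
  by rewrite lerB.
have X1 : 1 <= X by rewrite -expR0 ler_expR mulr_ge0// subr_ge0.
have m0 : 0 <= m%:R :> R by [].
have td : 0 <= `|z t| + d by rewrite addr_ge0.
have K2 : 0 <= gK m C (b - a) * (`|z t| + d) by rewrite mulr_ge0 ?gK_ge0.
rewrite -(@ler_pXn2r _ 2)// ?nnegrE//.
apply: le_trans (zE u) _.
apply: (@le_trans _ _ (E u + d ^+ 2)); first by rewrite lerDl sqr_ge0.
apply: (le_trans key).
apply: (@le_trans _ _ ((m%:R + 1) * (`|z t| + d) ^+ 2 * X)).
  rewrite ler_wpM2r ?expR_ge0//; apply: (@le_trans _ _ (m%:R * `|z t| ^+ 2 + d ^+ 2)).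
    by rewrite lerD2r.
  have h1 : `|z t| ^+ 2 <= (`|z t| + d) ^+ 2 by rewrite ler_pXn2r ?nnegrE// lerDl.
  have h2 : d ^+ 2 <= (`|z t| + d) ^+ 2 by rewrite ler_pXn2r ?nnegrE// lerDr.
  by rewrite mulrDl mul1r lerD// ler_wpM2l.
rewrite /gK -/X exprMn [leRHS]mulrC [leLHS]mulrAC [leLHS]mulrC ler_wpM2l ?sqr_ge0//.
have : 0 <= (m%:R + 1) * X by rewrite mulr_ge0 ?addr_ge0 ?(le_trans _ X1).
set Y := _ * X => Y0; have : 1 <= Y.
  by rewrite /Y -[leLHS]mulr1 ler_pM// lerDr.
by move=> Y1; rewrite expr2 ler_peMl.
Qed.

End Gronwall.

Section Flow.
Context {R : realType} {m : nat}.

(** A curve whose difference quotients are Cauchy is strictly differentiable,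
    by completeness. This avoids guessing the derivative of a flow before it is
    known to exist. *)
Lemma strict_cauchy (c : R -> 'rV[R]_m) s0 :
  (forall e, 0 < e -> exists2 d, 0 < d & forall s s' t t',
     `|s - s0| < d -> `|s' - s0| < d -> `|t - s0| < d -> `|t' - s0| < d ->
     s != s' -> t != t' ->
     `|(s - s')^-1 *: (c s - c s') - (t - t')^-1 *: (c t - c t')| <= e) ->
  exists Y, strict c s0 (fun h : R => h *: Y).
Proof.
move=> H; pose q (h : R) : 'rV[R]_m := h^-1 *: (c (h + s0) - c s0).
have slope e d (s t : R) : 0 < d ->
    (forall s s' t t', `|s - s0| < d -> `|s' - s0| < d -> `|t - s0| < d -> `|t' - s0| < d ->
     s != s' -> t != t' ->
     `|(s - s')^-1 *: (c s - c s') - (t - t')^-1 *: (c t - c t')| <= e) ->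
    `|s| < d -> `|t| < d -> s != 0 -> t != 0 -> `|q s - q t| <= e.
  move=> d0 Hd sd td s_0 t_0.
  have := Hd (s + s0) s0 (t + s0) s0; rewrite !addrK subrr normr0; apply => //.
    by rewrite -subr_eq0 addrK.
  by rewrite -subr_eq0 addrK.
have /cvg_ex[Y HY] : cvg (q h @[h --> (0:R)^']).
  apply: cauchy_cvg; apply/cauchyP => e e0.
  have e2 : 0 < e / 2 by rewrite divr_gt0.
  have [d d0 Hd] := H (e / 2) e2.
  have d2 : 0 < d / 2 by rewrite divr_gt0.
  have d2d : d / 2 < d by rewrite ltr_pdivrMr// ltr_pMr// ltr1n.
  exists (q (d / 2)); apply/nbhs_ballP; exists d => //= h.
  rewrite -ball_normE /ball_/= sub0r normrN => hd h0; rewrite -ball_normE /ball_/=.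
  apply: (@le_lt_trans _ _ (e / 2)); last by rewrite ltr_pdivrMr// ltr_pMr// ltr1n.
  by apply: slope Hd _ _ _ _ => //; rewrite ?gt_eqF// gtr0_norm.
exists Y => e e0; have e2 : 0 < e / 2 by rewrite divr_gt0.
have [d d0 Hd] := H (e / 2) e2; exists d => // s s' sd s'd.
have [->|ss'] := eqVneq s s'; first by rewrite !subrr scale0r subr0 !normr0 mulr0.
have /cvgrPdist_lt/(_ _ e2)/nbhs_ballP[d' /= d'0 Hd'] := HY.
pose h := Num.min d d' / 2.
have m0 : 0 < Num.min d d' by rewrite lt_min d0.
have h0 : 0 < h by rewrite divr_gt0.
have : h < Num.min d d' by rewrite ltr_pdivrMr// ltr_pMr// ltr1n.
rewrite lt_min => /andP[hd hd'].
have /Hd' H1 : ball 0 d' h by rewrite -ball_normE /ball_/= sub0r normrN gtr0_norm.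
have {}H1 := H1 (lt0r_neq0 h0).
have H2 : `|(s - s')^-1 *: (c s - c s') - q h| <= e / 2.
  have := Hd s s' (h + s0) s0; rewrite addrK subrr normr0 (gtr0_norm h0) => /(_ sd s'd hd d0 ss').
  by apply; rewrite -subr_eq0 addrK gt_eqF.
have ss'0 : s - s' != 0 by rewrite subr_eq0.
have -> : c s - c s' - (s - s') *: Y = (s - s') *: ((s - s')^-1 *: (c s - c s') - Y).
  by rewrite scalerBr scalerA divff// scale1r.
rewrite normrZ mulrC ler_wpM2r//.
rewrite -(subrKA (q h)) [e]splitr (le_trans (ler_normD _ _))// lerD//.
by rewrite distrC ltW.
Qed.

Lemma vec_mvt (f df : R -> 'rV[R]_m) (w : 'rV[R]_m) (C a b : R) : a <= b -> 0 <= C ->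
  (forall t, a <= t <= b -> is_derive t (1:R) f (df t)) ->
  (forall t, a <= t <= b -> `|df t - w| <= C) ->
  `|f b - f a - (b - a) *: w| <= C * (b - a).
Proof.
move=> ab C0 Hf HC; apply/mx_norm_le => [|j]; first by rewrite mulr_ge0// subr_ge0.
have [t tab E] := @mvt R (fun t => f t 0 j) (fun t => df t 0 j) a b ab
  (fun t H => (is_derive_mx f t 1 (df t)).1 (Hf t H) j).
rewrite !mxE E mulrC -mulrBr normrM mulrC (ger0_norm (_ : 0 <= b - a)) ?subr_ge0//.
rewrite ler_wpM2r ?subr_ge0//; apply: le_trans (HC t tab).
by have := coord_le_norm (df t - w) j; rewrite !mxE.
Qed.

Lemma vec_mvt2 (f df : R -> 'rV[R]_m) (w : 'rV[R]_m) (C u k : R) : 0 <= C ->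
  (forall t, `|t - u| <= `|k| -> is_derive t (1:R) f (df t)) ->
  (forall t, `|t - u| <= `|k| -> `|df t - w| <= C) ->
  `|f (u + k) - f u - k *: w| <= C * `|k|.
Proof.
move=> C0 Hf HC; have [k0|k0] := leP 0 k.
  have E : u + k - u = k by rewrite addrAC subrr add0r.
  have := @vec_mvt f df w C u (u + k); rewrite lerDl E (ger0_norm k0).
  have H t : u <= t <= u + k -> `|t - u| <= `|k|.
    by move=> /andP[t1 t2]; rewrite !ger0_norm ?subr_ge0// lerBlDl.
  by apply => // t /H h; [exact: Hf|exact: HC].
have E : u - (u + k) = - k by rewrite opprD addrA subrr add0r.
have := @vec_mvt f df w C (u + k) u; rewrite gerDl (ltW k0) E.
have H t : u + k <= t <= u -> `|t - u| <= `|k|.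
  move=> /andP[t1 t2]; rewrite ler0_norm ?subr_le0// ltr0_norm//.
  by rewrite lerN2 lerBrDl.
rewrite (ltr0_norm k0).
have -> : f u - f (u + k) - - k *: w = - (f (u + k) - f u - k *: w).
  by apply/rowP => j; rewrite !mxE; ring.
by rewrite normrN; apply => // t /H h; [exact: Hf|exact: HC].
Qed.

Context (B : set 'rV[R]_m) (F : 'rV[R]_m -> 'rV[R]_m) (DF : 'rV[R]_m -> 'rV[R]_m -> 'rV[R]_m).
Context (C : R) (C0 : 0 <= C).
Context (DFB : forall z v w, B z -> DF z (v - w) = DF z v - DF z w).
Context (DFZ : forall z (h : R) w, B z -> DF z (h *: w) = h *: DF z w).
Context (H1 : forall x w, B x -> `|DF x w| <= C * `|w|)
  (H2 : forall x y, B x -> B y -> `|F x - F y| <= C * `|x - y|)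
  (H3 : forall x y w, B x -> B y -> `|DF x w - DF y w| <= C * `|x - y| * `|w|)
  (H4 : forall x y z, B x -> B y -> B z ->
       `|F x - F y - DF z (x - y)| <= C * (`|x - z| + `|y - z|) * `|x - y|).
Context (phi : R -> R -> 'rV[R]_m) (s0 r a b u1 : R) (Y1 : 'rV[R]_m).
Context (r0 : 0 < r) (u1ab : a <= u1 <= b).
Context (phiB : forall s u, `|s - s0| < r -> a <= u <= b -> B (phi s u)).
Context (dphi : forall s u, `|s - s0| < r -> a <= u <= b ->
  is_derive u (1:R) (phi s) (F (phi s u))).

Let ab : a <= b. Proof. by case/andP: u1ab => h1 h2; exact: le_trans h1 h2. Qed.

(** The difference of two solutions satisfies the hypothesis of gronwall_vec
    with d = 0, since F is Lipschitz on B. *)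
Lemma flow_gronwall s s' u u' : `|s - s0| < r -> `|s' - s0| < r -> a <= u <= b ->
  a <= u' <= b ->
  `|phi s u - phi s' u| <= gK m C (b - a) * `|phi s u' - phi s' u'|.
Proof.
move=> sr s'r uab u'ab.
have := @gronwall_vec R m (fun u => phi s u - phi s' u) (fun u => F (phi s u) - F (phi s' u))
  C 0 a b C0 (lexx _) ab _ _ u' u u'ab uab; rewrite addr0; apply.
  by move=> t tab; apply: is_deriveB; exact: dphi.
by move=> t tab; rewrite addr0; apply: H2; exact: phiB.
Qed.

Context (sphi : strict (phi^~ u1) s0 (fun h : R => h *: Y1)).

Lemma flow_lip : exists L d, [/\ 0 <= L, 0 < d <= r & forall s s' u,
  `|s - s0| < d -> `|s' - s0| < d -> a <= u <= b -> `|phi s u - phi s' u| <= L * `|s - s'|].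
Proof.
have Y0 : 0 <= `|Y1| by [].
have [d d0 Hd] := strict_lip Y0 (fun h : R => ltac:(by rewrite normrZ mulrC) :
   `|h *: Y1| <= `|Y1| * `|h|) sphi ltr01.
exists (gK m C (b - a) * (`|Y1| + 1)), (Num.min d r); split.
- by rewrite mulr_ge0 ?gK_ge0// addr_ge0.
- by rewrite lt_min d0 r0 ge_min lexx orbT.
move=> s s' u; rewrite !lt_min => /andP[sd sr] /andP[s'd s'r] uab.
apply: le_trans (flow_gronwall sr s'r uab u1ab) _.
by rewrite -[leRHS]mulrA ler_wpM2l ?gK_ge0//; exact: Hd.
Qed.

Let zeta s s' u := (s - s')^-1 *: (phi s u - phi s' u).

(** The difference quotients zeta in the parameter s solve the linearized
    equation along phi s0 up to an error L * e, by the second order Taylor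
    bound. *)
Lemma flow_zeta : exists L d, [/\ 0 <= L, 0 < d <= r & forall s s' u e,
  `|s - s0| < e -> `|s' - s0| < e -> e <= d -> s != s' -> a <= u <= b ->
  [/\ `|zeta s s' u| <= L, `|phi s u - phi s0 u| <= L * `|s - s0|,
    is_derive u (1:R) (zeta s s') ((s - s')^-1 *: (F (phi s u) - F (phi s' u))) &
   `|(s - s')^-1 *: (F (phi s u) - F (phi s' u)) - DF (phi s0 u) (zeta s s' u)| <= L * e]].
Proof.
have [L [d [L0 /andP[d0 dr] Hd]]] := flow_lip.
exists (L + C * (L + L) * L), d; split.
- by rewrite addr_ge0// !mulr_ge0// addr_ge0.
- by rewrite d0.
move=> s s' u e se s'e ed ss' uab.
have ss'0 : 0 < `|s - s'| by rewrite normr_gt0 subr_eq0.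
have sd := lt_le_trans se ed; have s'd := lt_le_trans s'e ed.
have sr := lt_le_trans sd dr; have s'r := lt_le_trans s'd dr.
have s0d : `|s0 - s0| < d by rewrite subrr normr0.
have s0r : `|s0 - s0| < r by rewrite subrr normr0.
have z1 : `|zeta s s' u| <= L.
  by rewrite normrZ normfV mulrC ler_pdivrMr//; exact: Hd.
have LL : 0 <= C * (L + L) * L by rewrite !mulr_ge0// addr_ge0.
split.
- by rewrite (le_trans z1)// lerDl.
- by rewrite (le_trans (Hd s s0 u sd s0d uab))// ler_wpM2r// lerDl.
- by apply: is_deriveZ; apply: is_deriveB; exact: dphi.
have Bs := phiB sr uab; have Bs' := phiB s'r uab; have Bs0 := phiB s0r uab.
rewrite DFZ// -scalerBr normrZ normfV mulrC ler_pdivrMr//.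
apply: le_trans (H4 Bs Bs' Bs0) _.
have e0 : 0 < e by rewrite (le_lt_trans _ se).
apply: (@le_trans _ _ (C * (L * e + L * e) * (L * `|s - s'|))).
  rewrite ler_pM//; first by rewrite mulr_ge0// addr_ge0.
    rewrite ler_wpM2l// lerD//.
      by apply: le_trans (Hd s s0 u sd s0d uab) _; rewrite ler_wpM2l// ltW.
    by apply: le_trans (Hd s' s0 u s'd s0d uab) _; rewrite ler_wpM2l// ltW.
  exact: Hd.
rewrite mulrA ler_wpM2r//; have -> : C * (L * e + L * e) * L = (C * (L + L) * L) * e by ring.
by rewrite ler_wpM2r ?lerDr// ltW.
Qed.

(** By Gronwall, difference quotients that are close at time u1 remain close at
    time u: they are Cauchy at u if they are at u1. *)
Lemma flow_strict u : a <= u <= b -> exists Y, strict (phi^~ u) s0 (fun h : R => h *: Y).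
Proof.
move=> uab; have [L [d [L0 /andP[d0 dr] Hd]]] := flow_zeta.
pose K := gK m C (b - a); have K0 : 0 <= K by exact: gK_ge0.
apply: strict_cauchy => e e0.
(* Gronwall multiplies by K the sum of four errors: two from the quotients at
   u1, at most e1 each, and two from the linearization, at most L * e2 <= e1
   each. *)
pose e1 := e / (4 * (K + 1)); pose e2 := e1 / (L + 1).
have K1 : 0 < K + 1 by rewrite ltr_wpDl.
have L1 : 0 < L + 1 by rewrite ltr_wpDl.
have e10 : 0 < e1 by rewrite divr_gt0// mulr_gt0.
have e20 : 0 < e2 by rewrite divr_gt0.
have [d1 d10 Hd1] := sphi e10.
pose d2 := Num.min (Num.min d1 d) e2.
have d20 : 0 < d2 by rewrite !lt_min d10 d0.
have d2d : d2 <= d by rewrite !ge_min lexx orbT.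
have d2d1 : d2 <= d1 by rewrite !ge_min lexx.
have d2e : d2 <= e2 by rewrite !ge_min lexx orbT.
exists d2 => // s s' t t' sd s'd td t'd ss' tt'.
have A v vab := Hd s s' v d2 sd s'd d2d ss' vab.
have A' v vab := Hd t t' v d2 td t'd d2d tt' vab.
have s0r : `|s0 - s0| < r by rewrite subrr normr0.
have Z (x x' : R) : `|x - s0| < d2 -> `|x' - s0| < d2 -> x != x' -> `|zeta x x' u1 - Y1| <= e1.
  move=> xd x'd xx'; have x0 : 0 < `|x - x'| by rewrite normr_gt0 subr_eq0.
  have := Hd1 x x' (lt_le_trans xd d2d1) (lt_le_trans x'd d2d1).
  rewrite -(ler_pM2l (_ : 0 < `|x - x'|^-1)) ?invr_gt0// mulrCA mulVf ?gt_eqF// mulr1.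
  by rewrite -normfV -normrZ scalerBr scalerA mulVf ?scale1r// subr_eq0.
have := @gronwall_vec R m (fun v => zeta s s' v - zeta t t' v)
  (fun v => (s - s')^-1 *: (F (phi s v) - F (phi s' v)) - (t - t')^-1 *: (F (phi t v) - F (phi t' v)))
  C (L * d2 + L * d2) a b C0 _ ab _ _ u1 u u1ab uab.
have Ld : 0 <= L * d2 by rewrite mulr_ge0// ltW.
move=> /(_ _ _ _)/le_trans; apply.
- by rewrite addr_ge0.
- move=> v vab; have [_ _ a1 _] := A v vab; have [_ _ a2 _] := A' v vab.
  exact: is_deriveB.
- move=> v vab; have [_ _ _ a1] := A v vab; have [_ _ _ a2] := A' v vab.
  have Bs0 := phiB s0r vab; have := H1 (zeta s s' v - zeta t t' v) Bs0.
  rewrite DFB//; move: a1 a2.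
  set x := (s - s')^-1 *: (_ - _); set y := (t - t')^-1 *: (_ - _).
  set x' := DF _ _; set y' := DF _ _ => a1 a2 a3.
  have -> : x - y = (x' - y') + ((x - x') - (y - y')).
    by rewrite opprB !addrA; apply/rowP => j; rewrite !mxE; ring.
  by rewrite (le_trans (ler_normD _ _))// lerD// (le_trans (ler_normB _ _))// lerD.
have zz : `|zeta s s' u1 - zeta t t' u1| <= e1 + e1.
  rewrite -(subrKA Y1) (le_trans (ler_normD _ _))// lerD//; first exact: Z.
  by rewrite distrC; exact: Z.
apply: (@le_trans _ _ (K * (e1 + e1 + (L * e2 + L * e2)))).
  by rewrite ler_wpM2l// lerD// lerD// ler_wpM2l.
have Le : L * e2 <= e1.
  by rewrite /e2 mulrCA ler_piMr ?(ltW e10)// ler_pdivrMr// mul1r lerDl.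
apply: (@le_trans _ _ (K * (4 * e1))).
  by rewrite ler_wpM2l//; lra.
have -> : K * (4 * e1) = e * (K / (K + 1)).
  by rewrite /e1; field; rewrite gt_eqF.
by rewrite ler_piMr ?(ltW e0)// ler_pdivrMr// mul1r lerDl.
Qed.

(** The derivative Y in the parameter satisfies the linearized equation: pass
    to the limit in the equation of the difference quotients, uniformly in u. *)
Lemma flow_derive (Y : R -> 'rV[R]_m) :
  (forall u, a <= u <= b -> strict (phi^~ u) s0 (fun h : R => h *: Y u)) ->
  forall u, a < u < b -> is_derive u (1:R) Y (DF (phi s0 u) (Y u)).
Proof.
move=> HY u /andP[au ub]; have [L [d [L0 /andP[d0 dr] Hd]]] := flow_zeta.
have uab : a <= u <= b by rewrite !ltW.
have s0r : `|s0 - s0| < r by rewrite subrr normr0.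
have lim (v : R) : a <= v <= b -> forall e, 0 < e -> exists2 d1, 0 < d1 &
    forall s, `|s - s0| < d1 -> s != s0 -> `|zeta s s0 v - Y v| <= e.
  move=> vab e e0; have [d1 d10 Hd1] := HY v vab e e0; exists d1 => // s sd ss0.
  have x0 : 0 < `|s - s0| by rewrite normr_gt0 subr_eq0.
  have := Hd1 s s0 sd; rewrite subrr normr0 => /(_ d10).
  rewrite -(ler_pM2l (_ : 0 < `|s - s0|^-1)) ?invr_gt0// mulrCA mulVf ?gt_eqF// mulr1.
  by rewrite -normfV -normrZ scalerBr scalerA mulVf ?scale1r// subr_eq0.
apply/is_derive_epsP => e e0; set W := DF _ _.
have L1 : 0 < L + 1 by rewrite ltr_wpDl.
have C1 : 0 < C + 1 by rewrite ltr_wpDl.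
have Ld0 : 0 <= L * d by rewrite mulr_ge0// ltW.
have CL0 : 0 <= C * L by rewrite mulr_ge0.
have e4 : 0 < e / 4 by rewrite divr_gt0.
have cphi : {for u, continuous (phi s0)}.
  apply/differentiable_continuous/derivable1_diffP.
  by case: (dphi s0r uab).
pose P := C * (L * d + C * L) + 1.
have P0 : 0 < P by rewrite ltr_wpDl// mulr_ge0// addr_ge0.
have [rho1 rho10 Hrho1] := (continuous_epsP _ _).1 cphi (e / 4 / (C * L + 1)) ltac:(by rewrite divr_gt0// ltr_wpDl).
pose rho := Num.min (Num.min rho1 (e / 4 / P)) (Num.min (u - a) (b - u)).
have rho0 : 0 < rho by rewrite !lt_min rho10 divr_gt0// !subr_gt0 au.
exists rho => // k krho; rewrite [k *: _]mulr1 [k + u]addrC.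
move: krho; rewrite !lt_min => /andP[/andP[k1 k2] /andP[k3 k4]].
have kab v : `|v - u| <= `|k| -> a <= v <= b.
  move=> vk; have := le_lt_trans vk k3; have := le_lt_trans vk k4.
  by rewrite !ltr_norml => /andP[_ b1] /andP[b2 _]; apply/andP; split; lra.
apply/ler_addgt0Pl => eta eta0; have eta2 : 0 < eta / 2 by rewrite divr_gt0.
have ukab : a <= u + k <= b by apply: kab; rewrite addrAC subrr add0r.
have [d1 d10 Hd1] := lim u uab (Num.min (eta / 2) (e / 4 / (C + 1))) ltac:(by rewrite lt_min eta2 divr_gt0).
have [d2 d20 Hd2] := lim _ ukab (eta / 2) eta2.
pose e' := Num.min d (e / 4 / (L + 1)).
have e'0 : 0 < e' by rewrite lt_min d0 divr_gt0.
pose s := s0 + Num.min (Num.min d1 d2) e' / 2.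
have m0 : 0 < Num.min (Num.min d1 d2) e' by rewrite lt_min e'0 lt_min d10 d20.
have ss0 : s != s0 by rewrite -subr_eq0 /s addrAC subrr add0r gt_eqF// divr_gt0.
have : `|s - s0| < Num.min (Num.min d1 d2) e'.
  by rewrite /s addrAC subrr add0r gtr0_norm ?divr_gt0// ltr_pdivrMr// ltr_pMr// ltr1n.
rewrite !lt_min => /andP[/andP[sd1 sd2]] se'.
have {}se' : `|s - s0| < e' by rewrite lt_min.
have e'd : e' <= d by rewrite ge_min lexx.
have s0e' : `|s0 - s0| < e' by rewrite subrr normr0.
have A v vab := Hd s s0 v e' se' s0e' e'd ss0 vab.
have := Hd1 s sd1 ss0; rewrite le_min => /andP[z1 z2].
have z3 := Hd2 s sd2 ss0.
have Bu := phiB s0r uab.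
have Le' : L * e' <= e / 4.
  apply: (@le_trans _ _ (L * (e / 4 / (L + 1)))); first by rewrite ler_wpM2l// ge_min lexx orbT.
  by rewrite mulrCA ler_piMr ?(ltW e4)// ler_pdivrMr// mul1r lerDl.
have zlip v : `|v - u| <= `|k| -> `|zeta s s0 v - zeta s s0 u| <= (L * d + C * L) * `|k|.
  move=> vk; have := @vec_mvt2 (zeta s s0)
    (fun v => (s - s0)^-1 *: (F (phi s v) - F (phi s0 v))) 0 (L * d + C * L) u (v - u).
  rewrite scaler0 subr0 [u + _]addrC subrK => H.
  apply: (@le_trans _ _ ((L * d + C * L) * `|v - u|)); last by rewrite ler_wpM2l// addr_ge0.
  apply: H; first by rewrite addr_ge0.
    by move=> t tv; have [_ _ ? _] := A t (kab _ (le_trans tv vk)).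
  move=> t tv; have tab := kab _ (le_trans tv vk); have [a1 _ _ a2] := A t tab.
  rewrite subr0 -(subrK (DF (phi s0 t) (zeta s s0 t)) (_ *: _)).
  rewrite (le_trans (ler_normD _ _))// lerD//.
    by rewrite (le_trans a2)// ler_wpM2l.
  by apply: le_trans (H1 _ (phiB s0r tab)) _; rewrite ler_wpM2l.
have main : `|zeta s s0 (u + k) - zeta s s0 u - k *: W| <= e * `|k|.
  apply: (@vec_mvt2 _ (fun v => (s - s0)^-1 *: (F (phi s v) - F (phi s0 v)))); first exact: ltW.
    by move=> t /kab tab; have [_ _ ? _] := A t tab.
  move=> t tk; have tab := kab _ tk; have [a1 _ _ a2] := A t tab.
  have Bt := phiB s0r tab.
  have -> : (s - s0)^-1 *: (F (phi s t) - F (phi s0 t)) - W =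
    ((s - s0)^-1 *: (F (phi s t) - F (phi s0 t)) - DF (phi s0 t) (zeta s s0 t))
    + (DF (phi s0 t) (zeta s s0 t) - DF (phi s0 u) (zeta s s0 t))
    + DF (phi s0 u) (zeta s s0 t - zeta s s0 u) + DF (phi s0 u) (zeta s s0 u - Y u).
    by rewrite !DFB//; apply/rowP => j; rewrite !mxE; ring.
  have b1 := le_trans a2 Le'.
  have b2 : `|DF (phi s0 t) (zeta s s0 t) - DF (phi s0 u) (zeta s s0 t)| <= e / 4.
    apply: le_trans (H3 _ Bt Bu) _.
    apply: (@le_trans _ _ (C * (e / 4 / (C * L + 1)) * L)).
      rewrite ler_pM// ?mulr_ge0// ler_wpM2l// ltW// Hrho1//.
      exact: le_lt_trans tk k1.
    rewrite mulrAC mulrCA ler_piMr ?(ltW e4)// ler_pdivrMr ?mul1r ?lerDl//.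
    by rewrite ltr_wpDl.
  have b3 : `|DF (phi s0 u) (zeta s s0 t - zeta s s0 u)| <= e / 4.
    apply: le_trans (H1 _ Bu) _; apply: (@le_trans _ _ (C * ((L * d + C * L) * (e / 4 / P)))).
      rewrite ler_wpM2l// (le_trans (zlip _ tk))// ler_wpM2l ?addr_ge0//.
      exact: ltW.
    rewrite mulrA mulrCA ler_piMr ?(ltW e4)// ler_pdivrMr// mul1r /P.
    by rewrite lerDl.
  have b4 : `|DF (phi s0 u) (zeta s s0 u - Y u)| <= e / 4.
    apply: le_trans (H1 _ Bu) _; apply: (@le_trans _ _ (C * (e / 4 / (C + 1)))).
      by rewrite ler_wpM2l.
    by rewrite mulrCA ler_piMr ?(ltW e4)// ler_pdivrMr// mul1r lerDl.
  have -> : e = e / 4 + e / 4 + e / 4 + e / 4 by field.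
  by do 3! (apply: le_trans (ler_normD _ _) _; apply: lerD => //).
have -> : Y (u + k) - Y u - k *: W = (zeta s s0 (u + k) - zeta s s0 u - k *: W)
   + ((zeta s s0 u - Y u) - (zeta s s0 (u + k) - Y (u + k))).
  by apply/rowP => j; rewrite !mxE; ring.
rewrite [eta + _]addrC; apply: le_trans (ler_normD _ _) _; apply: lerD => //.
by rewrite (le_trans (ler_normB _ _))// [eta]splitr lerD.
Qed.

End Flow.

(** * Smooth fields of matrices and of bilinear forms *)

Section SmoothReal.
Context {R : realType} {V : normedModType R} (U : set V) (oU : open U).

Lemma smooth_onD_dir (W : normedModType R) (f : V -> W) v :
  smooth_on U f -> smooth_on U ('D_v f).
Proof. by move=> Hf k; have [_ /(_ v)[]] := Hf k.+1. Qed.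

Lemma Ck_det m k (F : V -> 'M[R]_m) : (forall a b, Ck k U (fun x => F x a b)) ->
  Ck k U (fun x => \det (F x)).
Proof.
move=> HF; rewrite /determinant; apply: Ck_sum => // s _; apply: CkM => //.
  exact: Ck_cst.
by apply: Ck_prod.
Qed.

(** Cramer's rule: the entries of the inverse are quotients of polynomials in
    the entries. *)
Lemma Ck_invmx m k (F : V -> 'M[R]_m) : (forall x, U x -> F x \in unitmx) ->
  (forall a b, Ck k U (fun x => F x a b)) ->
  forall a b, Ck k U (fun x => invmx (F x) a b).
Proof.
move=> uF HF a b.
have H : Ck k U (fun x => (\det (F x))^-1 * cofactor (F x) b a).
  apply: CkM => //.
    apply: CkV => //; last exact: Ck_det.
    by move=> x /uF; rewrite unitmxE unitfE.
  rewrite /cofactor; apply: CkM => //; first exact: Ck_cst.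
  apply: Ck_det => c d.
  have -> : (fun x => row' b (col' a (F x)) c d) = (fun x => F x (lift b c) (lift a d)).
    by apply/funext => x; rewrite !mxE.
  exact: HF.
apply: (Ck_ext oU _ H) => x /uF u; rewrite /invmx u !mxE.
by [].
Qed.

End SmoothReal.

Section BilinearField.
Context {R : realType} {n : nat}.
Implicit Types (U : set 'rV[R]_n) (f : 'rV[R]_n -> 'rV[R]_n -> 'rV[R]_n -> R).

(** Bilinear forms in the last two arguments whose coefficients depend smoothly
    on the first one; the metric and each coordinate of the Christoffel symbol
    are of this kind. *)
Definition bilinear_field U f :=
  (forall y v w, U y -> f y v w = \sum_p \sum_q v 0 p * w 0 q * f y (delta_mx 0 p) (delta_mx 0 q))
  /\ (forall p q, smooth_on U (fun y => f y (delta_mx 0 p) (delta_mx 0 q))).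

Context (U : set 'rV[R]_n) (oU : open U) (f : 'rV[R]_n -> 'rV[R]_n -> 'rV[R]_n -> R).
Context (Hf : bilinear_field U f).

Lemma bilinear_fieldE y v w : U y ->
  f y v w = \sum_p \sum_q v 0 p * w 0 q * f y (delta_mx 0 p) (delta_mx 0 q).
Proof. by case: Hf => + _; apply. Qed.

Lemma bilinear_field_smooth v w : smooth_on U (fun y => f y v w).
Proof.
move=> k; apply: (Ck_ext oU (f := fun y => \sum_p \sum_q v 0 p * w 0 q * f y (delta_mx 0 p) (delta_mx 0 q))).
  by move=> y Uy; rewrite -bilinear_fieldE.
apply: Ck_sum => // p _; apply: Ck_sum => // q _; apply: CkM => //.
  exact: Ck_cst.
by case: Hf => _; apply.
Qed.

Lemma is_derive_sums (V : normedModType R) (I : Type) (r : seq I) (h dh : I -> V -> R) x v :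
  (forall i, is_derive x v (h i) (dh i x)) ->
  is_derive x v (fun y => \sum_(i <- r) h i y) (\sum_(i <- r) dh i x).
Proof.
move=> H; elim: r => [|i r IH].
  have -> : (fun y => \sum_(i <- [::]) h i y) = cst 0 by apply/funext => y; rewrite big_nil.
  by rewrite big_nil; exact: is_derive_cst.
have -> : (fun y => \sum_(j <- i :: r) h j y) = h i + (fun y => \sum_(j <- r) h j y).
  by apply/funext => y; rewrite big_cons.
by rewrite big_cons; exact: is_deriveD.
Qed.

Lemma bilinear_fieldD y u v w : U y -> 'D_u (fun y => f y v w) y =
  \sum_p \sum_q v 0 p * w 0 q * 'D_u (fun y => f y (delta_mx 0 p) (delta_mx 0 q)) y.
Proof.
move=> Uy; rewrite (derive_congr _ oU Uy (fun x Ux => bilinear_fieldE v w Ux)).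
have [] // := @is_derive_sums _ _ (index_enum 'I_n) (fun p x => \sum_q v 0 p * w 0 q * f x (delta_mx 0 p) (delta_mx 0 q))
  (fun p x => \sum_q v 0 p * w 0 q * 'D_u (fun y => f y (delta_mx 0 p) (delta_mx 0 q)) x) y u _.
move=> p; apply: (@is_derive_sums _ _ (index_enum 'I_n) (fun q x => v 0 p * w 0 q * f x (delta_mx 0 p) (delta_mx 0 q))
  (fun q x => v 0 p * w 0 q * 'D_u (fun y => f y (delta_mx 0 p) (delta_mx 0 q)) x)) => q.
have /(_ 1%N) H := Hf.2 p q.
have := is_deriveZ (v 0 p * w 0 q) (derivableP (C1_derivable (v := u) H Uy)).
exact.
Qed.

(** Product rule along a curve: one term differentiates the coefficients, two
    terms differentiate the arguments. *)
Lemma bilinear_field_derive (c a b : R -> 'rV[R]_n) t c' a' b' :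
  U (c t) -> is_derive t (1:R) c c' -> is_derive t (1:R) a a' -> is_derive t (1:R) b b' ->
  is_derive t (1:R) (fun t => f (c t) (a t) (b t))
    ('D_c' (fun y => f y (a t) (b t)) (c t) + f (c t) a' (b t) + f (c t) (a t) b').
Proof.
move=> Uc dc /is_derive_mx da /is_derive_mx db.
have nU : \forall s \near t, U (c s).
  have : {for t, continuous c}.
    by apply/differentiable_continuous/derivable1_diffP; case: dc.
  by move=> cc; apply: cc; exact: open_nbhs_nbhs.
apply: (@near_eq_is_derive _ _ _
  (fun s => \sum_p \sum_q a s 0 p * b s 0 q * f (c s) (delta_mx 0 p) (delta_mx 0 q))).
  by apply: filterS nU => s Us; rewrite [in RHS]bilinear_fieldE.
pose e p q s := f (c s) (delta_mx 0 p) (delta_mx 0 q).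
pose de p q : R := 'D_c' (fun y => f y (delta_mx 0 p) (delta_mx 0 q)) (c t).
have H p q : is_derive t (1:R) (fun s => a s 0 p * b s 0 q * e p q s)
   (a t 0 p * b t 0 q * de p q + (a t 0 p * b' 0 q + b t 0 q * a' 0 p) * e p q t).
  have /(_ 1%N) Hpq := Hf.2 p q.
  have dE : is_derive t (1:R) (e p q) (de p q) := C1_chain oU Hpq Uc dc.
  apply: (is_derive_eq (is_deriveM (is_deriveM (da p) (db q)) dE)).
  rewrite -[LHS]/(a t 0 p * b t 0 q * de p q + e p q t * (a t 0 p * b' 0 q + b t 0 q * a' 0 p)).
  by ring.
have := @is_derive_sums _ _ (index_enum 'I_n) (fun p s => \sum_q a s 0 p * b s 0 q * e p q s)
  (fun p _ => \sum_q (a t 0 p * b t 0 q * de p q + (a t 0 p * b' 0 q + b t 0 q * a' 0 p) * e p q t)) t (1:R)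
  (fun p => @is_derive_sums _ _ (index_enum 'I_n) _ (fun q _ => _) t (1:R) (H p)).
move=> /is_derive_eq; apply.
rewrite (bilinear_fieldD _ _ _ Uc) [f (c t) a' _]bilinear_fieldE// [f (c t) _ b']bilinear_fieldE//.
rewrite -!big_split/=; apply: eq_bigr => p _; rewrite -!big_split/=; apply: eq_bigr => q _.
by rewrite /de /e; ring.
Qed.

End BilinearField.

(** * The metric and its Levi-Civita connection in one chart *)

Section ChartGeometry.
Context {R : realType} {n : nat} {M : topologicalType}.
Context {A : smooth_manifold R n M} (g : riemannian_metric A).
Implicit Types (i : chart_index A) (x u v w z : 'rV[R]_n).

Lemma inner_sumE i x v w : inner g i x v w = \sum_p \sum_q v 0 p * w 0 q * gram g i x p q.
Proof.
rewrite /inner mxE exchange_big/=; apply: eq_bigr => q _.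
by rewrite !mxE mulr_suml; apply: eq_bigr => p _; ring.
Qed.

Lemma gramE i x p q : inner g i x (delta_mx 0 p) (delta_mx 0 q) = gram g i x p q.
Proof.
rewrite inner_sumE (bigD1 p)//= (bigD1 q)//= big1 ?addr0 => [|k kq]; last first.
  by rewrite !mxE (negbTE kq) andbF mulr0 mul0r.
rewrite big1 ?addr0 => [|k kp]; first by rewrite !mxE !eqxx !mul1r.
by apply: big1 => l _; rewrite !mxE (negbTE kp) andbF mul0r mul0r.
Qed.

Lemma inner_field i : bilinear_field (chart_cod (s := A) i) (inner g i).
Proof.
split=> [y v w _|p q k].
  rewrite inner_sumE; apply: eq_bigr => p _; apply: eq_bigr => q _.
  by rewrite gramE.
have -> : (fun y => inner g i y (delta_mx 0 p) (delta_mx 0 q)) = (fun y => gram g i y p q).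
  by apply/funext => y; rewrite gramE.
exact: gram_smooth.
Qed.

Lemma inner_sym i x v w : chart_cod i x -> inner g i x v w = inner g i x w v.
Proof.
move=> ix; have gs a b : gram g i x a b = gram g i x b a by rewrite -{1}(gram_sym g ix) mxE.
rewrite !inner_sumE exchange_big/=; apply: eq_bigr => q _; apply: eq_bigr => p _.
by rewrite gs; ring.
Qed.

Lemma inner_gt0 i x v : chart_cod i x -> v != 0 -> 0 < inner g i x v v.
Proof. exact: gram_pos. Qed.

Lemma inner0l i x v : inner g i x 0 v = 0.
Proof. by rewrite /inner !mul0mx mxE. Qed.

Lemma inner0r i x v : inner g i x v 0 = 0.
Proof. by rewrite /inner trmx0 mulmx0 mxE. Qed.

Lemma inner_ge0 i x v : chart_cod i x -> 0 <= inner g i x v v.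
Proof.
by move=> ix; have [->|/(inner_gt0 ix)/ltW//] := eqVneq v 0; rewrite inner0l.
Qed.

Lemma innerDl i x v v' w : inner g i x (v + v') w = inner g i x v w + inner g i x v' w.
Proof. by rewrite /inner !mulmxDl mxE. Qed.

Lemma innerDr i x v w w' : inner g i x v (w + w') = inner g i x v w + inner g i x v w'.
Proof. by rewrite /inner linearD mulmxDr mxE. Qed.

Lemma innerZl i x (a : R) v w : inner g i x (a *: v) w = a * inner g i x v w.
Proof. by rewrite /inner -!scalemxAl mxE. Qed.

Lemma innerZr i x (a : R) v w : inner g i x v (a *: w) = a * inner g i x v w.
Proof. by rewrite /inner linearZ -scalemxAr mxE. Qed.

Lemma innerNl i x v w : inner g i x (- v) w = - inner g i x v w.
Proof. by rewrite -scaleN1r innerZl mulN1r. Qed.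

Lemma innerNr i x v w : inner g i x v (- w) = - inner g i x v w.
Proof. by rewrite -scaleN1r innerZr mulN1r. Qed.

Lemma innerBl i x v v' w : inner g i x (v - v') w = inner g i x v w - inner g i x v' w.
Proof. by rewrite innerDl innerNl. Qed.

Lemma innerBr i x v w w' : inner g i x v (w - w') = inner g i x v w - inner g i x v w'.
Proof. by rewrite innerDr innerNr. Qed.

(** The metric is nondegenerate: test v - w against itself. *)
Lemma inner_inj i x v w : chart_cod i x ->
  (forall z, inner g i x v z = inner g i x w z) -> v = w.
Proof.
move=> ix H; apply/eqP; rewrite -subr_eq0; apply/negPn/negP => /(inner_gt0 ix).
by rewrite {1}innerBl H subrr ltxx.
Qed.

Lemma inner_CS i x v w : chart_cod i x ->
  inner g i x v w ^+ 2 <= inner g i x v v * inner g i x w w.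
Proof.
move=> ix; have [->|w0] := eqVneq w 0.
  by rewrite (inner_sym v 0 ix) !inner0l expr0n/= mulr0.
have ww := inner_gt0 ix w0.
have := inner_ge0 (inner g i x w w *: v - inner g i x v w *: w) ix.
rewrite !(innerBl, innerBr, innerZl, innerZr) (inner_sym w v ix).
set a := inner g i x v v; set b := inner g i x v w; set c := inner g i x w w.
have -> : c * (c * a - b * b) - b * (c * b - b * c) = c * (a * c - b ^+ 2) by ring.
by rewrite pmulr_rge0// subr_ge0.
Qed.

Lemma gram_unit i x : chart_cod i x -> gram g i x \in unitmx.
Proof.
move=> ix; rewrite -row_free_unit -kermx_eq0; apply/eqP/row_matrixP => k.
rewrite row0; apply/eqP/negPn/negP => /(inner_gt0 ix).
by rewrite /inner -row_mul mulmx_ker row0 mul0mx mxE ltxx.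
Qed.

(** The derivative of the metric in the direction u. It is locked, here as for
    the other derived fields below, so that conversion does not unfold the
    limits inside. *)
Definition dinner_def i x u v w : R := 'D_u (fun y => inner g i y v w) x.
Fact dinner_key : unit. Proof. by []. Qed.
Definition dinner := locked_with dinner_key dinner_def.

Lemma dinnerE i x u v w : dinner i x u v w = 'D_u (fun y => inner g i y v w) x.
Proof. by rewrite /dinner unlock. Qed.

Lemma inner_C i v w k : Ck k (chart_cod (s := A) i) (fun y => inner g i y v w).
Proof. exact: (bilinear_field_smooth (@chart_cod_open _ _ _ A i) (inner_field i)). Qed.

Lemma inner_derivable i x u v w : chart_cod i x -> derivable (fun y => inner g i y v w) x u.
Proof. exact: C1_derivable (inner_C i v w 1). Qed.

Lemma dinnerDu i x u u' v w : chart_cod i x ->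
  dinner i x (u + u') v w = dinner i x u v w + dinner i x u' v w.
Proof. by rewrite !dinnerE; exact: (deriveDdir (@chart_cod_open _ _ _ A i) _ _ (inner_C i v w 1)). Qed.

Lemma dinnerZu i x (a : R) u v w : chart_cod i x ->
  dinner i x (a *: u) v w = a * dinner i x u v w.
Proof. by move=> ix; rewrite !dinnerE deriveZdir//; exact: inner_derivable. Qed.

Lemma dinner_sym i x u v w : chart_cod i x -> dinner i x u v w = dinner i x u w v.
Proof.
move=> ix; rewrite !dinnerE; apply: (derive_congr _ (@chart_cod_open _ _ _ A i) ix) => y iy.
exact: inner_sym.
Qed.

Lemma dinnerDl i x u v v' w : chart_cod i x ->
  dinner i x u (v + v') w = dinner i x u v w + dinner i x u v' w.
Proof.
move=> ix; rewrite !dinnerE; under [in LHS]eq_fun do rewrite innerDl.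
have d1 : derivable (fun y => inner g i y v w) x u by exact: inner_derivable.
have d2 : derivable (fun y => inner g i y v' w) x u by exact: inner_derivable.
exact: deriveD d1 d2.
Qed.

Lemma dinnerZl i x (a : R) u v w : chart_cod i x ->
  dinner i x u (a *: v) w = a * dinner i x u v w.
Proof.
move=> ix; rewrite !dinnerE; under [in LHS]eq_fun do rewrite innerZl.
have d1 : derivable (fun y => inner g i y v w) x u by exact: inner_derivable.
exact: deriveZ d1.
Qed.

Lemma dinnerDr i x u v w w' : chart_cod i x ->
  dinner i x u v (w + w') = dinner i x u v w + dinner i x u v w'.
Proof. by move=> ix; rewrite !(dinner_sym _ v)// dinnerDl. Qed.

Lemma dinnerZr i x (a : R) u v w : chart_cod i x ->
  dinner i x u v (a *: w) = a * dinner i x u v w.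
Proof. by move=> ix; rewrite !(dinner_sym _ v)// dinnerZl. Qed.

(** Half the right side of the Koszul formula, the linear form in z that
    christoffel i x v w represents. *)
Definition koszul i x v w z : R :=
  2^-1 * (dinner i x v w z + dinner i x w v z - dinner i x z v w).

Lemma koszulDz i x v w z z' : chart_cod i x ->
  koszul i x v w (z + z') = koszul i x v w z + koszul i x v w z'.
Proof. move=> ix; rewrite /koszul (dinnerDr v w z z' ix) (dinnerDr w v z z' ix) (dinnerDu z z' v w ix).
by ring. Qed.

Lemma koszulZz i x (a : R) v w z : chart_cod i x ->
  koszul i x v w (a *: z) = a * koszul i x v w z.
Proof. by move=> ix; rewrite /koszul !dinnerZr// dinnerZu//; ring. Qed.

(** The Koszul formula. The definition of the Christoffel symbol states it on
    the coordinate vectors only; linearity in z gives all vectors. *)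
Lemma inner_christoffel i x v w z : chart_cod i x ->
  inner g i x (christoffel g i x v w) z = koszul i x v w z.
Proof.
move=> ix; rewrite /inner /christoffel mulmxKV ?gram_unit// {2}(row_sum_delta z).
have k0 : koszul i x v w 0 = 0 by rewrite -(scale0r 0) koszulZz// mul0r.
have -> : koszul i x v w (\sum_j z 0 j *: delta_mx 0 j) =
   \sum_j z 0 j * koszul i x v w (delta_mx 0 j).
  elim/big_ind2 : _ => //[y1 y2 z1 z2 <- <-|j _]; first by rewrite koszulDz.
  by rewrite koszulZz.
by rewrite mxE; apply: eq_bigr => j _; rewrite !mxE /koszul !dinnerE mulrC.
Qed.

Lemma christoffelDl i x v v' w : chart_cod i x ->
  christoffel g i x (v + v') w = christoffel g i x v w + christoffel g i x v' w.
Proof.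
move=> ix; apply: (inner_inj ix) => z; rewrite innerDl.
rewrite (inner_christoffel (v + v') w z ix) (inner_christoffel v w z ix) (inner_christoffel v' w z ix).
rewrite /koszul (dinnerDu v v' w z ix) (dinnerDl w v v' z ix) (dinnerDl z v v' w ix).
by ring.
Qed.

Lemma christoffelZl i x (a : R) v w : chart_cod i x ->
  christoffel g i x (a *: v) w = a *: christoffel g i x v w.
Proof.
move=> ix; apply: (inner_inj ix) => z; rewrite innerZl.
rewrite (inner_christoffel (a *: v) w z ix) (inner_christoffel v w z ix).
rewrite /koszul (dinnerZu a v w z ix) (dinnerZl a w v z ix) (dinnerZl a z v w ix).
by ring.
Qed.

Lemma christoffel_sym i x v w : chart_cod i x ->
  christoffel g i x v w = christoffel g i x w v.
Proof.
move=> ix; apply: (inner_inj ix) => z.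
rewrite (inner_christoffel v w z ix) (inner_christoffel w v z ix).
by rewrite /koszul (dinner_sym z v w ix); ring.
Qed.

Lemma christoffelDr i x v w w' : chart_cod i x ->
  christoffel g i x v (w + w') = christoffel g i x v w + christoffel g i x v w'.
Proof. by move=> ix; rewrite !(christoffel_sym v)// christoffelDl. Qed.

Lemma christoffelZr i x (a : R) v w : chart_cod i x ->
  christoffel g i x v (a *: w) = a *: christoffel g i x v w.
Proof. by move=> ix; rewrite !(christoffel_sym v)// christoffelZl. Qed.

(** The connection is metric: in the sum of the two Koszul formulas all other
    terms cancel. *)
Lemma dinner_christoffel i x u v w : chart_cod i x ->
  dinner i x u v w =
  inner g i x (christoffel g i x u v) w + inner g i x v (christoffel g i x u w).
Proof.
move=> ix; rewrite (inner_sym v _ ix) (inner_christoffel u v w ix) (inner_christoffel u w v ix) /koszul.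
rewrite (dinner_sym u w v ix) (dinner_sym w u v ix) (dinner_sym v u w ix).
by field.
Qed.

Lemma christoffel_field i k :
  bilinear_field (chart_cod (s := A) i) (fun y v w => christoffel g i y v w 0 k).
Proof.
split=> [y v w iy|p q m].
  rewrite {1}(row_sum_delta v) {1}(row_sum_delta w).
  have H1 (r : seq 'I_n) v' : christoffel g i y v' (\sum_(q <- r) w 0 q *: delta_mx 0 q) =
     \sum_(q <- r) w 0 q *: christoffel g i y v' (delta_mx 0 q).
    elim: r => [|q r IH]; last by rewrite !big_cons christoffelDr// IH christoffelZr.
    by rewrite !big_nil; have := christoffelZr 0 v' 0 iy; rewrite !scale0r.
  have H2 (r : seq 'I_n) w' : christoffel g i y (\sum_(q <- r) v 0 q *: delta_mx 0 q) w' =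
     \sum_(q <- r) v 0 q *: christoffel g i y (delta_mx 0 q) w'.
    elim: r => [|q r IH]; last by rewrite !big_cons christoffelDl// IH christoffelZl.
    by rewrite !big_nil; have := christoffelZl 0 0 w' iy; rewrite !scale0r.
  rewrite H2 summxE; apply: eq_bigr => p _; rewrite H1 mxE summxE mulr_sumr.
  by apply: eq_bigr => q _; rewrite mxE mulrA.
have oU := @chart_cod_open _ _ _ A i.
have -> : (fun y => christoffel g i y (delta_mx 0 p) (delta_mx 0 q) 0 k) =
  (fun y => \sum_d koszul i y (delta_mx 0 p) (delta_mx 0 q) (delta_mx 0 d) * invmx (gram g i y) d k).
  by apply/funext => y; rewrite /christoffel mxE; apply: eq_bigr => d _; rewrite mxE /koszul !dinnerE.
have D u v w : Ck m (chart_cod i) (fun y => dinner i y u v w).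
  have -> : (fun y => dinner i y u v w) = 'D_u (fun y => inner g i y v w).
    by apply/funext => y; rewrite dinnerE.
  exact: (smooth_onD_dir u (fun k => inner_C i v w k)).
apply: Ck_sum => // d _; apply: CkM => //.
  apply: CkM => //; first exact: Ck_cst.
  by apply: CkB => //; apply: CkD.
apply: Ck_invmx => //; first by move=> y; exact: gram_unit.
by move=> a b; exact: gram_smooth.
Qed.

End ChartGeometry.

(** * Change of charts *)

Section Transition.
Context {R : realType} {n : nat} {M : topologicalType}.
Context {A : smooth_manifold R n M} (g : riemannian_metric A).
Implicit Types (i j : chart_index A) (x u v w z : 'rV[R]_n).

Definition tau i j : 'rV[R]_n -> 'rV[R]_n := chart j \o chart_inv i.

Definition overlap i j : set 'rV[R]_n :=
  [set x | chart_cod i x /\ chart_dom j (chart_inv i x)].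

Definition dtau_def i j x v : 'rV[R]_n := \row_k 'D_v (fun y => tau i j y 0 k) x.
Fact dtau_key : unit. Proof. by []. Qed.
Definition dtau := locked_with dtau_key dtau_def.

Definition ddtau_def i j x u v : 'rV[R]_n :=
  \row_k 'D_u ('D_v (fun y => tau i j y 0 k)) x.
Fact ddtau_key : unit. Proof. by []. Qed.
Definition ddtau := locked_with ddtau_key ddtau_def.

Lemma overlap_open i j : open (overlap i j).
Proof.
rewrite openE => x [ix jx]; rewrite /interior /overlap.
apply: filterI; first by apply: open_nbhs_nbhs; split; [exact: chart_cod_open|].
have := chart_inv_continuous ix; apply.
by apply: open_nbhs_nbhs; split; [exact: chart_dom_open|].
Qed.

Lemma tau_Ck i j k m : Ck m (overlap i j) (fun y => tau i j y 0 k).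
Proof. by apply: Ck_coord; [exact: overlap_open|exact: transition_smooth]. Qed.

Lemma tau_cod i j x : overlap i j x -> chart_cod j (tau i j x).
Proof. by move=> [ix jx]; exact: chart_in_cod. Qed.

Lemma tau_overlap i j x : overlap i j x -> overlap j i (tau i j x).
Proof.
move=> [ix jx]; split; first exact: chart_in_cod.
by rewrite /tau /= chartK//; exact: chart_inv_in_dom.
Qed.

Lemma tauK i j x : overlap i j x -> tau j i (tau i j x) = x.
Proof. by move=> [ix jx]; rewrite /tau /= chartK// chart_invK. Qed.

Lemma chart_overlap i j (p : M) : chart_dom i p -> chart_dom j p -> overlap i j (chart i p).
Proof. by move=> ip jp; split; [exact: chart_in_cod|rewrite chartK]. Qed.

Lemma tau_chart i j (p : M) : chart_dom i p -> tau i j (chart i p) = chart j p.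
Proof. by move=> ip; rewrite /tau /= chartK. Qed.

Lemma dtau_coord i j x v k : dtau i j x v 0 k = 'D_v (fun y => tau i j y 0 k) x.
Proof. by rewrite /dtau unlock mxE. Qed.

Lemma ddtau_coord i j x u v k :
  ddtau i j x u v 0 k = 'D_u ('D_v (fun y => tau i j y 0 k)) x.
Proof. by rewrite /ddtau unlock mxE. Qed.

Lemma dtauD i j x v w : overlap i j x -> dtau i j x (v + w) = dtau i j x v + dtau i j x w.
Proof.
move=> ox; apply/rowP => k; rewrite [RHS]mxE !dtau_coord.
exact: (deriveDdir (@overlap_open i j) _ _ (tau_Ck i j k 1) ox).
Qed.

Lemma dtauZ i j x (a : R) v : overlap i j x -> dtau i j x (a *: v) = a *: dtau i j x v.
Proof.
move=> ox; apply/rowP => k; rewrite [RHS]mxE !dtau_coord deriveZdir//.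
exact: (C1_derivable (tau_Ck i j k 1) ox).
Qed.

Lemma dtauB i j x v w : overlap i j x -> dtau i j x (v - w) = dtau i j x v - dtau i j x w.
Proof. by move=> ox; rewrite dtauD// -scaleN1r dtauZ// scaleN1r. Qed.

Lemma tau_derive i j x v : overlap i j x -> is_derive x v (tau i j) (dtau i j x v).
Proof.
move=> ox; apply/is_derive_mx => k; rewrite dtau_coord; apply: derivableP.
exact: (C1_derivable (tau_Ck i j k 1) ox).
Qed.

Lemma dtauE i j x v : overlap i j x -> dtau i j x v = 'D_v (tau i j) x.
Proof. by move=> /(tau_derive v)[]. Qed.

Lemma inner_tau i j x v w : overlap i j x ->
  inner g j (tau i j x) (dtau i j x v) (dtau i j x w) = inner g i x v w.
Proof.
move=> ox; rewrite !dtauE//; case: ox => ix jx.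
by rewrite /inner (gram_transition g v w ix jx).
Qed.

Lemma dtauK i j x v : overlap i j x -> dtau i j x (dtau j i (tau i j x) v) = v.
Proof.
move=> ox; have oy := tau_overlap ox; have E := tauK ox.
apply/rowP => k; rewrite dtau_coord.
have := C1_chain (@overlap_open i j) (tau_Ck i j k 1) (c := tau j i) (x := tau i j x) (v := v).
rewrite E => /(_ _ ox (tau_derive v oy))[_ <-].
have -> : 'D_v ((fun y => tau i j y 0 k) \o tau j i) (tau i j x) = 'D_v (fun y : 'rV[R]_n => y 0 k) (tau i j x).
  apply: (derive_congr _ (@overlap_open j i) oy) => y /tauK /= ->.
  by [].
have H : is_derive (tau i j x) v (fun y : 'rV[R]_n => y) v by exact: is_derive_id.
by have /is_derive_mx/(_ k)[] := H.
Qed.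

Lemma ddtau_sym i j x u v : overlap i j x -> ddtau i j x u v = ddtau i j x v u.
Proof.
move=> ox; apply/rowP => k; rewrite !ddtau_coord.
exact: (schwarz (@overlap_open i j) _ _ (tau_Ck i j k 2) ox).
Qed.

Lemma dtau_derive i j (c a : R -> 'rV[R]_n) t c' a' : overlap i j (c t) ->
  is_derive t (1:R) c c' -> is_derive t (1:R) a a' ->
  is_derive t (1:R) (fun t => dtau i j (c t) (a t)) (dtau i j (c t) a' + ddtau i j (c t) c' (a t)).
Proof.
move=> ox dc /is_derive_mx da; apply/is_derive_mx => k; rewrite mxE dtau_coord ddtau_coord.
pose f y := tau i j y 0 k.
have oO := @overlap_open i j.
have nU : \forall s \near t, overlap i j (c s).
  have : {for t, continuous c}.
    by apply/differentiable_continuous/derivable1_diffP; case: dc.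
  by move=> cc; apply: cc; exact: open_nbhs_nbhs.
apply: (@near_eq_is_derive _ _ _ (fun s => \sum_p a s 0 p * 'D_(delta_mx 0 p) f (c s))).
  by apply: filterS nU => s os; rewrite dtau_coord (derive_sumE oO _ (tau_Ck i j k 1) os).
have H p : is_derive t (1:R) (fun s => a s 0 p * 'D_(delta_mx 0 p) f (c s))
   (a' 0 p * 'D_(delta_mx 0 p) f (c t) + a t 0 p * 'D_c' ('D_(delta_mx 0 p) f) (c t)).
  have Hp : Ck 1 (overlap i j) ('D_(delta_mx 0 p) f).
    by have [_ /(_ (delta_mx 0 p))[]] := tau_Ck i j k 2.
  have dE := C1_chain oO Hp ox dc.
  apply: (is_derive_eq (is_deriveM (da p) dE)).
  rewrite -[LHS]/(a t 0 p * 'D_c' ('D_(delta_mx 0 p) f) (c t) + 'D_(delta_mx 0 p) f (c t) * a' 0 p).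
  by rewrite addrC mulrC.
have := @is_derive_sums _ _ _ (index_enum 'I_n) _ (fun p _ => _) t (1:R) H.
move=> /is_derive_eq; apply; rewrite big_split/=; congr (_ + _).
  by rewrite (derive_sumE oO _ (tau_Ck i j k 1) ox).
have E : forall y, overlap i j y -> 'D_(a t) f y = \sum_p a t 0 p * 'D_(delta_mx 0 p) f y.
  by move=> y oy; rewrite (derive_sumE oO _ (tau_Ck i j k 1) oy).
rewrite (derive_congr _ oO ox E).
have [] // := @is_derive_sums _ _ _ (index_enum 'I_n) (fun p y => a t 0 p * 'D_(delta_mx 0 p) f y)
  (fun p y => a t 0 p * 'D_c' ('D_(delta_mx 0 p) f) y) (c t) c' _.
move=> p; have Hp : Ck 1 (overlap i j) ('D_(delta_mx 0 p) f).
  by have [_ /(_ (delta_mx 0 p))[]] := tau_Ck i j k 2.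
exact: is_deriveZ (derivableP (C1_derivable (v := c') Hp ox)).
Qed.

(** Differentiate inner_tau along a line through x: the transition map enters
    through the base point and through the two arguments. *)
Lemma dinner_tau i j x u v w : overlap i j x ->
  dinner g i x u v w =
  dinner g j (tau i j x) (dtau i j x u) (dtau i j x v) (dtau i j x w)
  + inner g j (tau i j x) (ddtau i j x u v) (dtau i j x w)
  + inner g j (tau i j x) (dtau i j x v) (ddtau i j x u w).
Proof.
move=> ox; have oO := @overlap_open i j.
pose l (s : R) : 'rV[R]_n := x + s *: u.
have l0 : l 0 = x by rewrite /l scale0r addr0.
have dl : is_derive (0:R) (1:R) l u.
  apply/is_derive_epsP => e e0; exists 1 => // h _.
  rewrite /l [h *: 1]mulr1 addr0 scale0r addr0.
  have -> : x + h *: u - x - h *: u = 0 by rewrite [x + _]addrC addrK subrr.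
  by rewrite normr0 mulr_ge0// ltW.
have ol : overlap i j (l 0) by rewrite l0.
have dcst (b : 'rV[R]_n) : is_derive (0:R) (1:R) (fun _ : R => b) 0 by exact: is_derive_cst.
have d1 := dtau_derive ol dl (dcst v); have d2 := dtau_derive ol dl (dcst w).
have dt0 : dtau i j (l 0) 0 = 0 by have := dtauZ 0 0 ol; rewrite !scale0r.
rewrite dt0 add0r l0 in d1; rewrite dt0 add0r l0 in d2.
have d0 : is_derive (0:R) (1:R) (tau i j \o l) (dtau i j x u).
  apply/is_derive_mx => k; rewrite dtau_coord -{1}l0.
  exact: (C1_chain oO (tau_Ck i j k 1) ol dl).
have oj : chart_cod j ((tau i j \o l) 0) by rewrite /= l0; exact: tau_cod.
have := bilinear_field_derive (@chart_cod_open _ _ _ A j) (inner_field g j) oj d0 d1 d2.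
rewrite /= l0 -(dinnerE g j (tau i j x) (dtau i j x u) (dtau i j x v) (dtau i j x w)) => -[_ <-].
have dx : derivable (fun y => inner g i y v w) (x + 0 *: u) u.
  by rewrite scale0r addr0; apply: inner_derivable; case: ox.
have := is_derive_line dx; rewrite scale0r addr0 => -[_]; rewrite -(dinnerE g i x u v w) => <-.
apply: near_eq_derive.
have : \forall s \near (0:R), overlap i j (l s).
  have : {for (0:R), continuous l}.
    by apply/differentiable_continuous/derivable1_diffP; case: dl.
  by move=> cc; apply: cc; exact: open_nbhs_nbhs.
by apply: filterS => s os; rewrite inner_tau.
Qed.

(** Transformation rule of the Christoffel symbol on the diagonal. Both sides
    are compared through their inner products by the Koszul formula; the second
    derivatives of the transition map left over in the derivatives of the
    metric combine into one term. *)
Lemma christoffel_tau i j x v : overlap i j x ->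
  dtau i j x (christoffel g i x v v) =
  christoffel g j (tau i j x) (dtau i j x v) (dtau i j x v) + ddtau i j x v v.
Proof.
move=> ox; have ix : chart_cod i x by case: ox.
have jx := tau_cod ox.
apply: (inner_inj (g := g) jx) => z'.
rewrite -(dtauK z' ox); set z := dtau j i _ z'.
rewrite inner_tau// innerDl (inner_christoffel g v v z ix).
rewrite (inner_christoffel g (dtau i j x v) (dtau i j x v) (dtau i j x z) jx) /koszul.
rewrite (dinner_tau v v z ox) (dinner_tau z v v ox).
rewrite (inner_sym g (dtau i j x v) (ddtau i j x z v) jx).
rewrite (inner_sym g (dtau i j x v) (ddtau i j x v z) jx) (ddtau_sym v z ox).
by field.
Qed.

End Transition.

Section Curves.
Context {R : realType} {n : nat} {M : topologicalType}.
Context {A : smooth_manifold R n M} (g : riemannian_metric A).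
Implicit Types (i j : chart_index A) (x u v w z : 'rV[R]_n) (c : R -> M).

Definition vel_def i c (t : R) : 'rV[R]_n := derive1 (chart i \o c) t.
Fact vel_key : unit. Proof. by []. Qed.
Definition vel := locked_with vel_key vel_def.

Lemma velE i c t : vel i c t = derive1 (chart i \o c) t.
Proof. by rewrite /vel unlock. Qed.

Lemma velocityE c t : @velocity R n M A c t = vel (chart_at A (c t)) c t.
Proof. by rewrite velE. Qed.

Definition acc i c (t : R) : 'rV[R]_n :=
  derive1 (vel i c) t + christoffel g i (chart i (c t)) (vel i c t) (vel i c t).

Lemma accelerationE c t : acceleration g c t = acc (chart_at A (c t)) c t.
Proof.
by rewrite /acc -velocityE /vel unlock.
Qed.

Lemma curve_near (U : set R) c t i : open U -> {for t, continuous c} -> U t ->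
  chart_dom i (c t) -> \forall s \near t, U s /\ chart_dom i (c s).
Proof.
move=> oU cc Ut it; apply: filterI; first exact: open_nbhs_nbhs.
by apply: cc; exact: open_nbhs_nbhs (conj (chart_dom_open i) it).
Qed.

Context (U : set R) (oU : open U) (c : R -> M) (sc : @smooth_curve R n M A U c).

Lemma smooth_curve_cont t : U t -> {for t, continuous c}.
Proof. by case: sc => + _; apply. Qed.

(** The operator derive1 is total; smoothness of the chart representation is
    what makes its value a derivative. *)
Lemma vel_derive i t : U t -> chart_dom i (c t) ->
  is_derive t (1:R) (chart i \o c) (vel i c t).
Proof.
move=> Ut it; case: sc => _ /(_ i 1%N)[_ /(_ 1)[d1 _]].
by rewrite velE derive1E; apply: derivableP; exact: d1.
Qed.

Lemma acc_derive i t : U t -> chart_dom i (c t) ->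
  is_derive t (1:R) (vel i c) (acc i c t - christoffel g i (chart i (c t)) (vel i c t) (vel i c t)).
Proof.
move=> Ut it; rewrite /acc addrK; case: sc => _ /(_ i 2%N)[_ /(_ 1)[_ [_ /(_ 1)[d2 _]]]].
have -> : vel i c = 'D_1 (chart i \o c) by apply/funext => s; rewrite velE derive1E.
by rewrite derive1E; apply: derivableP; exact: d2.
Qed.

Lemma chart_tau_derive i j (t : R) l (c0 : R -> M) : {for t, continuous c0} -> chart_dom i (c0 t) ->
  chart_dom j (c0 t) -> is_derive t (1:R) (chart i \o c0) l ->
  is_derive t (1:R) (chart j \o c0) (dtau i j (chart i (c0 t)) l).
Proof.
move=> cc it jt dc; have ox := chart_overlap it jt.
have [_ near_i] : True /\ \forall s \near t, True /\ chart_dom i (c0 s).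
  by split => //; apply: (@curve_near setT) => //; exact: openT.
apply: (@near_eq_is_derive _ _ _ (tau i j \o (chart i \o c0))).
  by apply: filterS near_i => s [_ is_] /=; rewrite tau_chart.
apply/is_derive_mx => k; rewrite dtau_coord.
exact: (C1_chain (@overlap_open R n M A i j) (tau_Ck i j k 1) ox dc).
Qed.

Lemma vel_tau i j t : U t -> chart_dom i (c t) -> chart_dom j (c t) ->
  vel j c t = dtau i j (chart i (c t)) (vel i c t).
Proof.
move=> Ut it jt; have := chart_tau_derive (smooth_curve_cont Ut) it jt (vel_derive Ut it).
by move=> [_ <-]; rewrite velE derive1E.
Qed.

(** The acceleration is a tangent vector: the inhomogeneous term in the rule of
    the Christoffel symbol cancels the second derivative of the transition map. *)
Lemma acc_tau i j t : U t -> chart_dom i (c t) -> chart_dom j (c t) ->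
  acc j c t = dtau i j (chart i (c t)) (acc i c t).
Proof.
move=> Ut it jt; have ox := chart_overlap it jt.
have H := dtau_derive ox (vel_derive Ut it) (acc_derive Ut it).
have near_ij : \forall s \near t, vel j c s = dtau i j (chart i (c s)) (vel i c s).
  have := curve_near oU (smooth_curve_cont Ut) Ut it.
  have := curve_near oU (smooth_curve_cont Ut) Ut jt.
  by apply: filterS2 => s [Us js] [_ is_]; exact: vel_tau.
have H2 : is_derive t (1:R) (vel j c)
   (dtau i j (chart i (c t)) (acc i c t - christoffel g i (chart i (c t)) (vel i c t) (vel i c t))
    + ddtau i j (chart i (c t)) (vel i c t) (vel i c t)).
  apply: (@near_eq_is_derive _ _ _ (fun s => dtau i j ((chart i \o c) s) (vel i c s))) => //.
  by apply: filterS near_ij => s ->.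
rewrite {1}/acc derive1E; case: H2 => _ ->.
rewrite dtauB// (christoffel_tau g _ ox) tau_chart// -(vel_tau Ut it jt).
by rewrite -addrA [ddtau _ _ _ _ _ + _]addrC subrK.
Qed.

(** The differential of the transition map is an isometry of the Gram matrices,
    so the speed can be computed in every chart around the point. *)
Lemma velocity_inner i t : U t -> chart_dom i (c t) ->
  inner_at g (c t) (@velocity R n M A c t) (@velocity R n M A c t) =
  inner g i (chart i (c t)) (vel i c t) (vel i c t).
Proof.
move=> Ut it; rewrite /inner_at velocityE (vel_tau Ut it (chart_atP _ _)).
by rewrite -(tau_chart (chart_at A (c t)) it) inner_tau//; exact: chart_overlap it (chart_atP _ _).
Qed.

Lemma acceleration_inner i t : U t -> chart_dom i (c t) ->
  inner_at g (c t) (acceleration g c t) (acceleration g c t) =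
  inner g i (chart i (c t)) (acc i c t) (acc i c t).
Proof.
move=> Ut it; rewrite /inner_at accelerationE (acc_tau Ut it (chart_atP _ _)).
by rewrite -(tau_chart (chart_at A (c t)) it) inner_tau//; exact: chart_overlap it (chart_atP _ _).
Qed.

Lemma geodesic_acc i t : (forall t, U t -> acceleration g c t = 0) -> U t -> chart_dom i (c t) ->
  acc i c t = 0.
Proof.
move=> gc Ut it; have ct := chart_atP A (c t); have := gc t Ut.
rewrite accelerationE.
rewrite (acc_tau Ut ct it) => ->.
by have := dtauZ 0 0 (chart_overlap ct it); rewrite !scale0r.
Qed.

End Curves.

(** * Real induction *)

Section RealInduction.
Context {R : realType}.

(** Supremum argument, packaged once: it carries statements proved locally in
    one chart along a whole pole. *)
Lemma real_ind (P : R -> Prop) (b : R) : 0 <= b -> P 0 ->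
  (forall e, 0 < e <= b -> (forall t, 0 <= t < e -> P t) -> P e) ->
  (forall e, 0 <= e < b -> (forall t, 0 <= t <= e -> P t) ->
     exists2 d, 0 < d & forall t, e < t < e + d -> P t) ->
  forall t, 0 <= t <= b -> P t.
Proof.
move=> b0 P0 Pc Po.
pose S := [set t | 0 <= t <= b /\ forall t', 0 <= t' <= t -> P t'].
have S0 : S 0.
  split; first by rewrite lexx.
  by move=> t' /andP[h1 h2]; have -> : t' = 0 by apply/eqP; rewrite eq_le h1 h2.
have hS : has_sup S by split; [exists 0|exists b => t [/andP[_ ->]]].
have sS t : S t -> t <= sup S by move=> St; exact: ub_le_sup hS.2 _ St.
have s0 : 0 <= sup S by exact: sS.
have sb : sup S <= b by apply: ge_sup; [exists 0|move=> t [/andP[_ ->]]].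
have Plt t : 0 <= t < sup S -> P t.
  move=> /andP[t0 ts]; have [t' [_ H] tt'] := sup_gt hS.1 ts.
  by apply: H; rewrite t0 ltW.
have Ps : P (sup S).
  have [e|sn0] := eqVneq (sup S) 0; first by rewrite e.
  by apply: Pc => //; rewrite lt_neqAle eq_sym sn0 s0.
have Ple t : 0 <= t <= sup S -> P t.
  by rewrite [t <= _]le_eqVlt => /andP[t0 /orP[/eqP->//|ts]]; apply: Plt; rewrite t0.
have [sb'|sb'] := ltP (sup S) b; last first.
  by move=> t /andP[t0 tb]; apply: Ple; rewrite t0 (le_trans tb).
have [d d0 Hd] : exists2 d, 0 < d & forall t, sup S < t < sup S + d -> P t.
  by apply: Po => //; rewrite s0.
pose m := Num.min (d / 2) (b - sup S).
have m0 : 0 < m by rewrite lt_min divr_gt0// subr_gt0.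
have : S (sup S + m).
  split.
    by rewrite addr_ge0 ?(ltW m0)//= -lerBrDl ge_min lexx orbT.
  move=> t /andP[t0 tm]; have [ts|ts] := leP t (sup S); first by apply: Ple; rewrite t0.
  apply: Hd; rewrite ts (le_lt_trans tm)// ltrD2l (@le_lt_trans _ _ (d / 2))//.
    by rewrite ge_min lexx.
  by rewrite ltr_pdivrMr// ltr_pMr// ltr1n.
by move=> /sS; rewrite gerDl leNgt m0.
Qed.

Lemma left_near (e d : R) : 0 < e -> 0 < d -> exists2 t, 0 <= t < e & `|t - e| < d.
Proof.
move=> e0 d0; pose m := Num.min d e / 2.
have m1 : 0 < Num.min d e by rewrite lt_min d0.
have m0 : 0 < m by rewrite divr_gt0.
have : m < Num.min d e by rewrite ltr_pdivrMr// ltr_pMr// ltr1n.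
rewrite lt_min => /andP[md me]; exists (e - m).
  by rewrite subr_ge0 (ltW me) ltrBlDr ltrDl.
by rewrite addrAC subrr add0r normrN gtr0_norm.
Qed.

Lemma interior_near (L s d : R) : 0 < L -> 0 <= s <= L -> 0 < d ->
  exists2 t, 0 < t < L & `|t - s| < d.
Proof.
move=> L0 /andP[s0 sL] d0; pose e := Num.min (d / 2) (L / 4).
have e0 : 0 < e by rewrite lt_min !divr_gt0.
have ed : e <= d / 2 by rewrite ge_min lexx.
have em : e <= L / 4 by rewrite ge_min lexx orbT.
have [sm|sm] := leP s (L / 2).
  exists (s + e); first by apply/andP; split; lra.
  by rewrite addrAC subrr add0r gtr0_norm//; lra.
exists (s - e); first by apply/andP; split; lra.
by rewrite addrAC subrr add0r normrN gtr0_norm//; lra.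
Qed.

End RealInduction.

(** * The geodesic equation as a first order system *)

Section CkMore.
Context {R : realType}.

Lemma Ck_id k : Ck k [set: R] (fun x : R => x).
Proof.
elim: k => [|k IH]; split => //; try by move=> x _; exact: cvg_id.
move=> v; split; first by move=> x _; exact: derivable_id.
have -> : (fun x : R => 'D_v (fun x : R => x) x) = cst v by apply/funext => x; rewrite derive_id.
exact: Ck_cst.
Qed.

Lemma Ck_lin (V : normedModType R) k (U : set V) (l : V -> R) :
  linear l -> continuous l -> Ck k U l.
Proof.
move=> ll cl; have := Ck_complin (l := l) ll cl (Ck_id k).
by apply: Ck_sub.
Qed.

Lemma Ck_R_strict (S : set R) (f : R -> R) x : open S -> Ck 1 S f -> S x ->
  strict f x (fun h : R => h * 'D_1 f x).
Proof.
move=> oS Hf Sx e e0; have [d d0 Hd] := C1_near oS 1 Hf Sx e0.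
exists (d / 2) => [|y z yd zd]; first by rewrite divr_gt0.
have d2 : d / 2 < d by rewrite ltr_pdivrMr// ltr_pMr// ltr1n.
have yz : `|y - z| < d.
  by rewrite -(subrKA x) (splitr d) (le_lt_trans (ler_normD _ _))// ltrD// distrC.
have := Hd z (y - z) (lt_trans zd d2) yz.
by rewrite [_ *: 1]mulr1 [z + _]addrC subrK.
Qed.

Context {n : nat}.

Lemma norm_lsubmx (p : 'rV[R]_(n + n)) : `|lsubmx p| <= `|p|.
Proof. by apply/mx_norm_le => // j; rewrite mxE; exact: coord_le_norm. Qed.

Lemma norm_rsubmx (p : 'rV[R]_(n + n)) : `|rsubmx p| <= `|p|.
Proof. by apply/mx_norm_le => // j; rewrite mxE; exact: coord_le_norm. Qed.

Lemma lsubmx_continuous : continuous (fun p : 'rV[R]_(n + n) => lsubmx p).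
Proof.
move=> p; apply/continuous_epsP => e e0; exists e => // q qp.
by rewrite -linearB; exact: le_lt_trans (norm_lsubmx _) qp.
Qed.

Lemma rsubmx_continuous : continuous (fun p : 'rV[R]_(n + n) => rsubmx p).
Proof.
move=> p; apply/continuous_epsP => e e0; exists e => // q qp.
by rewrite -linearB; exact: le_lt_trans (norm_rsubmx _) qp.
Qed.

Lemma Ck_coordT k m (U : set 'rV[R]_m) j : Ck k U (fun p : 'rV[R]_m => p 0 j).
Proof.
apply: Ck_lin; last exact: coord_continuous.
by move=> a x y; rewrite !mxE.
Qed.

Lemma row_mx_split (p : 'rV[R]_(n + n)) : p = row_mx (lsubmx p) (rsubmx p).
Proof. by rewrite hsubmxK. Qed.

Lemma row_mx_lcoord (x v : 'rV[R]_n) k : (row_mx x v) 0 (lshift n k) = x 0 k.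
Proof. by rewrite row_mxEl. Qed.

Lemma row_mx_rcoord (x v : 'rV[R]_n) k : (row_mx x v) 0 (rshift n k) = v 0 k.
Proof. by rewrite row_mxEr. Qed.

Lemma ord_split (P : 'I_(n + n) -> Prop) :
  (forall k, P (lshift n k)) -> (forall k, P (rshift n k)) -> forall k, P k.
Proof.
by move=> Hl Hr k; rewrite -(splitK k); case: (fintype.split k).
Qed.

Lemma is_derive_row_mx (x v : R -> 'rV[R]_n) t x' v' :
  is_derive t (1:R) x x' -> is_derive t (1:R) v v' ->
  is_derive t (1:R) (fun s => row_mx (x s) (v s)) (row_mx x' v').
Proof.
move=> /is_derive_mx dx /is_derive_mx dv; apply/is_derive_mx; apply: ord_split => k.
  rewrite row_mx_lcoord.
  have -> : (fun s => row_mx (x s) (v s) 0 (lshift n k)) = (fun s => x s 0 k).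
    by apply/funext => s; rewrite row_mx_lcoord.
  exact: dx.
rewrite row_mx_rcoord.
have -> : (fun s => row_mx (x s) (v s) 0 (rshift n k)) = (fun s => v s 0 k).
  by apply/funext => s; rewrite row_mx_rcoord.
exact: dv.
Qed.

Lemma is_derive_lsubmx (p : R -> 'rV[R]_(n + n)) t p' :
  is_derive t (1:R) p p' -> is_derive t (1:R) (fun s => lsubmx (p s)) (lsubmx p').
Proof.
move=> /is_derive_mx dp; apply/is_derive_mx => k; rewrite mxE.
have -> : (fun s => lsubmx (p s) 0 k) = (fun s => p s 0 (lshift n k)).
  by apply/funext => s; rewrite mxE.
exact: dp.
Qed.

Lemma is_derive_rsubmx (p : R -> 'rV[R]_(n + n)) t p' :
  is_derive t (1:R) p p' -> is_derive t (1:R) (fun s => rsubmx (p s)) (rsubmx p').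
Proof.
move=> /is_derive_mx dp; apply/is_derive_mx => k; rewrite mxE.
have -> : (fun s => rsubmx (p s) 0 k) = (fun s => p s 0 (rshift n k)).
  by apply/funext => s; rewrite mxE.
exact: dp.
Qed.

Definition pball (x0 : 'rV[R]_n) (r C : R) : set 'rV[R]_(n + n) :=
  [set p | `|lsubmx p - x0| <= r /\ `|rsubmx p| <= C].

Lemma norm_row_mx (x v : 'rV[R]_n) C : `|x| <= C -> `|v| <= C -> `|row_mx x v| <= C.
Proof.
move=> xC vC; apply/mx_norm_le; first exact: le_trans xC.
apply: ord_split => k; rewrite ?row_mx_lcoord ?row_mx_rcoord.
  exact: le_trans (coord_le_norm _ _) xC.
exact: le_trans (coord_le_norm _ _) vC.
Qed.

Lemma closed_norm_le (V W : normedModType R) (f : V -> W) (a : W) (C : R) :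
  continuous f -> closed [set p | `|f p - a| <= C].
Proof.
move=> cf; have -> : [set p | `|f p - a| <= C] = (fun p => `|f p - a|) @^-1` [set x | x <= C] by [].
apply: preimage_closed; last exact: closed_le.
move=> p _; apply: (@continuous_comp _ _ _ (fun p => f p - a) (fun y : W => `|y|)).
  by apply: cvgB; [exact: cf|exact: cvg_cst].
exact: norm_continuous.
Qed.

Lemma pball_compact x0 r C : 0 <= r -> 0 <= C -> compact (pball x0 r C).
Proof.
move=> r0 C0; apply: bounded_closed_compact.
  exists (`|x0| + r + C); split; first exact: num_real.
  move=> D hD p [h1 h2] /=; apply: ltW; apply: le_lt_trans hD.
  rewrite (row_mx_split p); apply: norm_row_mx.
    rewrite -(subrK x0 (lsubmx p)) (le_trans (ler_normD _ _))// addrC -addrA lerD//.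
    by rewrite (le_trans h1)// lerDl.
  by rewrite (le_trans h2)// lerDr addr_ge0.
have -> : pball x0 r C = [set p | `|lsubmx p - x0| <= r] `&` [set p | `|rsubmx p - 0| <= C].
  by apply/seteqP; split => p; rewrite /pball /= subr0.
by apply: closedI; apply: closed_norm_le; [exact: lsubmx_continuous|exact: rsubmx_continuous].
Qed.

Lemma pball_segment x0 r C : segment_closed (pball x0 r C).
Proof.
move=> p q t [p1 p2] [q1 q2] /andP[t0 t1].
have t1' : 0 <= 1 - t by rewrite subr_ge0.
have E (a b D : R) : a <= D -> b <= D -> t * a + (1 - t) * b <= D.
  move=> aD bD; have -> : D = t * D + (1 - t) * D by ring.
  by rewrite lerD// ler_wpM2l.
split.
  have -> : lsubmx (q + t *: (p - q)) - x0 = t *: (lsubmx p - x0) + (1 - t) *: (lsubmx q - x0).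
    by apply/rowP => k; rewrite !mxE; ring.
  apply: le_trans (ler_normD _ _) _; rewrite !normrZ (ger0_norm t0) (ger0_norm t1').
  exact: E.
have -> : rsubmx (q + t *: (p - q)) = t *: rsubmx p + (1 - t) *: rsubmx q.
  by apply/rowP => k; rewrite !mxE; ring.
apply: le_trans (ler_normD _ _) _; rewrite !normrZ (ger0_norm t0) (ger0_norm t1').
exact: E.
Qed.

End CkMore.

Section PhaseField.
Context {R : realType} {n : nat} {M : topologicalType}.
Context {A : smooth_manifold R n M} (g : riemannian_metric A).
Implicit Types (i j : chart_index A) (x u v w z : 'rV[R]_n) (c : R -> M).

(** The geodesic equation x'' = - Gamma_x(x', x') as a first order equation for
    the pair (x, x'). *)
Definition gfield i (p : 'rV[R]_(n + n)) : 'rV[R]_(n + n) :=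
  row_mx (rsubmx p) (- christoffel g i (lsubmx p) (rsubmx p) (rsubmx p)).

Definition pcod i : set 'rV[R]_(n + n) := [set p | chart_cod i (lsubmx p)].

Lemma pcod_open i : open (pcod i).
Proof.
have -> : pcod i = (fun p : 'rV[R]_(n + n) => lsubmx p) @^-1` chart_cod i by [].
apply: open_comp; last exact: chart_cod_open.
by move=> p _; exact: lsubmx_continuous.
Qed.

(** The velocity half is linear and the acceleration half is quadratic in the
    velocity with smooth coefficients. *)
Lemma gfield_Ck i m k : Ck m (pcod i) (fun p => gfield i p 0 k).
Proof.
move: k; apply: ord_split => k.
  have -> : (fun p => gfield i p 0 (lshift n k)) = (fun p => p 0 (rshift n k)).
    by apply/funext => p; rewrite /gfield row_mx_lcoord mxE.
  exact: Ck_coordT.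
have oU := @pcod_open i.
pose G a b y := christoffel g i y (delta_mx 0 a) (delta_mx 0 b) 0 k.
apply: (Ck_ext oU (f := fun p : 'rV[R]_(n + n) =>
  - \sum_a \sum_b p 0 (rshift n a) * p 0 (rshift n b) * G a b (lsubmx p))).
  move=> p ip; rewrite /gfield row_mx_rcoord [in RHS]mxE.
  rewrite (bilinear_fieldE (christoffel_field g i k) _ _ ip); congr (- _).
  by apply: eq_bigr => a _; apply: eq_bigr => b _; rewrite ![rsubmx _ 0 _]mxE.
apply: CkN => //; apply: Ck_sum => // a _; apply: Ck_sum => // b _.
apply: CkM => //; first by apply: CkM => //; exact: Ck_coordT.
have -> : (fun p : 'rV[R]_(n + n) => G a b (lsubmx p)) = G a b \o (fun p : 'rV[R]_(n + n) => lsubmx p) by [].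
apply: Ck_complin.
- by move=> h p q; rewrite linearP.
- exact: lsubmx_continuous.
by have [_ /(_ a b m)] := christoffel_field g i k.
Qed.

Lemma is_derive_affine (V : normedModType R) (y v : V) t :
  is_derive (t:R) (1:R) (fun s : R => y + s *: v) v.
Proof.
apply/is_derive_epsP => e e0; exists 1 => // h _; rewrite [h *: 1]mulr1.
have -> : y + (h + t) *: v - (y + t *: v) - h *: v = 0.
  rewrite scalerDl [h *: v + _]addrC addrA [y + t *: v + _]addrC addrK.
  exact: subrr.
by rewrite normr0 mulr_ge0// ltW.
Qed.

Lemma christoffel_derive i (c a b : R -> 'rV[R]_n) t x' a' b' : chart_cod i (c t) ->
  is_derive t (1:R) c x' -> is_derive t (1:R) a a' -> is_derive t (1:R) b b' ->
  is_derive t (1:R) (fun t => christoffel g i (c t) (a t) (b t))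
    ('D_x' (fun y => christoffel g i y (a t) (b t)) (c t)
     + christoffel g i (c t) a' (b t) + christoffel g i (c t) (a t) b').
Proof.
move=> ic dc da db; apply/is_derive_mx => k.
have := bilinear_field_derive (@chart_cod_open _ _ _ A i) (christoffel_field g i k) ic dc da db.
move=> /is_derive_eq; apply; rewrite [in RHS]mxE [X in _ = X + _]mxE; congr (_ + _ + _).
rewrite derive_mx ?mxE//; apply/derivable_mxP => o l; rewrite (ord1 o).
have := bilinear_field_smooth (@chart_cod_open _ _ _ A i) (christoffel_field g i l) (a t) (b t) 1%N.
by move=> H; exact: (C1_derivable H ic).
Qed.

(** The linearization of the geodesic field, obtained by differentiating it
    along a line in phase space. *)
Lemma jac_gfield i x v Y W : chart_cod i x ->
  jac (gfield i) (row_mx x v) (row_mx Y W) =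
  row_mx W (- ('D_Y (fun y => christoffel g i y v v) x
               + christoffel g i x W v + christoffel g i x v W)).
Proof.
move=> ix; have ip : pcod i (row_mx x v) by rewrite /pcod /= row_mxKl.
pose l (s : R) : 'rV[R]_(n + n) := row_mx x v + s *: row_mx Y W.
have l0 : l 0 = row_mx x v by rewrite /l scale0r addr0.
have H1 : jac (gfield i) (row_mx x v) (row_mx Y W) = 'D_1 (gfield i \o l) 0.
  have H k : is_derive (0:R) (1:R) (fun s => (gfield i \o l) s 0 k)
      (jac (gfield i) (row_mx x v) (row_mx Y W) 0 k).
    rewrite /jac mxE -l0.
    apply: (C1_chain (@pcod_open i) (gfield_Ck i 1 k) _ (is_derive_affine _ _ _)).
    by rewrite /= scale0r addr0.
  by apply/esym; have /is_derive_mx[] := H.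
rewrite H1; have ll s : lsubmx (l s) = x + s *: Y by rewrite /l linearD linearZ /= !row_mxKl.
have lr s : rsubmx (l s) = v + s *: W by rewrite /l linearD linearZ /= !row_mxKr.
have E : gfield i \o l = (fun s => row_mx (v + s *: W)
    (- christoffel g i (x + s *: Y) (v + s *: W) (v + s *: W))).
  by apply/funext => s; rewrite /= /gfield ll lr.
have ix0 : chart_cod i (x + 0 *: Y) by rewrite scale0r addr0.
have := is_derive_row_mx (is_derive_affine v W 0)
  (is_deriveN (christoffel_derive ix0 (is_derive_affine x Y 0) (is_derive_affine v W 0) (is_derive_affine v W 0))).
by rewrite -[X in is_derive _ _ X _]E !scale0r !addr0 => -[].
Qed.

Definition phase i c t : 'rV[R]_(n + n) := row_mx (chart i (c t)) (vel i c t).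

Lemma phase_derive (U : set R) c i t : geodesic_on g U c -> U t -> chart_dom i (c t) -> open U ->
  is_derive t (1:R) (phase i c) (gfield i (phase i c t)).
Proof.
move=> [sc gc] Ut it oU; rewrite /gfield row_mxKl row_mxKr.
apply: is_derive_row_mx; first exact: (vel_derive sc Ut it).
by have := acc_derive g sc Ut it; rewrite (geodesic_acc oU sc gc Ut it) sub0r.
Qed.

Lemma gfield_bounds i x0 r C : 0 <= r -> 0 <= C ->
  (forall x, `|x - x0| <= r -> chart_cod i x) ->
  exists2 L, 0 <= L &
  [/\ forall p q, pball x0 r C p -> `|jac (gfield i) p q| <= L * `|q|,
      forall p q, pball x0 r C p -> pball x0 r C q -> `|gfield i p - gfield i q| <= L * `|p - q|,
      forall p q h, pball x0 r C p -> pball x0 r C q ->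
        `|jac (gfield i) p h - jac (gfield i) q h| <= L * `|p - q| * `|h| &
      forall p q h, pball x0 r C p -> pball x0 r C q -> pball x0 r C h ->
       `|gfield i p - gfield i q - jac (gfield i) h (p - q)| <= L * (`|p - h| + `|q - h|) * `|p - q|].
Proof.
move=> r0 C0 rcod; apply: (C2_compact_mx (U := pcod i) (@pcod_open i)).
- by move=> p [h _]; exact: rcod.
- exact: pball_compact.
- exact: pball_segment.
- by move=> k; exact: gfield_Ck.
Qed.

Lemma closed_ball_cod i x0 : chart_cod i x0 ->
  exists2 r, 0 < r & forall x, `|x - x0| <= r -> chart_cod i x.
Proof.
move=> ix; have [d d0 H] := open_eps (@chart_cod_open _ _ _ A i) ix.
exists (d / 2); first by rewrite divr_gt0.
move=> x xd; apply: H; apply: le_lt_trans xd _.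
by rewrite ltr_pdivrMr// ltr_pMr// ltr1n.
Qed.

Lemma compact_closed_ball (x0 : 'rV[R]_n) r : compact [set x | `|x - x0| <= r].
Proof.
apply: bounded_closed_compact.
  exists (`|x0| + r); split; first exact: num_real.
  move=> D hD x /= h; apply: ltW; apply: le_lt_trans hD.
  by rewrite -(subrK x0 x) (le_trans (ler_normD _ _))// addrC lerD2l.
by apply: closed_norm_le => y; exact: cvg_id.
Qed.

(** The coordinate v_k is the inner product of v with the k-th row of the
    inverse Gram matrix; apply Cauchy-Schwarz. *)
Lemma inner_coord i x v k : chart_cod i x ->
  v 0 k ^+ 2 <= inner g i x v v * invmx (gram g i x) k k.
Proof.
(* The vector dual to the k-th coordinate. *)
move=> ix; pose e := (delta_mx 0 k : 'rV[R]_n) *m invmx (gram g i x).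
have uG := gram_unit g ix.
have H (w : 'rV[R]_n) : inner g i x e w = w 0 k.
  rewrite /inner /e mulmxKV// mxE (bigD1 k)//= big1 ?addr0 => [|l lk].
    by rewrite !mxE !eqxx mul1r.
  by rewrite !mxE (negbTE lk) andbF mul0r.
have := inner_CS g e v ix; rewrite !H mulrC.
suff -> : e 0 k = invmx (gram g i x) k k by [].
rewrite /e mxE (bigD1 k)//= big1 ?addr0 => [|l lk].
  by rewrite !mxE !eqxx mul1r.
by rewrite !mxE (negbTE lk) andbF mul0r.
Qed.

(** Over a compact ball of the chart the Riemannian norm dominates the
    coordinate norm. *)
Lemma vel_bound i x0 r : (forall x, `|x - x0| <= r -> chart_cod i x) ->
  exists2 C, 0 <= C & forall x v, `|x - x0| <= r -> `|v| ^+ 2 <= C * inner g i x v v.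
Proof.
move=> rcod; pose K := [set x : 'rV[R]_n | `|x - x0| <= r].
have HI k : exists2 C, 0 <= C & forall x, K x -> `|invmx (gram g i x) k k| <= C.
  apply: compact_bound; first exact: compact_closed_ball.
  move=> x Kx; have H : Ck 0 (chart_cod (s := A) i) (fun x => invmx (gram g i x) k k).
    apply: Ck_invmx; first exact: chart_cod_open.
      by move=> y; exact: gram_unit.
    by move=> a b; exact: gram_smooth.
  by case: H => + _; apply; exact: rcod.
have [C HC] := @choice 'I_n R (fun k C => 0 <= C /\ forall x, K x -> `|invmx (gram g i x) k k| <= C)
  (fun k => let: ex_intro2 C C0 HC := HI k in ex_intro _ C (conj C0 HC)).
have S0 : 0 <= \sum_k C k by apply: sumr_ge0 => k _; case: (HC k).
exists (\sum_k C k) => // x v xr; have ix := rcod x xr.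
have : `|v| <= Num.sqrt ((\sum_k C k) * inner g i x v v).
  apply/mx_norm_le; first exact: sqrtr_ge0.
  move=> k; rewrite -sqrtr_sqr ler_wsqrtr// (le_trans (inner_coord v k ix))// mulrC.
  rewrite ler_wpM2r ?inner_ge0//; case: (HC k) => Ck0 /(_ x xr) h.
  rewrite (le_trans (ler_norm _))// (le_trans h)// (bigD1 k)//= lerDl.
  by apply: sumr_ge0 => l _; case: (HC l).
rewrite -(@ler_pXn2r _ 2)// ?nnegrE ?sqrtr_ge0// sqr_sqrtr//.
by rewrite mulr_ge0// inner_ge0.
Qed.

End PhaseField.

(** * Uniqueness of geodesics and conservation of speed *)

Section Geodesics.
Context {R : realType} {n : nat} {M : topologicalType}.
Context {A : smooth_manifold R n M} (g : riemannian_metric A).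
Implicit Types (i j : chart_index A) (x u v w z : 'rV[R]_n) (c : R -> M).

Notation vlc := (@velocity R n M A).

(** Equality of two curves at time t to first order. It is locked because
    comparing velocities by conversion is expensive. *)
Definition agree_def c1 c2 (t : R) := c1 t = c2 t /\ vlc c1 t = vlc c2 t.
Fact agree_key : unit. Proof. by []. Qed.
Definition agree := locked_with agree_key agree_def.

Lemma agreeP c1 c2 t : agree c1 c2 t <-> c1 t = c2 t /\ vlc c1 t = vlc c2 t.
Proof. by rewrite /agree unlock. Qed.

Section Two.
Context (U : set R) (oU : open U) (c1 c2 : R -> M).

Lemma agree_phase i t : @smooth_curve R n M A U c1 -> @smooth_curve R n M A U c2 -> U t ->
  agree c1 c2 t -> chart_dom i (c1 t) -> phase i c1 t = phase i c2 t.
Proof.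
move=> s1 s2 Ut /agreeP[E V] it; rewrite /phase E; congr row_mx.
have it2 : chart_dom i (c2 t) by rewrite -E.
rewrite (vel_tau s1 Ut (chart_atP _ _) it) (vel_tau s2 Ut (chart_atP _ _) it2).
move: V; rewrite !velocityE.
by rewrite E => ->.
Qed.

Lemma phase_agree i t : @smooth_curve R n M A U c1 -> @smooth_curve R n M A U c2 -> U t ->
  chart_dom i (c1 t) -> chart_dom i (c2 t) -> phase i c1 t = phase i c2 t -> agree c1 c2 t.
Proof.
move=> s1 s2 Ut i1 i2 /eq_row_mx[E V].
have E' : c1 t = c2 t by rewrite -(chartK i1) E chartK.
apply/agreeP; split; first exact: E'.
rewrite !velocityE.
by rewrite (vel_tau s1 Ut i1 (chart_atP _ _)) (vel_tau s2 Ut i2 (chart_atP _ _)) E V E'.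
Qed.

End Two.

Lemma chart_curve_cont c i (t : R) : {for t, continuous c} -> chart_dom i (c t) ->
  {for t, continuous (chart i \o c)}.
Proof. by move=> cc it; apply: continuous_comp => //; exact: chart_continuous. Qed.

Lemma phase_near (U : set R) c i t0 r : open U -> geodesic_on g U c -> U t0 -> chart_dom i (c t0) ->
  0 < r -> exists2 d, 0 < d & forall t, `|t - t0| < d ->
  [/\ U t, chart_dom i (c t) & pball (chart i (c t0)) r (`|vel i c t0| + 1) (phase i c t)].
Proof.
move=> oU gc Ut it r0; have [sc _] := gc.
have [d1 d10 H1] := (nbhs_epsP _ _).1 (curve_near oU (smooth_curve_cont sc Ut) Ut it).
have cp : {for t0, continuous (phase i c)}.
  by apply/differentiable_continuous/derivable1_diffP; case: (phase_derive gc Ut it oU).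
have m0 : 0 < Num.min r 1 by rewrite lt_min r0 ltr01.
have [d2 d20 H2] := (continuous_epsP _ _).1 cp _ m0.
exists (Num.min d1 d2) => [|t]; first by rewrite lt_min d10.
rewrite lt_min => /andP[/H1[Ut' it'] /H2]; rewrite lt_min => /andP[h1 h2].
split => //; split.
  have := le_trans (norm_lsubmx _) (ltW h1).
  by rewrite linearB /phase /= !row_mxKl.
have := le_trans (norm_rsubmx _) (ltW h2).
rewrite linearB /phase /= !row_mxKr => h.
by rewrite -(subrK (vel i c t0) (vel i c t)) (le_trans (ler_normD _ _))// addrC lerD2l.
Qed.

Lemma pball_mono x0 (r C C' : R) p : C <= C' -> pball x0 r C p -> pball x0 r C' p.
Proof. by move=> CC [h1 h2]; split => //; exact: le_trans h2 CC. Qed.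

(** Gronwall in one chart around the common point: agreement at one nearby time
    spreads to all nearby times. *)
Lemma agree_local (U : set R) c1 c2 t0 : open U -> geodesic_on g U c1 -> geodesic_on g U c2 ->
  U t0 -> c1 t0 = c2 t0 -> exists2 d, 0 < d & forall t1 t,
    `|t1 - t0| < d -> `|t - t0| < d -> agree c1 c2 t1 -> agree c1 c2 t.
Proof.
move=> oU g1 g2 Ut0 E; have [s1 _] := g1; have [s2 _] := g2.
pose i := chart_at A (c1 t0); have i1 : chart_dom i (c1 t0) by exact: chart_atP.
have i2 : chart_dom i (c2 t0) by rewrite -E.
have [r r0 rcod] := closed_ball_cod (chart_in_cod i1).
have [d1 d10 H1] := phase_near oU g1 Ut0 i1 r0.
have [d2 d20 H2] := phase_near oU g2 Ut0 i2 r0.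
pose C := Num.max (`|vel i c1 t0| + 1) (`|vel i c2 t0| + 1).
have C0 : 0 <= C by rewrite le_max addr_ge0.
have [L L0 [_ HL _ _]] := gfield_bounds g (ltW r0) C0 rcod.
pose d := Num.min d1 d2 / 2.
have m0 : 0 < Num.min d1 d2 by rewrite lt_min d10.
have d0 : 0 < d by rewrite divr_gt0.
have dm : d < Num.min d1 d2 by rewrite ltr_pdivrMr// ltr_pMr// ltr1n.
have K t : t0 - d <= t <= t0 + d ->
    [/\ U t, chart_dom i (c1 t), chart_dom i (c2 t),
      pball (chart i (c1 t0)) r C (phase i c1 t) & pball (chart i (c1 t0)) r C (phase i c2 t)].
  rewrite -ler_distl => td; have := le_lt_trans td dm; rewrite lt_min => /andP[/H1[? ? p1] /H2[? ? p2]].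
  split => //; first by apply: pball_mono p1; rewrite le_max lexx.
  by rewrite E; apply: pball_mono p2; rewrite le_max lexx orbT.
exists d => // t1 t t1d td ag.
have I1 : t0 - d <= t1 <= t0 + d by rewrite -ler_distl ltW.
have I2 : t0 - d <= t <= t0 + d by rewrite -ler_distl ltW.
have ab : t0 - d <= t0 + d by rewrite lerD2l ge0_cp ?ltW.
have := @gronwall_vec R _ (fun t => phase i c1 t - phase i c2 t)
  (fun t => gfield g i (phase i c1 t) - gfield g i (phase i c2 t)) L 0 _ _ L0 (lexx _) ab _ _ t1 t I1 I2.
have [U1 j1 _ _ _] := K _ I1; have [U2 k1 k2 _ _] := K _ I2.
rewrite (agree_phase s1 s2 U1 ag j1) subrr normr0 addr0 mulr0 => H.
apply: (phase_agree s1 s2 U2 k1 k2); apply/eqP; rewrite -subr_eq0 -normr_le0; apply: H.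
  move=> s /K[Us is1 is2 _ _]; apply: is_deriveB.
    exact: (phase_derive g1 Us is1 oU).
  exact: (phase_derive g2 Us is2 oU).
by move=> s /K[Us is1 is2 p1 p2]; rewrite addr0; exact: HL.
Qed.

Lemma hausdorff_eq c1 c2 (t0 : R) : {for t0, continuous c1} -> {for t0, continuous c2} ->
  (forall d, 0 < d -> exists2 t, `|t - t0| < d & c1 t = c2 t) -> c1 t0 = c2 t0.
Proof.
move=> h1 h2 H; apply: (mfd_hausdorff A) => B1 B2 n1 n2.
have /nbhs_epsP[d1 d10 H1] := h1 _ n1; have /nbhs_epsP[d2 d20 H2] := h2 _ n2.
have d0 : 0 < Num.min d1 d2 by rewrite lt_min d10.
have [t + E] := H _ d0; rewrite lt_min => /andP[/H1 ? /H2 ?].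
by exists (c1 t); split => //; rewrite E.
Qed.

(** Real induction along the ray sg * t. At a limit time the two curves meet by
    the Hausdorff property, and agree_local carries agreement up to that time
    and beyond it. *)
Lemma geodesic_unique (U : set R) c1 c2 (sg b : R) : open U -> geodesic_on g U c1 ->
  geodesic_on g U c2 -> `|sg| = 1 -> 0 <= b -> (forall t, 0 <= t <= b -> U (sg * t)) ->
  agree c1 c2 0 -> forall t, 0 <= t <= b -> agree c1 c2 (sg * t).
Proof.
move=> oU g1 g2 sg1 b0 HU ag0.
have D (s t : R) : `|sg * s - sg * t| = `|s - t| by rewrite -mulrBr normrM sg1 mul1r.
apply: real_ind; [exact: b0|by rewrite mulr0| |].
- move=> e /andP[e0 eb] He; have Ue : U (sg * e) by apply: HU; rewrite eb ltW.
  have E : c1 (sg * e) = c2 (sg * e).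
    apply: hausdorff_eq.
    - by case: g1 => s1 _; exact: (smooth_curve_cont s1).
    - by case: g2 => s2 _; exact: (smooth_curve_cont s2).
    move=> d /(left_near e0)[t /He/agreeP[Et _] td]; exists (sg * t) => //; by rewrite D.
  have [d d0 Hd] := agree_local oU g1 g2 Ue E.
  have [t te td] := left_near e0 d0.
  by apply: (Hd (sg * t)); [rewrite D|rewrite subrr normr0|exact: He].
- move=> e /andP[e0 eb] He.
  have Ue : U (sg * e) by apply: HU; rewrite e0 ltW.
  have ee : 0 <= e <= e by rewrite e0 lexx.
  have /agreeP[Ee _] := He e ee.
  have [d d0 Hd] := agree_local oU g1 g2 Ue Ee.
  exists d => // t /andP[et ted]; apply: (Hd (sg * e)); last exact: He.
    by rewrite subrr normr0.
  by rewrite D gtr0_norm ?subr_gt0// ltrBlDl.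
Qed.

Lemma geodesic_uniqueT c1 c2 : geodesic_on g setT c1 -> geodesic_on g setT c2 ->
  agree c1 c2 0 -> forall t, agree c1 c2 t.
Proof.
move=> g1 g2 ag t; have [t0|t0] := leP 0 t.
  have := geodesic_unique openT g1 g2 (normr1 _) t0 (fun _ _ => I) ag.
  by move=> /(_ t); rewrite mul1r t0 lexx; exact.
have sg1 : `|-1| = 1 :> R by rewrite normrN normr1.
have t0' : 0 <= - t by rewrite oppr_ge0 ltW.
have := geodesic_unique openT g1 g2 sg1 t0' (fun _ _ => I) ag.
by move=> /(_ (- t)); rewrite mulN1r opprK t0' lexx; exact.
Qed.

Definition energy c t : R := inner_at g (c t) (vlc c t) (vlc c t).

Lemma energy_ge0 c t : 0 <= energy c t.
Proof. by apply: inner_ge0; apply: chart_in_cod; exact: chart_atP. Qed.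

(** The connection is metric, so the derivative of the squared speed is twice
    the inner product of velocity and acceleration. *)
Lemma energy_const c : geodesic_on g setT c -> forall t, energy c t = energy c 0.
Proof.
move=> gc t; have [sc ac] := gc; apply: is_derive_0_is_cst => {}t.
pose i := chart_at A (c t); have it : chart_dom i (c t) by exact: chart_atP.
have cc := smooth_curve_cont sc (I : setT t).
apply: (@near_eq_is_derive _ _ _ (fun s => inner g i ((chart i \o c) s) (vel i c s) (vel i c s))).
  have := curve_near openT cc (I : setT t) it; apply: filterS => s [_ is_].
  by rewrite /energy (velocity_inner g sc (I : setT s) is_).
have dv := acc_derive g sc (I : setT t) it.
rewrite (geodesic_acc openT sc ac (I : setT t) it) sub0r in dv.
have := bilinear_field_derive (@chart_cod_open _ _ _ A i) (inner_field g i)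
   (chart_in_cod it) (vel_derive sc (I : setT t) it) dv dv.
move=> /is_derive_eq; apply; rewrite -(dinnerE g) dinner_christoffel; last exact: chart_in_cod.
by rewrite innerNl innerNr; ring.
Qed.

(** A curve with chart velocity at most V cannot leave a chart ball before its
    radius is exhausted. The image of the closed ball is compact, hence closed
    in the manifold, so the curve does not escape from the chart domain either. *)
Lemma curve_stays c i x0 (t1 r R0 V tau : R) : @smooth_curve R n M A setT c ->
  (forall x, `|x - x0| <= R0 -> chart_cod i x) -> 0 <= V -> 0 <= tau -> r + V * tau < R0 ->
  (forall t, chart_dom i (c t) -> `|chart i (c t) - x0| <= R0 -> `|vel i c t| <= V) ->
  chart_dom i (c t1) -> `|chart i (c t1) - x0| <= r ->
  forall t, `|t - t1| <= tau -> chart_dom i (c t) /\ `|chart i (c t) - x0| <= r + V * tau.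
Proof.
move=> sc rcod V0 tau0 rV HV it1 ht1 t tt1.
pose sg : R := if 0 <= t - t1 then 1 else -1.
have sg1 : `|sg| = 1 by rewrite /sg; case: ifP; rewrite ?normrN normr1.
have tE : t = t1 + sg * `|t - t1|.
  rewrite /sg; case: ifPn => [h|]; first by rewrite ger0_norm// mul1r addrC subrK.
  by rewrite -ltNge => h; rewrite ltr0_norm// mulN1r opprK addrC subrK.
pose P (s : R) := chart_dom i (c (t1 + sg * s)) /\ `|chart i (c (t1 + sg * s)) - x0| <= r + V * s.
have D (s s' : R) : `|t1 + sg * s - (t1 + sg * s')| = `|s - s'|.
  have -> : t1 + sg * s - (t1 + sg * s') = sg * (s - s') by ring.
  by rewrite normrM sg1 mul1r.
have cc (s : R) : {for s, continuous c} := smooth_curve_cont sc (I : setT s).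
have Vle (s : R) : s <= tau -> r + V * s <= r + V * tau by move=> h; rewrite lerD2l ler_wpM2l.
have key : forall s, 0 <= s <= tau -> P s.
  apply: real_ind => //.
  - by rewrite /P mulr0 addr0 mulr0 addr0.
  - move=> e /andP[e0 etau] He.
    pose K := chart_inv (s := A) i @` [set x | `|x - x0| <= r + V * tau].
    have cK : closed K.
      apply: compact_closed; first exact: mfd_hausdorff A.
      apply: continuous_compact; last exact: compact_closed_ball.
      apply: continuous_in_subspaceT => x /[1!inE] /= xr; apply: chart_inv_continuous.
      by apply: rcod; exact: le_trans xr (ltW rV).
    have : K (c (t1 + sg * e)).
      apply: cK => B nB; have /nbhs_epsP[d d0 Hd] := cc _ _ nB.
      have [s s0e sd] := left_near e0 d0; exists (c (t1 + sg * s)); split; last first.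
        by apply: Hd; rewrite D.
      have [is_ sr] := He s s0e; exists (chart i (c (t1 + sg * s))); last exact: chartK.
      apply: (le_trans sr); apply: Vle; case/andP: s0e => _ se.
      exact: le_trans (ltW se) etau.
    move=> [y yr yE]; have iy : chart_cod i y by apply: rcod; exact: le_trans yr (ltW rV).
    have ie : chart_dom i (c (t1 + sg * e)) by rewrite -yE; exact: chart_inv_in_dom.
    split => //; rewrite leNgt; apply/negP => h.
    have h0 : 0 < `|chart i (c (t1 + sg * e)) - x0| - (r + V * e) by rewrite subr_gt0.
    have [d d0 Hd] := (continuous_epsP _ _).1 (chart_curve_cont (cc _) ie) _ h0.
    have [s s0e sd] := left_near e0 d0; have [_ sr] := He s s0e.
    have := Hd (t1 + sg * s); rewrite D => /(_ sd) /=; rewrite ltNge => /negP; apply.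
    rewrite lerBlDr; apply: (@le_trans _ _ (`|chart i (c (t1 + sg * s)) - chart i (c (t1 + sg * e))| + `|chart i (c (t1 + sg * s)) - x0|)).
      by rewrite -[in leLHS](subrKA (chart i (c (t1 + sg * s)))) (le_trans (ler_normD _ _))// lerD2r distrC.
    rewrite lerD2l (le_trans sr)// lerD2l ler_wpM2l//.
    by case/andP: s0e => _ /ltW.
  - move=> e /andP[e0 etau] He.
    have ee : 0 <= e <= e by rewrite e0 lexx.
    have [ie er] := He e ee.
    have hR : 0 < R0 - `|chart i (c (t1 + sg * e)) - x0|.
      rewrite subr_gt0; apply: le_lt_trans er _; apply: le_lt_trans rV.
      by apply: Vle; exact: ltW.
    have [d1 d10 H1] := (continuous_epsP _ _).1 (chart_curve_cont (cc _) ie) _ hR.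
    have [d2 d20 H2] := (nbhs_epsP _ _).1 (curve_near openT (cc _) (I : setT _) ie).
    exists (Num.min d1 d2) => [|s /andP[es sd]]; first by rewrite lt_min d10.
    have near_e (v : R) : `|v - (t1 + sg * e)| <= s - e -> chart_dom i (c v) /\ `|chart i (c v) - x0| <= R0.
      move=> hv; have : `|v - (t1 + sg * e)| < Num.min d1 d2.
        by apply: le_lt_trans hv _; rewrite ltrBlDl.
      rewrite lt_min => /andP[/H1 h1 /H2[_ h2]]; split => //.
      rewrite -(subrKA (chart i (c (t1 + sg * e)))) (le_trans (ler_normD _ _))//.
      by rewrite -lerBrDr ltW.
    have es0 : `|sg * (s - e)| = s - e by rewrite normrM sg1 mul1r gtr0_norm// subr_gt0.
    have := @vec_mvt2 R n (chart i \o c) (vel i c) 0 V (t1 + sg * e) (sg * (s - e)) V0.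
    rewrite es0 scaler0 subr0; have -> : t1 + sg * e + sg * (s - e) = t1 + sg * s by ring.
    move=> mv; have [is_ _] : chart_dom i (c (t1 + sg * s)) /\ `|chart i (c (t1 + sg * s)) - x0| <= R0.
      by apply: near_e; rewrite D gtr0_norm// subr_gt0.
    split => //; rewrite -(subrKA (chart i (c (t1 + sg * e)))) (le_trans (ler_normD _ _))//.
    have -> : r + V * s = V * (s - e) + (r + V * e) by ring.
    apply: lerD => //; apply: mv.
      by move=> v /near_e[iv _]; exact: (vel_derive sc (I : setT v) iv).
    by move=> v /near_e[iv vr]; rewrite subr0; exact: HV.
have h : 0 <= `|t - t1| <= tau by rewrite normr_ge0.
have [] := key _ h; rewrite -tE => h1 h2; split => //.
by apply: (le_trans h2); exact: Vle.
Qed.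

End Geodesics.

(** * Smooth dependence of a family of geodesics on its parameter *)

Section StrictMore.
Context {R : realType}.

Lemma jac_bound m p (U : set 'rV[R]_m) (F : 'rV[R]_m -> 'rV[R]_p) z : open U ->
  (forall k, Ck 1 U (fun x => F x 0 k)) -> U z ->
  exists2 C, 0 <= C & forall w, `|jac F z w| <= C * `|w|.
Proof.
move=> oU HF Uz; have H k := derive_bound oU (HF k) Uz.
have [C HC] := @choice 'I_p R (fun k C => 0 <= C /\ forall w, `|'D_w (fun y => F y 0 k) z| <= C * `|w|)
  (fun k => let: ex_intro2 C C0 HC := H k in ex_intro _ C (conj C0 HC)).
have S0 : 0 <= \sum_k C k by apply: sumr_ge0 => k _; case: (HC k).
exists (\sum_k C k) => // w; apply/mx_norm_le; first by rewrite mulr_ge0.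
move=> k; rewrite /jac mxE; have [_ /(_ w)/le_trans] := HC k; apply.
rewrite ler_wpM2r// (bigD1 k)//= lerDl; apply: sumr_ge0 => l _; by case: (HC l).
Qed.

Lemma jac_strict m p (U : set 'rV[R]_m) (F : 'rV[R]_m -> 'rV[R]_p) z : open U ->
  (forall k, Ck 1 U (fun x => F x 0 k)) -> U z -> strict F z (jac F z).
Proof.
move=> oU HF Uz; apply/strict_mx => k; have := C1_strict oU (HF k) Uz.
by congr strict; apply/funext => v; rewrite /jac mxE.
Qed.

Lemma Ck_R_strict_mx m (S : set R) (f : R -> 'rV[R]_m) x : open S ->
  (forall k, Ck 1 S (fun s => f s 0 k)) -> S x -> exists Y, strict f x (fun h : R => h *: Y).
Proof.
move=> oS Hf Sx; exists (\row_k 'D_1 (fun s => f s 0 k) x); apply/strict_mx => k.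
have := Ck_R_strict oS (Hf k) Sx.
by congr strict; apply/funext => h; rewrite !mxE.
Qed.

Lemma strict_curve_cont m (f : R -> 'rV[R]_m) x Y : strict f x (fun h : R => h *: Y) ->
  {for x, continuous f}.
Proof.
move=> sf; apply: (strict_cont (C := `|Y|) _ _ sf) => // w.
by rewrite normrZ mulrC.
Qed.

Lemma strict_curve_derive m (f : R -> 'rV[R]_m) x Y : strict f x (fun h : R => h *: Y) ->
  is_derive x (1:R) f Y.
Proof.
move=> sf; have := strict_derive (v := (1:R)) _ sf; rewrite scale1r; apply => h.
by rewrite [h *: (1 : R)]mulr1.
Qed.

(** A derivative is as close to w as all its small difference quotients are. *)
Lemma derive_near m (f : R -> 'rV[R]_m) x df w e d : 0 <= e -> 0 < d ->
  is_derive x (1:R) f df ->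
  (forall h, `|h| < d -> `|f (x + h) - f x - h *: w| <= e * `|h|) -> `|df - w| <= e.
Proof.
move=> e0 d0 /is_derive_epsP Hf Hw; apply/ler_addgt0Pl => eta eta0.
have [d' d'0 Hd'] := Hf eta eta0.
pose h := Num.min d d' / 2.
have m0 : 0 < Num.min d d' by rewrite lt_min d0.
have h0 : 0 < h by rewrite divr_gt0.
have : h < Num.min d d' by rewrite ltr_pdivrMr// ltr_pMr// ltr1n.
have hh : `|h| = h by rewrite gtr0_norm.
rewrite lt_min => /andP[hd hd'].
have := Hw h; rewrite hh => /(_ hd) H1.
have := Hd' h; rewrite hh [h *: 1]mulr1 [h + x]addrC => /(_ hd') H2.
rewrite -(ler_pM2l h0) -[X in X * _]hh -normrZ.
have -> : h *: (df - w) = (f (x + h) - f x - h *: w) - (f (x + h) - f x - h *: df).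
  by apply/rowP => k; rewrite !mxE; ring.
by rewrite (le_trans (ler_normB _ _))// addrC mulrDr lerD// mulrC.
Qed.

End StrictMore.

Section Family.
Context {R : realType} {n : nat} {M : topologicalType}.
Context {A : smooth_manifold R n M} (g : riemannian_metric A).
Context (U : set R) (oU : open U) (gamma : R -> M) (sgamma : @smooth_curve R n M A U gamma).
Context (eps : R) (lam : R -> R -> M).
Context (glam : forall s, U s -> geodesic_on g setT (lam s)).
Context (lam0 : forall s, U s -> lam s 0 = gamma s).
Context (vlam : forall s, U s -> @velocity R n M A (lam s) 0 = eps *: @velocity R n M A gamma s).
Implicit Types (i j : chart_index A).

Lemma energy_near s0 : U s0 -> exists2 d, 0 < d & forall s, `|s - s0| < d ->
  U s /\ energy g gamma s <= energy g gamma s0 + 1.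
Proof.
move=> Us; pose i := chart_at A (gamma s0); have is0 : chart_dom i (gamma s0) by exact: chart_atP.
have cg := smooth_curve_cont sgamma Us.
have dv := acc_derive g sgamma Us is0.
have H := bilinear_field_derive (@chart_cod_open _ _ _ A i) (inner_field g i)
   (chart_in_cod is0) (vel_derive sgamma Us is0) dv dv.
have cf : {for s0, continuous (fun s => inner g i ((chart i \o gamma) s) (vel i gamma s) (vel i gamma s))}.
  by apply/differentiable_continuous/derivable1_diffP; case: H.
have [d1 d10 H1] := (continuous_epsP _ _).1 cf 1 ltr01.
have [d2 d20 H2] := (nbhs_epsP _ _).1 (curve_near oU cg Us is0).
exists (Num.min d1 d2) => [|s]; first by rewrite lt_min d10.
rewrite lt_min => /andP[/H1 h1 /H2[Us' is_]]; split => //.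
rewrite /energy (velocity_inner g sgamma Us' is_) (velocity_inner g sgamma Us is0).
by rewrite addrC -lerBlDr ltW// (le_lt_trans (ler_norm _))//.
Qed.

Lemma energy_lam s u : U s -> energy g (lam s) u = eps ^+ 2 * energy g gamma s.
Proof.
move=> Us; rewrite (energy_const (glam Us)) /energy vlam// lam0// /inner_at innerZl innerZr.
by rewrite mulrA expr2.
Qed.

Let slam s : U s -> @smooth_curve R n M A setT (lam s).
Proof. by move=> Us; case: (glam Us). Qed.

Lemma lam_cont s u : U s -> {for u, continuous (lam s)}.
Proof. by move=> Us; exact: (smooth_curve_cont (slam Us)). Qed.

(** All nearby poles have nearly the same constant speed, so by curve_stays
    they remain in one compact piece of a single chart for a common length of
    time. *)
Lemma tube s0 u0 i : U s0 -> chart_dom i (lam s0 u0) -> exists r C rho,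
  [/\ 0 <= r, 0 <= C, 0 < rho, (forall x, `|x - chart i (lam s0 u0)| <= r -> chart_cod i x) &
   forall u1, `|u1 - u0| < rho -> {for s0, continuous (lam^~ u1)} ->
   exists2 d, 0 < d & forall s u, `|s - s0| < d -> `|u - u0| <= rho ->
    [/\ U s, chart_dom i (lam s u) & pball (chart i (lam s0 u0)) r C (phase i (lam s) u)]].
Proof.
move=> Us0 is0; set x0 := chart i (lam s0 u0).
have [R0 R00 rcod] := closed_ball_cod (chart_in_cod is0).
have [C1 C10 HC1] := vel_bound g rcod.
pose S := eps ^+ 2 * (energy g gamma s0 + 1).
have S0 : 0 <= S by rewrite mulr_ge0 ?sqr_ge0// addr_ge0 ?energy_ge0.
pose V := C1 * S + 1.
have V1 : 1 <= V by rewrite lerDr mulr_ge0.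
have V0 : 0 < V by exact: lt_le_trans V1.
have HV x v : `|x - x0| <= R0 -> inner g i x v v <= S -> `|v| <= V.
  move=> xr vS; rewrite -(@ler_pXn2r _ 2)// ?nnegrE ?(ltW V0)//.
  apply: le_trans (HC1 x v xr) _; apply: (@le_trans _ _ (C1 * S)); first by rewrite ler_wpM2l.
  apply: (@le_trans _ _ V); first by rewrite lerDl.
  by rewrite expr2 ler_peMl// ltW.
have R4 : 0 < R0 / 4 by rewrite divr_gt0.
have c0 : {for u0, continuous (lam s0)} := lam_cont Us0.
have [d1 d10 H1] := (continuous_epsP _ _).1 (chart_curve_cont c0 is0) _ R4.
have [d2 d20 H2] := (nbhs_epsP _ _).1 (curve_near openT c0 (I : setT u0) is0).
(* The points lam s u1 lie within R0 / 4 + R0 / 4 of the centre, and a pole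
   moves by at most V * (2 * rho) <= R0 / 4 within the time allowed. *)
pose rho := Num.min (Num.min d1 d2) (R0 / 8 / V).
have rho0 : 0 < rho by rewrite !lt_min d10 d20 !divr_gt0.
exists R0, V, rho; split => //; [exact: ltW|exact: ltW|].
move=> u1 u1rho; have := u1rho; rewrite !lt_min => /andP[/andP[u1d1 u1d2] _] cu1.
have [_ is1] := H2 _ u1d2; have h1 := H1 _ u1d1.
have [d3 d30 H3] := (continuous_epsP _ _).1 (chart_curve_cont (c := lam^~ u1) cu1 is1) _ R4.
have [d4 d40 H4] := (nbhs_epsP _ _).1 (curve_near oU (c := lam^~ u1) cu1 Us0 is1).
have [d5 d50 H5] := energy_near Us0.
exists (Num.min (Num.min d3 d4) d5); first by rewrite !lt_min d30 d40.
move=> s u; rewrite !lt_min => /andP[/andP[/H3 s3 /H4[Us is_]] /H5[_ s5]] uu0.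
have Vr : V * (2 * rho) <= R0 / 4.
  have h : rho <= R0 / 8 / V by rewrite ge_min lexx orbT.
  apply: (@le_trans _ _ (V * (2 * (R0 / 8 / V)))); first by rewrite ler_wpM2l ?(ltW V0)// ler_wpM2l.
  by rewrite le_eqVlt; apply/orP; left; apply/eqP; field; rewrite gt_eqF.
have [|||||iu ru] := @curve_stays R n M A (lam s) i x0 u1 (R0 / 2) R0 V (2 * rho) (slam Us) rcod (ltW V0) _ _ _ is_ _ u.
- by rewrite mulr_ge0// ltW.
- apply: (@le_lt_trans _ _ (R0 / 2 + R0 / 4)); first by rewrite lerD2l.
  have -> : R0 / 2 + R0 / 4 = R0 * (3 / 4) by field.
  by rewrite gtr_pMr// ltr_pdivrMr// mul1r ltr_nat.
- move=> t it tr; apply: (HV _ _ tr); rewrite -(velocity_inner g (slam Us) (I : setT t) it).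
  by rewrite -/(energy g (lam s) t) energy_lam// ler_wpM2l// sqr_ge0.
- rewrite -(subrKA (chart i (lam s0 u1))) (le_trans (ler_normD _ _))//.
  have -> : R0 / 2 = R0 / 4 + R0 / 4 by field.
  by rewrite lerD// ltW.
- rewrite -(subrKA u0) (le_trans (ler_normD _ _))// mulr2n mulrDl mul1r lerD//.
  by rewrite distrC ltW.
split => //; split.
  rewrite /phase row_mxKl (le_trans ru)//.
  apply: (@le_trans _ _ (R0 / 2 + R0 / 4)); first by rewrite lerD2l.
  have -> : R0 / 2 + R0 / 4 = R0 * (3 / 4) by field.
  by rewrite ler_piMr ?(ltW R00)// ler_pdivrMr// mul1r ler_nat.
rewrite /phase row_mxKr; apply: (HV (chart i (lam s u))).
  apply: (le_trans ru); apply: (@le_trans _ _ (R0 / 2 + R0 / 4)); first by rewrite lerD2l.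
  have -> : R0 / 2 + R0 / 4 = R0 * (3 / 4) by field.
  by rewrite ler_piMr ?(ltW R00)// ler_pdivrMr// mul1r ler_nat.
rewrite -(velocity_inner g (slam Us) (I : setT u) iu).
by rewrite -/(energy g (lam s) u) energy_lam// ler_wpM2l// sqr_ge0.
Qed.

(** Differentiability of the family in the parameter s at the time u. The
    derivative may depend on the chart, so only its existence is recorded. *)
Definition sdiff s0 u := {for s0, continuous (lam^~ u)} /\
  forall i, chart_dom i (lam s0 u) ->
    exists Y, strict (fun s => phase i (lam s) u) s0 (fun h : R => h *: Y).

Definition ptau i j (p : 'rV[R]_(n + n)) : 'rV[R]_(n + n) :=
  row_mx (tau i j (lsubmx p)) (dtau i j (lsubmx p) (rsubmx p)).

Definition poverlap i j : set 'rV[R]_(n + n) := [set p | overlap i j (lsubmx p)].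

Lemma poverlap_open i j : open (poverlap i j).
Proof.
have -> : poverlap i j = (fun p : 'rV[R]_(n + n) => lsubmx p) @^-1` overlap i j by [].
apply: open_comp; last exact: overlap_open.
by move=> p _; exact: lsubmx_continuous.
Qed.

Lemma ptau_Ck i j m k : Ck m (poverlap i j) (fun p => ptau i j p 0 k).
Proof.
have lC (f : 'rV[R]_n -> R) : Ck m (overlap i j) f -> Ck m (poverlap i j) (f \o (fun p : 'rV[R]_(n + n) => lsubmx p)).
  apply: Ck_complin; last exact: lsubmx_continuous.
  by move=> h p q; rewrite linearP.
move: k; apply: ord_split => k.
  have -> : (fun p => ptau i j p 0 (lshift n k)) = (fun y => tau i j y 0 k) \o (fun p : 'rV[R]_(n + n) => lsubmx p).
    by apply/funext => p; rewrite /ptau row_mx_lcoord.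
  by apply: lC; exact: tau_Ck.
have oU' := @poverlap_open i j.
pose D a y := 'D_(delta_mx 0 a) (fun y => tau i j y 0 k) y.
apply: (Ck_ext oU' (f := fun p : 'rV[R]_(n + n) => \sum_a p 0 (rshift n a) * D a (lsubmx p))).
  move=> p ip; rewrite /ptau row_mx_rcoord dtau_coord.
  rewrite (derive_sumE (@overlap_open _ _ _ A i j) _ (tau_Ck i j k 1) ip).
  by apply: eq_bigr => a _; rewrite [rsubmx _ 0 _]mxE.
apply: Ck_sum => // a _; apply: CkM => //; first exact: Ck_coordT.
apply: (lC (D a)); rewrite /D.
by have [_ /(_ (delta_mx 0 a))[]] := tau_Ck i j k m.+1.
Qed.

(** Chain rule with the transition map of phase space. *)
Lemma sdiff_chart s0 u i j Y : U s0 -> {for s0, continuous (lam^~ u)} -> chart_dom i (lam s0 u) ->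
  chart_dom j (lam s0 u) -> strict (fun s => phase i (lam s) u) s0 (fun h : R => h *: Y) ->
  exists Z, strict (fun s => phase j (lam s) u) s0 (fun h : R => h *: Z).
Proof.
move=> Us0 cu is0 js0 sY.
have ox : poverlap i j (phase i (lam s0) u).
  by rewrite /poverlap /= /phase row_mxKl; exact: chart_overlap.
have Tk k := ptau_Ck i j 1 k; have oT := @poverlap_open i j.
exists (jac (ptau i j) (phase i (lam s0) u) Y).
have [C C0 HC] := jac_bound oT Tk ox.
have Y0 : 0 <= `|Y| by [].
have hY (h : R) : `|h *: Y| <= `|Y| * `|h| by rewrite normrZ mulrC.
have TB a b := @jacB R _ _ oT _ (ptau i j) _ a b Tk ox.
have := strict_comp Y0 C0 hY HC TB sY (jac_strict oT Tk ox).
have -> : jac (ptau i j) (phase i (lam s0) u) \o ( *:%R^~ Y) = (fun h : R => h *: jac (ptau i j) (phase i (lam s0) u) Y).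
  apply/funext => h /=; exact: (@jacZ R _ _ _ (ptau i j) _ h Y Tk ox).
apply: strict_congr.
have n1 := curve_near oU (c := lam^~ u) cu Us0 is0.
have n2 := curve_near oU (c := lam^~ u) cu Us0 js0.
move: n1 n2; apply: filterS2 => s [Us is_] [_ js] /=.
rewrite /ptau /phase row_mxKl row_mxKr tau_chart//; congr row_mx.
by rewrite -(vel_tau (slam Us) (I : setT u) is_ js).
Qed.

Lemma lam_near0 s0 : U s0 -> \forall s \near s0, gamma s = lam s 0.
Proof.
by move=> Us; apply: filterS (open_nbhs_nbhs (conj oU Us)) => s /lam0.
Qed.

Lemma lam_vel0 s i : U s -> chart_dom i (gamma s) -> vel i (lam s) 0 = eps *: vel i gamma s.
Proof.
move=> Us is_; have E := lam0 Us.
have is0 : chart_dom i (lam s 0) by rewrite E.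
rewrite (vel_tau (slam Us) (I : setT 0) (chart_atP A _) is0) -velocityE vlam//.
rewrite (vel_tau sgamma Us (chart_atP A _) is_) E dtauZ ?velocityE//.
exact: chart_overlap (chart_atP A _) is_.
Qed.

(** At u = 0 the phase of the pole is that of gamma, with the velocity
    multiplied by eps. *)
Lemma sdiff0 s0 : U s0 -> sdiff s0 0.
Proof.
move=> Us; have cg := smooth_curve_cont sgamma Us.
have c0 : {for s0, continuous (lam^~ 0)}.
  rewrite /prop_for /continuous_at /= lam0//; apply: cvg_trans cg.
  by apply: near_eq_cvg; exact: lam_near0.
split => // i; rewrite lam0// => is0.
pose S := [set t | U t /\ chart_dom i (gamma t)].
have oS : open S.
  rewrite openE => t [Ut it]; exact: (curve_near oU (smooth_curve_cont sgamma Ut) Ut it).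
have [Y HY] : exists Y, strict (fun s => row_mx (chart i (gamma s)) (eps *: vel i gamma s)) s0 (fun h : R => h *: Y).
  apply: (@Ck_R_strict_mx _ _ S) => //; have [_ /(_ i) Hi] := sgamma.
  apply: ord_split => k.
    have -> : (fun s => row_mx (chart i (gamma s)) (eps *: vel i gamma s) 0 (lshift n k)) =
       (fun s => (chart i \o gamma) s 0 k).
      by apply/funext => s; rewrite row_mx_lcoord.
    by apply: Ck_coord => //; exact: Hi.
  have -> : (fun s => row_mx (chart i (gamma s)) (eps *: vel i gamma s) 0 (rshift n k)) =
     (fun s => eps * ('D_1 (chart i \o gamma) s) 0 k).
    by apply/funext => s; rewrite row_mx_rcoord mxE velE derive1E.
  apply: CkM => //; first exact: (@Ck_cst R R 1 R S eps).
  apply: Ck_coord => //; have [_ /(_ 1)[_ H]] := Hi 2%N; exact: H.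
exists Y; apply: strict_congr HY.
have := curve_near oU cg Us is0; apply: filterS => s [Us' is_].
by rewrite /phase lam0// lam_vel0.
Qed.

(** Inside a tube flow_strict transports differentiability from one time to
    another. *)
Lemma sdiff_local s0 u0 : U s0 -> exists2 rho, 0 < rho & forall u1 u, `|u1 - u0| < rho ->
  `|u - u0| < rho -> sdiff s0 u1 -> sdiff s0 u.
Proof.
move=> Us0; pose i := chart_at A (lam s0 u0).
have is0 : chart_dom i (lam s0 u0) by exact: chart_atP.
have [r [C [rho [r0 C0 rho0 rcod Htube]]]] := tube Us0 is0.
exists rho => // u1 u u1r ur [cu1 Su1].
have [d d0 Hd] := Htube u1 u1r cu1.
have [L L0 [b1 b2 b3 b4]] := gfield_bounds g r0 C0 rcod.
have s0d : `|s0 - s0| < d by rewrite subrr normr0.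
have [_ i1 _] := Hd s0 u1 s0d (ltW u1r).
have [Y1 HY1] := Su1 i i1.
have Bp p : pball (chart i (lam s0 u0)) r C p -> pcod i p by move=> [h _]; exact: rcod.
have gC k := gfield_Ck g i 1 k.
have I1 v : `|v - u0| < rho -> u0 - rho <= v <= u0 + rho by move=> h; rewrite -ler_distl ltW.
have I2 v : u0 - rho <= v <= u0 + rho -> `|v - u0| <= rho by rewrite ler_distl.
have [] := @flow_strict R _ (pball (chart i (lam s0 u0)) r C) (gfield g i) (jac (gfield g i)) L L0
  (fun z v w Bz => @jacB R _ _ (@pcod_open _ _ _ A i) _ _ z v w gC (Bp z Bz))
  (fun z h w Bz => @jacZ R _ _ _ _ z h w gC (Bp z Bz)) b1 b2 b4
  (fun s u => phase i (lam s) u) s0 d (u0 - rho) (u0 + rho) u1 Y1 d0 (I1 _ u1r) _ _ HY1 u (I1 _ ur).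
- by move=> s v sd /I2 vr; have [] := Hd s v sd vr.
- move=> s v sd /I2 vr; have [Us is_ _] := Hd s v sd vr.
  exact: (phase_derive (glam Us) (I : setT v) is_ openT).
move=> Y HY; have [_ iu _] := Hd s0 u s0d (ltW ur).
have cu : {for s0, continuous (lam^~ u)}.
  have cp := strict_curve_cont HY.
  have cx : {for s0, continuous (fun s => chart i (lam s u))}.
    have -> : (fun s => chart i (lam s u)) = (fun p : 'rV[R]_(n + n) => lsubmx p) \o (fun s => phase i (lam s) u).
      by apply/funext => s; rewrite /= /phase row_mxKl.
    apply: (@continuous_comp _ _ _ (fun s => phase i (lam s) u) (fun p : 'rV[R]_(n + n) => lsubmx p)).
      exact: cp.
    exact: lsubmx_continuous.
  have cc : {for s0, continuous (chart_inv i \o (fun s => chart i (lam s u)))}.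
    apply: (@continuous_comp _ _ _ (fun s => chart i (lam s u)) (chart_inv i)); first exact: cx.
    by apply: chart_inv_continuous; exact: chart_in_cod.
  rewrite /prop_for /continuous_at /= -[lam s0 u](chartK iu).
  have H : \forall s \near s0, (chart_inv i \o (fun s => chart i (lam s u))) s = lam s u.
    apply/nbhs_epsP; exists d => // s sd; have [_ is_ _] := Hd s u sd (ltW ur).
    by rewrite /= chartK.
  by apply: cvg_trans cc; apply: near_eq_cvg; exact: H.
split => // j ju; exact: (sdiff_chart Us0 cu iu ju HY).
Qed.

(** Real induction along the pole, starting from the base curve. *)
Lemma sdiff_all s0 u : U s0 -> sdiff s0 u.
Proof.
move=> Us0; pose sg : R := if 0 <= u then 1 else -1.
have sg1 : `|sg| = 1 by rewrite /sg; case: ifP; rewrite ?normrN normr1.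
have uE : u = sg * `|u|.
  rewrite /sg; case: ifPn => [h|]; first by rewrite ger0_norm// mul1r.
  by rewrite -ltNge => h; rewrite ltr0_norm// mulN1r opprK.
have D (s t : R) : `|sg * s - sg * t| = `|s - t| by rewrite -mulrBr normrM sg1 mul1r.
rewrite uE; have h : 0 <= `|u| <= `|u| by rewrite normr_ge0 lexx.
apply: (real_ind (P := fun t => sdiff s0 (sg * t)) (b := `|u|) _ _ _ _ h).
- exact: normr_ge0.
- by rewrite mulr0; exact: sdiff0.
- move=> e /andP[e0 eb] He.
  have [rho rho0 Hrho] := sdiff_local (sg * e) Us0.
  have [t te td] := left_near e0 rho0; apply: (Hrho (sg * t)).
  + by rewrite D.
  + by rewrite subrr normr0.
  exact: He.
- move=> e /andP[e0 eb] He; have [rho rho0 Hrho] := sdiff_local (sg * e) Us0.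
  exists rho => // t /andP[et ted]; apply: (Hrho (sg * e)).
  + by rewrite subrr normr0.
  + by rewrite D gtr0_norm ?subr_gt0// ltrBlDl.
  by apply: He; rewrite e0 lexx.
Qed.

(** The variation field of the family in the phase space of the chart i: its
    first half is the variation of the position, its second half that of the
    velocity. *)
Definition Yd i s u : 'rV[R]_(n + n) := 'D_1 (fun s => phase i (lam s) u) s.

Lemma Yd_strict i s u : U s -> chart_dom i (lam s u) ->
  strict (fun s => phase i (lam s) u) s (fun h : R => h *: Yd i s u).
Proof.
move=> Us is_; have [_ /(_ i is_)[Y HY]] := sdiff_all u Us.
by have [_ E] := strict_curve_derive HY; rewrite /Yd E.
Qed.

Lemma Yd_derive i s u : U s -> chart_dom i (lam s u) ->
  is_derive s (1:R) (fun s => phase i (lam s) u) (Yd i s u).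
Proof. by move=> Us is_; exact: strict_curve_derive (Yd_strict Us is_). Qed.

(** The variation field solves the linearized geodesic equation and is jointly
    continuous in the two parameters. Continuity in s comes from strict
    differentiability, continuity in u is uniform in s by the equation. *)
Lemma family_local s0 u0 i : U s0 -> chart_dom i (lam s0 u0) ->
  (exists2 d, 0 < d & forall s u, `|s - s0| < d -> `|u - u0| < d ->
    [/\ U s, chart_dom i (lam s u) &
     is_derive u (1:R) (Yd i s) (jac (gfield g i) (phase i (lam s) u) (Yd i s u))])
  /\ (forall e, 0 < e -> exists2 d, 0 < d & forall s u, `|s - s0| < d -> `|u - u0| < d ->
     `|phase i (lam s) u - phase i (lam s0) u0| < e /\ `|Yd i s u - Yd i s0 u0| < e).
Proof.
move=> Us0 is0.
have [r [C [rho [r0 C0 rho0 rcod Htube]]]] := tube Us0 is0.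
have u0rho : `|u0 - u0| < rho by rewrite subrr normr0.
have [cu0 _] := sdiff_all u0 Us0.
have [d d0 Hd] := Htube u0 u0rho cu0.
have [L L0 [b1 b2 b3 b4]] := gfield_bounds g r0 C0 rcod.
have Bp p : pball (chart i (lam s0 u0)) r C p -> pcod i p by move=> [h _]; exact: rcod.
have gC k := gfield_Ck g i 1 k.
have I1 v : `|v - u0| < rho -> u0 - rho <= v <= u0 + rho by move=> h; rewrite -ler_distl ltW.
have I2 v : u0 - rho <= v <= u0 + rho -> `|v - u0| <= rho by rewrite ler_distl.
have J1 z v w (Bz : pball (chart i (lam s0 u0)) r C z) := @jacB R _ _ (@pcod_open _ _ _ A i) _ _ z v w gC (Bp z Bz).
have J2 z (h : R) w (Bz : pball (chart i (lam s0 u0)) r C z) := @jacZ R _ _ _ _ z h w gC (Bp z Bz).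
have HB s v : `|s - s0| < d -> u0 - rho <= v <= u0 + rho -> pball (chart i (lam s0 u0)) r C (phase i (lam s) v).
  by move=> sd /I2 vr; have [] := Hd s v sd vr.
have HD s v : `|s - s0| < d -> u0 - rho <= v <= u0 + rho ->
    is_derive v (1:R) (phase i (lam s)) (gfield g i (phase i (lam s) v)).
  move=> sd /I2 vr; have [Us is_ _] := Hd s v sd vr.
  exact: (phase_derive (glam Us) (I : setT v) is_ openT).
have part1 s u : `|s - s0| < d -> `|u - u0| < rho -> [/\ U s, chart_dom i (lam s u) &
     is_derive u (1:R) (Yd i s) (jac (gfield g i) (phase i (lam s) u) (Yd i s u))].
  move=> sd ur; have [Us is_ _] := Hd s u sd (ltW ur); split => //.
  have dd : 0 < d - `|s - s0| by rewrite subr_gt0.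
  have sub t : `|t - s| < d - `|s - s0| -> `|t - s0| < d.
    by rewrite ltrBrDr => h; rewrite -(subrKA s) (le_lt_trans (ler_normD _ _)).
  have ss : s0 - s0 = 0 by rewrite subrr.
  have sY v : u0 - rho <= v <= u0 + rho -> strict (fun s => phase i (lam s) v) s (fun h : R => h *: Yd i s v).
    by move=> /I2 vr; have [_ iv _] := Hd s v sd vr; exact: Yd_strict.
  have uI : u0 - rho < u < u0 + rho by rewrite -ltr_distl.
  exact: (@flow_derive R _ (pball (chart i (lam s0 u0)) r C) (gfield g i) (jac (gfield g i)) L L0
    J1 J2 b1 b2 b3 b4 (fun s u => phase i (lam s) u) s (d - `|s - s0|) (u0 - rho) (u0 + rho) u (Yd i s u)
    dd (I1 _ ur) (fun t v td => HB t v (sub t td)) (fun t v td => HD t v (sub t td)) (sY u (I1 _ ur))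
    (Yd i s) sY u uI).
split.
  exists (Num.min d rho) => [|s u]; first by rewrite lt_min d0.
  by rewrite !lt_min => /andP[sd _] /andP[_ ur]; exact: part1.
have [L1 [d1 [L10 /andP[d10 d1d] Hlip]]] := @flow_lip R _ (pball (chart i (lam s0 u0)) r C) (gfield g i) L L0
  b2 (fun s u => phase i (lam s) u) s0 d (u0 - rho) (u0 + rho) u0 (Yd i s0 u0) d0 (I1 _ u0rho) HB HD (Yd_strict Us0 is0).
have Ybound s u : `|s - s0| < d1 -> `|u - u0| < rho -> `|Yd i s u| <= L1.
  move=> sd ur; have [Us is_ _] := Hd s u (lt_le_trans sd d1d) (ltW ur).
  rewrite -[Yd i s u]subr0.
  have dd : 0 < d1 - `|s - s0| by rewrite subr_gt0.
  apply: (derive_near (x := s) (f := fun s => phase i (lam s) u) (d := d1 - `|s - s0|)) => //; first exact: Yd_derive.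
  move=> h hd; rewrite scaler0 subr0 -[X in _ <= _ * `|X|](addrK s) [h + s]addrC.
  apply: Hlip => //; last exact: I1.
  rewrite addrAC (le_lt_trans (ler_normD _ _))//.
  by move: hd; rewrite ltrBrDr [`|h| + _]addrC.
have Ylip s u : `|s - s0| < d1 -> `|u - u0| < rho -> `|Yd i s u - Yd i s u0| <= L * L1 * `|u - u0|.
  move=> sd ur; have := @vec_mvt2 R _ (Yd i s) (fun v => jac (gfield g i) (phase i (lam s) v) (Yd i s v)) 0 (L * L1) u0 (u - u0).
  rewrite scaler0 subr0 [u0 + _]addrC subrK; apply; first by rewrite mulr_ge0.
    move=> v vu; have vr := le_lt_trans vu ur.
    by have [] := part1 s v (lt_le_trans sd d1d) vr.
  move=> v vu; have vr := le_lt_trans vu ur; rewrite subr0.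
  apply: le_trans (b1 _ _ (HB _ _ (lt_le_trans sd d1d) (I1 _ vr))) _.
  by rewrite ler_wpM2l// Ybound.
have cphase := phase_derive (glam Us0) (I : setT u0) is0 openT.
have cph : {for u0, continuous (phase i (lam s0))}.
  by apply/differentiable_continuous/derivable1_diffP; case: cphase.
move=> e e0; have e2 : 0 < e / 2 by rewrite divr_gt0.
have e4 : 0 < e / 4 by rewrite divr_gt0.
have [d2 d20 H2] := (continuous_epsP _ _).1 cph _ e2.
have [d3 d30 H3] := Yd_strict Us0 is0 e4.
have L11 : 0 < L1 + 1 by rewrite ltr_wpDl.
have LL1 : 0 < L * L1 + 1 by rewrite ltr_wpDl// mulr_ge0.
exists (Num.min (Num.min (Num.min d1 rho) (Num.min d2 d3)) (Num.min (e / 2 / (L1 + 1)) (e / 2 / (L * L1 + 1)))).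
  by rewrite !lt_min d10 rho0 d20 d30 !divr_gt0.
move=> s u; rewrite !lt_min => /andP[/andP[/andP[s1 _] /andP[_ s3]] /andP[s4 _]].
move=> /andP[/andP[/andP[_ ur] /andP[u2 _]] /andP[_ u5]]; split.
  have s0d1 : `|s0 - s0| < d1 by rewrite subrr normr0.
  have h1 : `|phase i (lam s) u - phase i (lam s0) u| <= L1 * `|s - s0| := Hlip s s0 u s1 s0d1 (I1 _ ur).
  have h2 := H2 u u2.
  rewrite -(subrKA (phase i (lam s0) u)) (le_lt_trans (ler_normD _ _))// [e]splitr ler_ltD//.
  apply: (le_trans h1); move: s4; rewrite ltr_pdivlMr// => /ltW; apply: le_trans.
  by rewrite mulrC ler_wpM2l// lerDl.
have h1 : `|Yd i s u - Yd i s u0| <= e / 2.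
  apply: (le_trans (Ylip s u s1 ur)); move: u5; rewrite ltr_pdivlMr// => /ltW; apply: le_trans.
  by rewrite mulrC ler_wpM2l// lerDl.
have h2 : `|Yd i s u0 - Yd i s0 u0| <= e / 4.
  have [Us is_ _] := Hd s u0 (lt_le_trans s1 d1d) (ltW u0rho).
  apply: (derive_near (x := s) (f := fun s => phase i (lam s) u0) (d := d3 - `|s - s0|)) (ltW e4) _ (Yd_derive Us is_) _.
    by rewrite subr_gt0.
  move=> h hd; have := H3 (s + h) s; rewrite [s + h - s]addrAC subrr add0r; apply => //.
  by rewrite addrAC (le_lt_trans (ler_normD _ _))//; move: hd; rewrite ltrBrDr [`|h| + _]addrC.
rewrite -(subrKA (Yd i s u0)) (le_lt_trans (ler_normD _ _))//.
apply: (@le_lt_trans _ _ (e / 2 + e / 4)); first exact: lerD.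
have -> : e / 2 + e / 4 = e * (3 / 4) by field.
by rewrite gtr_pMr// ltr_pdivrMr// mul1r ltr_nat.
Qed.

End Family.

(** * Algebra of the curvature tensor *)

Section Curvature.
Context {R : realType} {n : nat} {M : topologicalType}.
Context {A : smooth_manifold R n M} (g : riemannian_metric A).
Implicit Types (i : chart_index A) (x u v w z : 'rV[R]_n).

Definition dchr_def i x u v w : 'rV[R]_n := 'D_u (fun y => christoffel g i y v w) x.
Fact dchr_key : unit. Proof. by []. Qed.
Definition dchr := locked_with dchr_key dchr_def.

Lemma dchrE i x u v w : dchr i x u v w = 'D_u (fun y => christoffel g i y v w) x.
Proof. by rewrite /dchr unlock. Qed.

Lemma chr_Ck i v w k m : Ck m (chart_cod (s := A) i) (fun y => christoffel g i y v w 0 k).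
Proof. exact: (bilinear_field_smooth (@chart_cod_open _ _ _ A i) (christoffel_field g i k) v w m). Qed.

Lemma chr_derive i x u v w : chart_cod i x ->
  is_derive x u (fun y => christoffel g i y v w) (dchr i x u v w).
Proof.
move=> ix; rewrite dchrE; apply: derivableP; apply/derivable_mxP => o k; rewrite (ord1 o).
exact: (C1_derivable (chr_Ck i v w k 1) ix).
Qed.

Lemma dchr_coord i x u v w k : chart_cod i x ->
  dchr i x u v w 0 k = 'D_u (fun y => christoffel g i y v w 0 k) x.
Proof. by move=> /(chr_derive u v w)/is_derive_mx/(_ k)[]. Qed.

Lemma dchrDu i x u u' v w : chart_cod i x -> dchr i x (u + u') v w = dchr i x u v w + dchr i x u' v w.
Proof.
move=> ix; apply/rowP => k; rewrite [RHS]mxE !(dchr_coord _ _ _ k ix).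
exact: (deriveDdir (@chart_cod_open _ _ _ A i) _ _ (chr_Ck i v w k 1) ix).
Qed.

Lemma dchrZu i x (a : R) u v w : chart_cod i x -> dchr i x (a *: u) v w = a *: dchr i x u v w.
Proof.
by move=> ix; have [d _] := chr_derive u v w ix; rewrite !dchrE (deriveZdir _ d).
Qed.

Lemma dchr_sym i x u v w : chart_cod i x -> dchr i x u v w = dchr i x u w v.
Proof.
move=> ix; rewrite !dchrE; apply: (derive_congr _ (@chart_cod_open _ _ _ A i) ix) => y iy.
exact: christoffel_sym.
Qed.

Lemma dchrDl i x u v v' w : chart_cod i x -> dchr i x u (v + v') w = dchr i x u v w + dchr i x u v' w.
Proof.
move=> ix; rewrite [LHS]dchrE.
have E y : chart_cod i y -> christoffel g i y (v + v') w =
    ((fun y => christoffel g i y v w) + (fun y => christoffel g i y v' w)) y.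
  by move=> iy; exact: christoffelDl.
rewrite (derive_congr _ (@chart_cod_open _ _ _ A i) ix E).
by have [_ ->] := is_deriveD (chr_derive u v w ix) (chr_derive u v' w ix).
Qed.

Lemma dchrZl i x (a : R) u v w : chart_cod i x -> dchr i x u (a *: v) w = a *: dchr i x u v w.
Proof.
move=> ix; rewrite [LHS]dchrE.
have E y : chart_cod i y -> christoffel g i y (a *: v) w = (a \*: (fun y => christoffel g i y v w)) y.
  by move=> iy; exact: christoffelZl.
rewrite (derive_congr _ (@chart_cod_open _ _ _ A i) ix E).
by have [_ ->] := is_deriveZ a (chr_derive u v w ix).
Qed.

Lemma curvatureE i x v w z : curvature g i x v w z =
  (dchr i x v w z + christoffel g i x v (christoffel g i x w z))
  - (dchr i x w v z + christoffel g i x w (christoffel g i x v z)).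
Proof. by rewrite /curvature !dchrE. Qed.

Lemma curvatureDl i x v v' w z : chart_cod i x ->
  curvature g i x (v + v') w z = curvature g i x v w z + curvature g i x v' w z.
Proof.
move=> ix; rewrite !curvatureE (dchrDu v v' w z ix) (dchrDl w v v' z ix).
rewrite (christoffelDl g v v' _ ix) (christoffelDl g v v' _ ix).
rewrite (christoffelDr g w _ _ ix).
have E (a a' b b' c c' d d' : 'rV[R]_n) :
    a + a' + (b + b') - (c + c' + (d + d')) = a + b - (c + d) + (a' + b' - (c' + d')).
  by apply/rowP => k; rewrite !mxE; ring.
exact: E.
Qed.

Lemma curvatureZl i x (a : R) v w z : chart_cod i x ->
  curvature g i x (a *: v) w z = a *: curvature g i x v w z.
Proof.
move=> ix; rewrite !curvatureE (dchrZu a v w z ix) (dchrZl a w v z ix).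
rewrite (christoffelZl g a v _ ix) (christoffelZl g a v _ ix).
rewrite (christoffelZr g a w _ ix).
by rewrite !scalerDr scalerN !scalerDr.
Qed.

Lemma curvature_vv i x v z : curvature g i x v v z = 0.
Proof. by rewrite curvatureE subrr. Qed.

(** Division by the Gram determinant disappears for an orthogonal pair with a
    unit second vector. *)
Lemma sectional_inner (K : R) i x v w : sectional_lt g K -> chart_cod i x -> v != 0 ->
  inner g i x w w = 1 -> inner g i x v w = 0 ->
  inner g i x (curvature g i x v w w) v < K * inner g i x v v.
Proof.
move=> sK ix v0 w1 vw; have vv := inner_gt0 g ix v0.
have rf : row_free (col_mx v w).
  rewrite -kermx_eq0; apply/eqP/row_matrixP => k; rewrite row0.
  have : row k (kermx (col_mx v w)) *m col_mx v w = 0 by rewrite -row_mul mulmx_ker row0.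
  set y := row _ _; rewrite -[y]hsubmxK mul_row_col.
  have E (a : 'rV[R]_1) (t : 'rV[R]_n) : a *m t = a 0 0 *: t.
    by rewrite {1}[a]mx11_scalar mul_scalar_mx.
  rewrite !E => H.
  have h2 : (rsubmx y) 0 0 = 0.
    have := congr1 (fun t => inner g i x t w) H.
    by rewrite /= innerDl !innerZl vw w1 inner0l mulr0 add0r mulr1.
  have h1 : (lsubmx y) 0 0 = 0.
    have := congr1 (fun t => inner g i x t v) H.
    rewrite /= innerDl !innerZl h2 mul0r addr0 inner0l => /eqP.
    by rewrite mulf_eq0 (gt_eqF vv) orbF => /eqP.
  rewrite [lsubmx y]mx11_scalar [rsubmx y]mx11_scalar h1 h2.
  by rewrite !raddf0 row_mx0.
have := sK i x v w ix rf; rewrite /sectional w1 vw mulr1 expr0n /= subr0.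
by rewrite ltr_pdivrMr.
Qed.

End Curvature.

(** * The Jacobi equation along a pole *)

Section Jacobi.
Context {R : realType} {n : nat} {M : topologicalType}.
Context {A : smooth_manifold R n M} (g : riemannian_metric A).
Context (U : set R) (oU : open U) (gamma : R -> M) (sgamma : @smooth_curve R n M A U gamma).
Context (eps : R) (lam : R -> R -> M).
Context (glam : forall s, U s -> geodesic_on g setT (lam s)).
Context (lam0 : forall s, U s -> lam s 0 = gamma s).
Context (vlam : forall s, U s -> @velocity R n M A (lam s) 0 = eps *: @velocity R n M A gamma s).
Implicit Types (i j : chart_index A).

Notation vlc := (@velocity R n M A).

Let slam s : U s -> @smooth_curve R n M A setT (lam s).
Proof. by move=> Us; case: (glam Us). Qed.

(** Position and velocity parts of the variation field. *)
Definition jY i s u : 'rV[R]_n := lsubmx (Yd lam i s u).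
Definition jW i s u : 'rV[R]_n := rsubmx (Yd lam i s u).

Lemma pole_cont s u : U s -> {for s, continuous (lam^~ u)}.
Proof. by move=> Us; have [] := sdiff_all oU sgamma glam lam0 vlam u Us. Qed.

Lemma jY_derive i s u : U s -> chart_dom i (lam s u) ->
  is_derive s (1:R) (chart i \o lam^~ u) (jY i s u).
Proof.
move=> Us is_; have := is_derive_lsubmx (Yd_derive oU sgamma glam lam0 vlam Us is_).
have -> // : (fun s0 => lsubmx (phase i (lam s0) u)) = chart i \o lam^~ u.
by apply/funext => t; rewrite /phase row_mxKl.
Qed.

Lemma jW_derive i s u : U s -> chart_dom i (lam s u) ->
  is_derive s (1:R) (fun s => vel i (lam s) u) (jW i s u).
Proof.
move=> Us is_; have := is_derive_rsubmx (Yd_derive oU sgamma glam lam0 vlam Us is_).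
have -> // : (fun s0 => rsubmx (phase i (lam s0) u)) = (fun s => vel i (lam s) u).
by apply/funext => t; rewrite /phase row_mxKr.
Qed.

Lemma pole_velocity i s u : U s -> chart_dom i (lam s u) ->
  vlc (lam^~ u) s = dtau i (chart_at A (lam s u)) (chart i (lam s u)) (jY i s u).
Proof.
move=> Us is_.
have cu : {for s, continuous (lam^~ u)} := pole_cont Us.
have := chart_tau_derive (c0 := lam^~ u) cu is_ (chart_atP A _) (jY_derive Us is_).
by move=> [_ <-]; rewrite /velocity derive1E.
Qed.

Lemma pole_velocity_u i s u : U s -> chart_dom i (lam s u) ->
  vlc (lam s) u = dtau i (chart_at A (lam s u)) (chart i (lam s u)) (vel i (lam s) u).
Proof.
by move=> Us is_; rewrite velocityE (vel_tau (slam Us) (I : setT u) is_ (chart_atP A _)).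
Qed.

Lemma inner_at_dtau i (p : M) v w : chart_dom i p ->
  inner_at g p (dtau i (chart_at A p) (chart i p) v) (dtau i (chart_at A p) (chart i p) w) =
  inner g i (chart i p) v w.
Proof.
move=> ip; rewrite /inner_at -(tau_chart (chart_at A p) ip) inner_tau//.
exact: chart_overlap ip (chart_atP A p).
Qed.

Lemma pole_JJ i s u : U s -> chart_dom i (lam s u) ->
  inner_at g (lam s u) (vlc (lam^~ u) s) (vlc (lam^~ u) s) =
  inner g i (chart i (lam s u)) (jY i s u) (jY i s u).
Proof. by move=> Us is_; rewrite (pole_velocity Us is_) inner_at_dtau. Qed.

Lemma pole_Jv i s u : U s -> chart_dom i (lam s u) ->
  inner_at g (lam s u) (vlc (lam^~ u) s) (vlc (lam s) u) =
  inner g i (chart i (lam s u)) (jY i s u) (vel i (lam s) u).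
Proof. by move=> Us is_; rewrite (pole_velocity Us is_) (pole_velocity_u Us is_) inner_at_dtau. Qed.

Lemma jY_derive_u i s u : U s -> chart_dom i (lam s u) -> is_derive u (1:R) (jY i s) (jW i s u).
Proof.
move=> Us is_; have [[d d0 Hd] _] := family_local oU sgamma glam lam0 vlam Us is_.
have [||_ _] := Hd s u; [by rewrite subrr normr0|by rewrite subrr normr0|].
rewrite (row_mx_split (Yd lam i s u)) /phase jac_gfield; last exact: chart_in_cod.
by move=> /is_derive_lsubmx; rewrite row_mxKl.
Qed.

Lemma jW_derive_u i s u : U s -> chart_dom i (lam s u) ->
  let x := chart i (lam s u) in let v := vel i (lam s) u in
  is_derive u (1:R) (jW i s) (- (dchr g i x (jY i s u) v v
     + christoffel g i x (jW i s u) v + christoffel g i x v (jW i s u))).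
Proof.
move=> Us is_ x v; have [[d d0 Hd] _] := family_local oU sgamma glam lam0 vlam Us is_.
have [||_ _] := Hd s u; [by rewrite subrr normr0|by rewrite subrr normr0|].
rewrite (row_mx_split (Yd lam i s u)) /phase jac_gfield; last exact: chart_in_cod.
by move=> /is_derive_rsubmx; rewrite row_mxKr dchrE.
Qed.

Lemma vel_derive_u i s u : U s -> chart_dom i (lam s u) ->
  is_derive u (1:R) (vel i (lam s)) (- christoffel g i (chart i (lam s u)) (vel i (lam s) u) (vel i (lam s) u)).
Proof.
move=> Us is_; have [_ gl] := glam Us; have := acc_derive g (slam Us) (I : setT u) is_.
by rewrite (geodesic_acc openT (slam Us) gl (I : setT u) is_) sub0r.
Qed.

(** The covariant derivative of the variation field along the pole. *)
Definition jD i s u : 'rV[R]_n :=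
  jW i s u + christoffel g i (chart i (lam s u)) (vel i (lam s) u) (jY i s u).

(** The Jacobi equation. The derivative of the Christoffel symbol in the
    linearized geodesic equation and the one produced by the covariant
    derivative combine into the curvature. *)
Lemma jD_derive_u i s u : U s -> chart_dom i (lam s u) ->
  let x := chart i (lam s u) in let v := vel i (lam s) u in
  is_derive u (1:R) (jD i s)
    (- curvature g i x (jY i s u) v v - christoffel g i x v (jD i s u)).
Proof.
move=> Us is_ x v; have ix : chart_cod i x by exact: chart_in_cod.
have dx := vel_derive (slam Us) (I : setT u) is_.
have := is_deriveD (jW_derive_u Us is_)
  (christoffel_derive g ix dx (vel_derive_u Us is_) (jY_derive_u Us is_)).
move=> /is_derive_eq; apply; rewrite -/x -/v -(dchrE g i x v v (jY i s u)) curvatureE /jD -/x -/v.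
rewrite (christoffelDr g v _ _ ix) (dchr_sym g v v (jY i s u) ix).
rewrite (christoffel_sym g (jY i s u) v ix) (christoffel_sym g (jY i s u) _ ix).
rewrite (christoffel_sym g (jW i s u) v ix).
have -> : christoffel g i x (- christoffel g i x v v) (jY i s u) =
   - christoffel g i x (christoffel g i x v v) (jY i s u).
  by rewrite -scaleN1r (christoffelZl g _ _ _ ix) scaleN1r.
have E (a b c d e : 'rV[R]_n) : - (a + b + b) + (c - d + b) = - (a + d - (c + e)) - (b + e).
  by apply/rowP => k; rewrite !mxE; ring.
exact: E.
Qed.

Section Scalars.
Context (s0 : R) (Us0 : U s0) (unit0 : \forall s \near s0, energy g gamma s = 1).
Context (eps1 : eps = 1 \/ eps = -1).

Let eps2 : eps * eps = 1.
Proof. by case: eps1 => ->; rewrite ?mulrNN mulr1. Qed.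

Lemma pole_energy u : energy g (lam s0) u = 1.
Proof.
by rewrite (energy_lam glam lam0 vlam u Us0) expr2 eps2 mul1r; exact: (nbhs_singleton unit0).
Qed.

Lemma vel_unit i u : chart_dom i (lam s0 u) ->
  inner g i (chart i (lam s0 u)) (vel i (lam s0) u) (vel i (lam s0) u) = 1.
Proof. by move=> iu; rewrite -(velocity_inner g (slam Us0) (I : setT u) iu); exact: pole_energy. Qed.

(** All poles have unit speed; differentiate the inner product of the velocity
    with itself in the parameter s. *)
Lemma jD_orth i u : chart_dom i (lam s0 u) ->
  inner g i (chart i (lam s0 u)) (jD i s0 u) (vel i (lam s0) u) = 0.
Proof.
move=> iu; have ix := chart_in_cod iu; set x := chart i (lam s0 u); set v := vel i (lam s0) u.
have H := bilinear_field_derive (@chart_cod_open _ _ _ A i) (inner_field g i) (t := s0)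
  (c := chart i \o lam^~ u) (a := fun s => vel i (lam s) u) (b := fun s => vel i (lam s) u)
  ix (jY_derive Us0 iu) (jW_derive Us0 iu) (jW_derive Us0 iu).
have cu : {for s0, continuous (lam^~ u)} := pole_cont Us0.
have H0 : is_derive s0 (1:R) (fun s => inner g i ((chart i \o lam^~ u) s) (vel i (lam s) u) (vel i (lam s) u)) 0.
  have D1 : is_derive s0 (1:R) (cst (1:R) : R -> R) 0 := is_derive_cst _ _ _.
  apply: (@near_eq_is_derive _ _ _ (cst (1:R)) _ _ _ _ _ D1).
  move: unit0 (curve_near oU (c := lam^~ u) cu Us0 iu); apply: filterS2 => s e1 [Us is_].
  rewrite -(velocity_inner g (slam Us) (I : setT u) is_) /=.
  by rewrite -/(energy g (lam s) u) (energy_lam glam lam0 vlam u Us) e1 expr2 eps2 mulr1.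
have := derive_val (is_derive := H); rewrite (derive_val (is_derive := H0)).
rewrite -(dinnerE g i x (jY i s0 u) v v) (dinner_christoffel g _ v v ix).
rewrite (inner_sym g v _ ix) (inner_sym g v (jW i s0 u) ix) (christoffel_sym g _ v ix).
rewrite /jD innerDl -/x -/v.
set a := inner _ _ _ _ _; set b := inner _ _ _ _ _ => E.
have -> : b + a = (a + a + b + b) / 2 by field.
by rewrite -E mul0r.
Qed.

Lemma jY0 i : chart_dom i (gamma s0) -> jY i s0 0 = vel i gamma s0.
Proof.
move=> i0; have i0' : chart_dom i (lam s0 0) by rewrite lam0.
have [_ <-] := jY_derive Us0 i0'; rewrite velE derive1E.
by apply: near_eq_derive; have := lam_near0 oU lam0 Us0; apply: filterS => s /= ->.
Qed.

Lemma jW0 i : chart_dom i (gamma s0) -> jW i s0 0 =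
  eps *: (acc g i gamma s0 - christoffel g i (chart i (gamma s0)) (vel i gamma s0) (vel i gamma s0)).
Proof.
move=> i0; have i0' : chart_dom i (lam s0 0) by rewrite lam0.
have [_ <-] := jW_derive Us0 i0'.
have [_ <-] := is_deriveZ eps (acc_derive g sgamma Us0 i0).
apply: near_eq_derive.
have := curve_near oU (smooth_curve_cont sgamma Us0) Us0 i0; apply: filterS => s [Us is_].
by rewrite (lam_vel0 sgamma glam lam0 vlam Us is_).
Qed.

(** As the component of the variation field along the pole has length 1, this
    is the squared length of its normal part. *)
Definition jac_p u : R := inner_at g (lam s0 u) (vlc (lam^~ u) s0) (vlc (lam^~ u) s0) - 1.

Lemma pole_near i u : chart_dom i (lam s0 u) -> \forall t \near u, chart_dom i (lam s0 t).
Proof.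
move=> iu; have cu : {for u, continuous (lam s0)} := smooth_curve_cont (slam Us0) (I : setT u).
by have := curve_near openT cu (I : setT u) iu; apply: filterS => t [].
Qed.

(** Gauss lemma: the component along the pole is constant, and at the base
    point it is the inner product of gamma' with eps gamma'. *)
Lemma pole_Jv_const u : inner_at g (lam s0 u) (vlc (lam^~ u) s0) (vlc (lam s0) u) = eps.
Proof.
pose f t := inner_at g (lam s0 t) (vlc (lam^~ t) s0) (vlc (lam s0) t).
have -> : eps = f 0.
  pose i := chart_at A (gamma s0); have i0 : chart_dom i (gamma s0) by exact: chart_atP.
  have i0' : chart_dom i (lam s0 0) by rewrite lam0.
  rewrite /f (pole_Jv Us0 i0') (jY0 i0) (lam_vel0 sgamma glam lam0 vlam Us0 i0) innerZr lam0//.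
  rewrite -(velocity_inner g sgamma Us0 i0) -/(energy g gamma s0).
  by rewrite (nbhs_singleton unit0) mulr1.
apply: (is_derive_0_is_cst (f := f)) => {}u.
pose i := chart_at A (lam s0 u); have iu : chart_dom i (lam s0 u) by exact: chart_atP.
have ix := chart_in_cod iu.
apply: (@near_eq_is_derive _ _ _ (fun t => inner g i ((chart i \o lam s0) t) (jY i s0 t) (vel i (lam s0) t))).
  by have := pole_near iu; apply: filterS => t it; rewrite /f (pole_Jv Us0 it).
have := bilinear_field_derive (@chart_cod_open _ _ _ A i) (inner_field g i) (t := u)
  ix (vel_derive (slam Us0) (I : setT u) iu) (jY_derive_u Us0 iu) (vel_derive_u Us0 iu).
move=> /is_derive_eq; apply.
rewrite -(dinnerE g i) (dinner_christoffel g _ _ _ ix) innerNr.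
have := jD_orth iu; rewrite /jD innerDl /=.
have E (a b c : R) : a + b = 0 -> b + c + a - c = 0.
  by move=> h; have -> : b + c + a - c = a + b by ring.
exact: E.
Qed.

(** The normal part of the variation field. *)
Definition jX i u : 'rV[R]_n := jY i s0 u - eps *: vel i (lam s0) u.

Lemma jac_pE i u : chart_dom i (lam s0 u) ->
  jac_p u = inner g i (chart i (lam s0 u)) (jX i u) (jX i u).
Proof.
move=> iu; have ix := chart_in_cod iu.
have b := pole_Jv_const u; rewrite (pole_Jv Us0 iu) in b.
rewrite /jac_p (pole_JJ Us0 iu) /jX.
rewrite !(innerBl, innerBr, innerZl, innerZr) (inner_sym g (vel i (lam s0) u) _ ix) b.
rewrite (vel_unit iu) mulr1 !eps2; ring.
Qed.

Lemma jX_orth i u : chart_dom i (lam s0 u) ->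
  inner g i (chart i (lam s0 u)) (jX i u) (vel i (lam s0) u) = 0.
Proof.
move=> iu; have b := pole_Jv_const u; rewrite (pole_Jv Us0 iu) in b.
by rewrite /jX innerBl innerZl b (vel_unit iu) mulr1 subrr.
Qed.

Lemma jac_p_ge0 u : 0 <= jac_p u.
Proof.
rewrite (jac_pE (chart_atP A _)); apply: inner_ge0; apply: chart_in_cod.
exact: chart_atP.
Qed.

(** Half the derivative of jac_p. *)
Definition jac_Q i u : R := inner g i (chart i (lam s0 u)) (jD i s0 u) (jX i u).

Lemma jac_p_derive i u : chart_dom i (lam s0 u) -> is_derive u (1:R) jac_p (2 * jac_Q i u).
Proof.
move=> iu; have ix := chart_in_cod iu.
apply: (@near_eq_is_derive _ _ _ (fun t => inner g i ((chart i \o lam s0) t) (jY i s0 t) (jY i s0 t) - 1)).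
  by have := pole_near iu; apply: filterS => t it; rewrite /jac_p (pole_JJ Us0 it).
have H := bilinear_field_derive (@chart_cod_open _ _ _ A i) (inner_field g i) (t := u)
  ix (vel_derive (slam Us0) (I : setT u) iu) (jY_derive_u Us0 iu) (jY_derive_u Us0 iu).
have := is_deriveB H (is_derive_cst (1:R) u (1:R)).
move=> /is_derive_eq; apply; rewrite subr0.
rewrite -(dinnerE g i) (dinner_christoffel g _ _ _ ix) /jac_Q /jX innerBr innerZr (jD_orth iu) mulr0 subr0.
rewrite (inner_sym g (jY i s0 u) _ ix) (inner_sym g (jY i s0 u) (jW i s0 u) ix) /jD innerDl /=.
by ring.
Qed.

(** Product rule. The Jacobi equation turns the second covariant derivative of
    the normal part into the curvature term, in which the component along the
    pole drops out. *)
Lemma jac_Q_derive i u : chart_dom i (lam s0 u) -> is_derive u (1:R) (jac_Q i)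
  (inner g i (chart i (lam s0 u)) (jD i s0 u) (jD i s0 u) -
   inner g i (chart i (lam s0 u))
     (curvature g i (chart i (lam s0 u)) (jX i u) (vel i (lam s0) u) (vel i (lam s0) u)) (jX i u)).
Proof.
move=> iu; have ix := chart_in_cod iu.
have dX := is_deriveB (jY_derive_u Us0 iu) (is_deriveZ eps (vel_derive_u Us0 iu)).
have := bilinear_field_derive (@chart_cod_open _ _ _ A i) (inner_field g i) (t := u)
  ix (vel_derive (slam Us0) (I : setT u) iu) (jD_derive_u Us0 iu) dX.
move=> /is_derive_eq; apply.
rewrite -(dinnerE g i) (dinner_christoffel g _ _ _ ix) /=.
set x := chart i (lam s0 u); set v := vel i (lam s0) u.
have cX : curvature g i x (jY i s0 u) v v = curvature g i x (jX i u) v v.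
  rewrite -{1}(subrK (eps *: v) (jY i s0 u)) (curvatureDl g _ _ v v ix) (curvatureZl g eps v v v ix).
  by rewrite curvature_vv scaler0 addr0.
have GX : christoffel g i x v (jX i u) = christoffel g i x v (jY i s0 u) - eps *: christoffel g i x v v.
  have -> : jX i u = jY i s0 u + (- eps) *: v by rewrite /jX scaleNr.
  rewrite -[X in _ = _ + X]scaleNr; apply: etrans (christoffelDr g v (jY i s0 u) (- eps *: v) ix) _.
  by congr (_ + _); exact: (christoffelZr g (- eps) v v ix).
have VE : christoffel g i x v (jX i u) + (jW i s0 u - eps *: - christoffel g i x v v) = jD i s0 u.
  have E (a b c : 'rV[R]_n) : a - eps *: b + (c - eps *: - b) = c + a.
    by apply/rowP => k; rewrite !mxE; ring.
  by rewrite GX; exact: E.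
have HI : inner g i x (jD i s0 u) (jD i s0 u) = inner g i x (jD i s0 u) (christoffel g i x v (jX i u))
    + inner g i x (jD i s0 u) (jW i s0 u - eps *: - christoffel g i x v v).
  by rewrite -innerDr VE.
rewrite HI cX innerBl innerNl.
have E (a b c d : R) : a + b + (- c - a) + d = b + d - c by ring.
exact: E.
Qed.

Lemma jac_p0 : jac_p 0 = 0.
Proof.
pose i := chart_at A (gamma s0); have i0 : chart_dom i (gamma s0) by exact: chart_atP.
have i0' : chart_dom i (lam s0 0) by rewrite lam0.
rewrite (jac_pE i0') /jX (jY0 i0) (lam_vel0 sgamma glam lam0 vlam Us0 i0).
by rewrite scalerA eps2 scale1r subrr inner0l.
Qed.

Lemma jac_Q0 i : chart_dom i (gamma s0) -> jac_Q i 0 = 0.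
Proof.
move=> i0; rewrite /jac_Q /jX (jY0 i0) (lam_vel0 sgamma glam lam0 vlam Us0 i0).
by rewrite scalerA eps2 scale1r subrr inner0r.
Qed.

(** At the base point the variation field is gamma', so its covariant
    derivative along the pole is eps times the acceleration of gamma; this is
    how the curvature of gamma enters. *)
Lemma jD0 i : chart_dom i (gamma s0) -> jD i s0 0 = eps *: acc g i gamma s0.
Proof.
move=> i0; have ix := chart_in_cod i0.
rewrite /jD (jW0 i0) lam0// (jY0 i0) (lam_vel0 sgamma glam lam0 vlam Us0 i0).
by rewrite (christoffelZl g eps _ _ ix) -scalerDr subrK.
Qed.

Lemma curvature_sq : geodesic_curvature g gamma s0 ^+ 2 =
  inner_at g (gamma s0) (acceleration g gamma s0) (acceleration g gamma s0).
Proof.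
rewrite /geodesic_curvature /norm_at sqr_sqrtr//; apply: inner_ge0.
by apply: chart_in_cod; exact: chart_atP.
Qed.

(** The scalar content of the Jacobi equation. With X the normal part, q^2 =
    <X', X>^2 <= |X'|^2 |X|^2 by Cauchy-Schwarz, while q' = |X'|^2 - <R(X, v)
    v, X> and the curvature term is smaller than K |X|^2. *)
Lemma jacobi_scalars (K : R) : sectional_lt g K -> exists q dq : R -> R,
  [/\ forall u, is_derive u (1:R) jac_p (2 * q u),
      forall u, is_derive u (1:R) q (dq u),
      q 0 = 0,
      dq 0 = geodesic_curvature g gamma s0 ^+ 2 &
      forall u, 0 < jac_p u -> q u ^+ 2 - K * jac_p u ^+ 2 < jac_p u * dq u].
Proof.
move=> sK; pose q u : R := 'D_1 jac_p u / 2; pose dq u : R := 'D_1 q u.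
have qE i u : chart_dom i (lam s0 u) -> q u = jac_Q i u.
  by move=> /jac_p_derive[_ E]; rewrite /q E mulrC mulKf// pnatr_eq0.
have qnear i u : chart_dom i (lam s0 u) -> \forall t \near u, jac_Q i t = q t.
  by move=> iu; have := pole_near iu; apply: filterS => t it; rewrite (qE i).
have dqE i u (iu : chart_dom i (lam s0 u)) := near_eq_is_derive (qnear i u iu) (jac_Q_derive iu).
exists q, dq; split.
- move=> u; have iu := chart_atP A (lam s0 u); rewrite (qE _ _ iu).
  exact: jac_p_derive.
- move=> u; have [d _] := dqE _ u (chart_atP A (lam s0 u)).
  exact: derivableP.
- pose i := chart_at A (gamma s0); have i0 : chart_dom i (gamma s0) by exact: chart_atP.
  by rewrite (qE i) ?lam0// jac_Q0.
- pose i := chart_at A (gamma s0); have i0 : chart_dom i (gamma s0) by exact: chart_atP.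
  have i0' : chart_dom i (lam s0 0) by rewrite lam0.
  have [_ E] := dqE _ _ i0'; rewrite /dq E curvature_sq (acceleration_inner g oU sgamma Us0 i0).
  have -> : jX i 0 = 0.
    by rewrite /jX (jY0 i0) (lam_vel0 sgamma glam lam0 vlam Us0 i0) scalerA eps2 scale1r subrr.
  by rewrite inner0r subr0 (jD0 i0) innerZl innerZr mulrA eps2 mul1r lam0.
move=> u pu; pose i := chart_at A (lam s0 u); have iu : chart_dom i (lam s0 u) by exact: chart_atP.
have ix := chart_in_cod iu.
have [_ E] := dqE _ _ iu; rewrite /dq E (qE _ _ iu) mulrBr.
have pE := jac_pE iu.
have X0 : jX i u != 0.
  by apply/eqP => X0; move: pu; rewrite pE X0 inner0l ltxx.
have h1 := sectional_inner sK ix X0 (vel_unit iu) (jX_orth iu).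
have h2 := inner_CS g (jD i s0 u) (jX i u) ix.
rewrite -pE in h1 h2.
rewrite mulrC in h2; apply: ler_ltB; first exact: h2.
by rewrite expr2 mulrA [_ * jac_p u]mulrC ltr_pM2l.
Qed.

(** By the Gauss lemma the Gram determinant of the variation field and the unit
    vector along the pole reduces to the squared length of the normal part. *)
Lemma pole_density u : area_density g lam (s0, u) = Num.sqrt (jac_p u).
Proof.
rewrite /area_density /=; congr Num.sqrt.
rewrite pole_Jv_const -/(energy g (lam s0) u) pole_energy mulr1 expr2 eps2.
by [].
Qed.

Lemma pole_speed u : speed g (lam^~ u) s0 = Num.sqrt (1 + jac_p u).
Proof. by rewrite /speed /norm_at /jac_p addrC subrK. Qed.

End Scalars.

End Jacobi.

(** * Sturm comparison with a space form *)

Section Sturm.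
Context {R : realType}.

Lemma is_derive_sq (f : R -> R) (u df : R) :
  is_derive u (1:R) f df -> is_derive u (1:R) (fun x => f x ^+ 2) (2 * f u * df).
Proof.
move=> D; apply: (is_derive_eq (is_deriveM D D)).
by rewrite -![_ *: _]/(_ * _); ring.
Qed.

Lemma is_derive_div (f : R -> R) (c u df : R) :
  is_derive u (1:R) f df -> is_derive u (1:R) (fun x => f x / c) (df / c).
Proof.
move=> D; apply: (is_derive_eq (is_deriveM D (is_derive_cst (c^-1 : R) u (1:R)))).
by rewrite -[LHS]/(f u * 0 + c^-1 * df); ring.
Qed.

Section Comparison.
Context (K kap : R) (p q dq S C : R -> R).
Context (kap0 : 0 < kap).
Context (dp : forall u, is_derive u (1:R) p (2 * q u)).
Context (dq' : forall u, is_derive u (1:R) q (dq u)).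
Context (dS : forall u, is_derive u (1:R) S (C u)).
Context (dC : forall u, is_derive u (1:R) C (- K * S u)).
Context (p_ge0 : forall u, 0 <= p u) (p0 : p 0 = 0) (q0 : q 0 = 0) (S0 : S 0 = 0) (C0 : C 0 = 1).
Context (dq0 : dq 0 = kap ^+ 2).
Context (jac : forall u, 0 < p u -> q u ^+ 2 - K * p u ^+ 2 < p u * dq u).

Let slope (f : R -> R) (a : R) : is_derive 0 (1:R) f a -> f 0 = 0 ->
  forall e, 0 < e -> exists2 d, 0 < d & forall t, 0 <= t < d -> (a - e) * t <= f t <= (a + e) * t.
Proof.
move=> /is_derive_epsP H f0 e e0; have [d d0 Hd] := H e e0; exists d => // t /andP[t0 td].
have := Hd t; rewrite (ger0_norm t0) => /(_ td).
rewrite f0 subr0 -![_ *: _]/(_ * _) mulr1 addr0 ler_norml; lra.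
Qed.

(* Near 0 the function p behaves as kap^2 u^2 and q as kap^2 u. *)
Let p_slope e : 0 < e -> exists2 d, 0 < d &
  forall t, 0 <= t < d -> (kap ^+ 2 - e) * t ^+ 2 <= p t <= (kap ^+ 2 + e) * t ^+ 2.
Proof.
move=> e0; have [d d0 H] : exists2 d, 0 < d & forall t, 0 <= t < d -> (dq 0 - e) * t <= q t <= (dq 0 + e) * t.
  by apply: slope => //; exact: dq'.
rewrite dq0 in H; exists d => // t /andP[t0 td].
have D (a : R) : forall u, 0 <= u <= t -> is_derive u (1:R) (fun x => p x - a * x ^+ 2) (2 * (q u - a * u)).
  move=> u _; apply: (is_derive_eq (is_deriveB (dp u) (is_deriveZ a (is_derive_sq (is_derive_id u (1:R)))))).
  by rewrite -![_ *: _]/(_ * _); ring.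
have [c /andP[c0 ct]] := mvt t0 (D (kap ^+ 2 - e)).
have [c' /andP[c0' ct']] := mvt t0 (D (kap ^+ 2 + e)).
rewrite p0 expr0n /= !mulr0 !subr0 => E1 E2.
have [h1 _] : (kap ^+ 2 - e) * c <= q c /\ True.
  by split=> //; have /andP[] := H c (introT andP (conj c0 (le_lt_trans ct td))).
have /andP[_ h2] := H c' (introT andP (conj c0' (le_lt_trans ct' td))).
apply/andP; split.
  by rewrite -subr_ge0 E2 mulr_ge0// mulr_ge0// subr_ge0.
by rewrite -subr_le0 E1 mulr_le0_ge0// mulr_ge0_le0// subr_le0.
Qed.

Let p_near0 : exists2 d, 0 < d & forall t, 0 < t < d -> 0 < p t.
Proof.
have k2 : 0 < kap ^+ 2 / 2 by rewrite divr_gt0// exprn_gt0.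
have [d d0 H] := p_slope k2; exists d => // t /andP[t0 td].
have /andP[h _] := H t (introT andP (conj (ltW t0) td)).
by apply: lt_le_trans h; rewrite mulr_gt0 ?exprn_gt0//; lra.
Qed.

Section Positive.
Context (b : R) (b0 : 0 < b) (Spos : forall u, 0 < u <= b -> 0 < S u) (ppos : forall u, 0 < u <= b -> 0 < p u).

Let N u := q u * S u - p u * C u.

Let dN u : is_derive u (1:R) N (dq u * S u - q u * C u + K * p u * S u).
Proof.
apply: (is_derive_eq (is_deriveB (is_deriveM (dq' u) (dS u)) (is_deriveM (dp u) (dC u)))).
by rewrite -![_ *: _]/(_ * _); ring.
Qed.

(* The Wronskian of sqrt p and S, whose derivative has the sign of S (p q' -
   q^2 + K p^2). *)
Let psi u := N u * (Num.sqrt (p u))^-1.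

Let dpsi u : 0 < p u -> exists2 e, 0 < S u -> 0 < e & is_derive u (1:R) psi e.
Proof.
move=> pu; have sp : 0 < Num.sqrt (p u) by rewrite sqrtr_gt0.
have D := is_derive1_comp (is_derive1_sqrt pu) (dp u).
have D' := is_deriveM (dN u) (is_deriveV (f := Num.sqrt \o p) (lt0r_neq0 sp) D).
eexists; last exact: D'.
move=> Su; rewrite -![_ *: _]/(_ * _).
have E : p u = Num.sqrt (p u) ^+ 2 by rewrite sqr_sqrtr// ltW.
rewrite /N /= ; move: (jac pu); rewrite E sqrtr_sqr (gtr0_norm sp).
set s := Num.sqrt (p u) => J.
have -> : (q u * S u - s ^+ 2 * C u) * (- s ^- 2 * ((2 * s)^-1 * (2 * q u))) +
    s^-1 * (dq u * S u - q u * C u + K * s ^+ 2 * S u) =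
    S u * (s ^+ 2 * dq u - (q u ^+ 2 - K * (s ^+ 2) ^+ 2)) / s ^+ 3.
  by field; rewrite gt_eqF.
by rewrite divr_gt0 ?exprn_gt0// mulr_gt0// subr_gt0.
Qed.

Let incr (f : R -> R) : (forall u, 0 < u <= b -> exists2 e, 0 < e & is_derive u (1:R) f e) ->
  forall u v, 0 < u -> u < v -> v <= b -> f u < f v.
Proof.
move=> H u v u0 uv vb.
have Hc t : u <= t <= v -> is_derive t (1:R) f ('D_1 f t) /\ 0 < 'D_1 f t.
  move=> /andP[t1 t2]; have [e e0 D] := H t (introT andP (conj (lt_le_trans u0 t1) (le_trans t2 vb))).
  by have [_ E] := D; rewrite E.
have [c cuv E] := mvt (ltW uv) (fun t ht => (Hc t ht).1).
by rewrite -subr_gt0 E mulr_gt0 ?subr_gt0//; have [] := Hc c cuv.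
Qed.

(* The Wronskian is small at 0; as it increases, it is positive afterwards. *)
Let psi_near0 : exists2 c, 0 <= c & exists2 d, 0 < d & forall t, 0 < t < d -> - (c * t) <= psi t.
Proof.
have k2 : 0 < kap ^+ 2 by rewrite exprn_gt0.
have k22 : 0 < kap ^+ 2 / 2 by rewrite divr_gt0.
have [d1 d10 H1] := p_slope k22.
have [d2 d20 H2] : exists2 d, 0 < d & forall t, 0 <= t < d -> (dq 0 - kap ^+ 2) * t <= q t <= (dq 0 + kap ^+ 2) * t.
  by apply: slope => //; exact: dq'.
have cC : {for 0, continuous C} by apply/differentiable_continuous/derivable1_diffP; have [] := dC 0.
have [d3 d30 H3] := (continuous_epsP C 0).1 cC 1 ltr01.
have k1 : 0 < 2 * kap by rewrite mulr_gt0.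
exists (2 * (2 * kap)); first by rewrite ltW// mulr_gt0.
exists (Num.min (Num.min d1 d2) (Num.min d3 b)); first by rewrite !lt_min d10 d20 d30 b0.
move=> t /andP[t0]; rewrite !lt_min => /andP[/andP[t1 t2] /andP[t3 tb]].
have /andP[_ h1] := H1 t (introT andP (conj (ltW t0) t1)).
have /andP[h2 _] := H2 t (introT andP (conj (ltW t0) t2)).
have h3 : C t <= 2.
  have := H3 t; rewrite subr0 (gtr0_norm t0) C0 => /(_ t3); rewrite ltr_norml; lra.
have pt : 0 < p t by apply: ppos; rewrite t0 ltW.
have St : 0 < S t by apply: Spos; rewrite t0 ltW.
have sp : 0 < Num.sqrt (p t) by rewrite sqrtr_gt0.
have qt : 0 <= q t by move: h2; rewrite dq0 subrr mul0r.
have st : Num.sqrt (p t) <= 2 * kap * t.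
  have -> : 2 * kap * t = Num.sqrt ((2 * kap * t) ^+ 2).
    by rewrite sqrtr_sqr ger0_norm// ltW// mulr_gt0.
  apply: ler_wsqrtr; apply: (le_trans h1).
  have := exprn_gt0 2 t0; move: k2; rewrite -subr_ge0.
  set a := kap ^+ 2 => a0 b1; have -> : (2 * kap * t) ^+ 2 - (a + a / 2) * t ^+ 2 = 5 / 2 * (a * t ^+ 2).
    by rewrite /a; field.
  by rewrite mulr_ge0 ?divr_ge0// mulr_ge0// ltW.
rewrite /psi /N mulrBl; apply: (@le_trans _ _ (- (p t * C t / Num.sqrt (p t)))); last first.
  by rewrite lerDr divr_ge0 ?mulr_ge0// ltW.
have -> : p t * C t / Num.sqrt (p t) = Num.sqrt (p t) * C t.
  rewrite -{1}(sqr_sqrtr (ltW pt)); field; exact: lt0r_neq0.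
rewrite lerN2; apply: (@le_trans _ _ (Num.sqrt (p t) * 2)); first by rewrite ler_pM2l.
by rewrite mulrC -!mulrA ler_pM2l// mulrA.
Qed.

Let psi_gt0 u : 0 < u <= b -> 0 < psi u.
Proof.
move=> /andP[u0 ub]; rewrite ltNge; apply/negP => pu.
have I : forall x y, 0 < x -> x < y -> y <= b -> psi x < psi y.
  apply: incr => t ht; have [e e0 D] := dpsi (ppos ht); exists e => //; exact/e0/Spos.
have h : psi (u / 2) < 0 by apply: lt_le_trans pu; apply: I => //; lra.
have [c c0 [d d0 H]] := psi_near0.
pose a := - psi (u / 2).
have a0 : 0 < a by rewrite oppr_gt0.
have ac : 0 < a / (c + 1) by rewrite divr_gt0// ltr_wpDl.
pose t := Num.min (u / 4) (Num.min (d / 2) (a / (c + 1))).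
have t0 : 0 < t by rewrite !lt_min ac !divr_gt0.
have t1 : t < u / 2 by rewrite gt_min; apply/orP; left; lra.
have t2 : t < d by rewrite !gt_min; apply/orP; right; apply/orP; left; lra.
have t3 : t <= a / (c + 1) by rewrite !ge_min lexx !orbT.
have := H t (introT andP (conj t0 t2)).
have := I t (u / 2) t0 t1; rewrite -[psi (u/2)]opprK -/a => /(_ ltac:(lra)).
move: t3; rewrite ler_pdivlMr ?ltr_wpDl// => h3 h4 h5.
have : c * t <= a - t by lra.
lra.
Qed.

Let ratio_incr u v : 0 < u -> u < v -> v <= b -> p u * (S u ^- 2) < p v * (S v ^- 2).
Proof.
apply: (incr (f := fun u => p u * (S u ^- 2))) => {u v} u ub.
have Su := Spos ub; have pu := ppos ub.
have S2 : S u ^+ 2 != 0 by rewrite expf_neq0// gt_eqF.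
have D := is_deriveM (dp u) (is_deriveV (f := fun x => S x ^+ 2) S2 (is_derive_sq (dS u))).
exists (2 * N u / S u ^+ 3).
  have := psi_gt0 ub; rewrite pmulr_lgt0 ?invr_gt0 ?sqrtr_gt0// => N0.
  by rewrite divr_gt0 ?exprn_gt0// mulr_gt0.
apply: (is_derive_eq D); rewrite -![_ *: _]/(_ * _) /N /=.
by field; rewrite gt_eqF.
Qed.

(** The ratio p / S^2 tends to kap^2 at 0 and is strictly increasing, since psi
    is positive. *)
Lemma sturm_positive u : 0 < u <= b -> kap ^+ 2 * S u ^+ 2 < p u.
Proof.
move=> /andP[u0 ub]; have Su : 0 < S u by apply: Spos; rewrite u0.
rewrite -ltr_pdivlMr ?exprn_gt0//.
have h : p (u / 2) / S (u / 2) ^+ 2 < p u / S u ^+ 2 by apply: ratio_incr => //; lra.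
apply: le_lt_trans h; set m := p (u / 2) / _.
rewrite leNgt; apply/negP => mk.
have m0 : 0 <= m by rewrite /m divr_ge0// exprn_ge0// ltW// Spos//; apply/andP; split; lra.
pose e := Num.min 1 ((kap ^+ 2 - m) / (2 * (3 * m + 1))).
have m1 : 0 < 2 * (3 * m + 1) by lra.
have e0 : 0 < e by rewrite lt_min ltr01 divr_gt0// subr_gt0.
have e1 : e <= 1 by rewrite ge_min lexx.
have e2 : e * (2 * (3 * m + 1)) <= kap ^+ 2 - m by rewrite -ler_pdivlMr// ge_min lexx orbT.
have [d1 d10 H1] := p_slope e0.
have [d2 d20 H2] : exists2 d, 0 < d & forall t, 0 <= t < d -> (C 0 - e) * t <= S t <= (C 0 + e) * t.
  by apply: slope => //; exact: dS.
pose t := Num.min (u / 4) (Num.min (d1 / 2) (d2 / 2)).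
have t0 : 0 < t by rewrite !lt_min !divr_gt0.
have t1 : t < u / 2 by rewrite gt_min; apply/orP; left; lra.
have t2 : t < d1 by rewrite !gt_min; apply/orP; right; apply/orP; left; lra.
have t3 : t < d2 by rewrite !gt_min; apply/orP; right; apply/orP; right; lra.
have /andP[h1 _] := H1 t (introT andP (conj (ltW t0) t2)).
have /andP[_ h2] := H2 t (introT andP (conj (ltW t0) t3)).
have St : 0 < S t by apply: Spos; rewrite t0/=; lra.
have h3 : p t / S t ^+ 2 < m by apply: ratio_incr => //; lra.
rewrite ltr_pdivrMr ?exprn_gt0// in h3.
have h4 : S t ^+ 2 <= ((1 + e) * t) ^+ 2 by rewrite -C0; rewrite ler_sqr ?nnegrE// ?ltW// mulr_gt0// C0; lra.
have t20 : 0 < t ^+ 2 by rewrite exprn_gt0.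
have h5 : (kap ^+ 2 - e) * t ^+ 2 < m * (1 + e) ^+ 2 * t ^+ 2.
  apply: (le_lt_trans h1); apply: (lt_le_trans h3); rewrite -mulrA -exprMn.
  exact: ler_wpM2l.
rewrite ltr_pM2r// in h5.
have h6 : (1 + e) ^+ 2 <= 1 + 3 * e.
  rewrite -subr_ge0; have -> : 1 + 3 * e - (1 + e) ^+ 2 = e * (1 - e) by ring.
  by rewrite mulr_ge0 ?subr_ge0// ltW.
have h7 : m * (1 + e) ^+ 2 <= m * (1 + 3 * e) by exact: ler_wpM2l.
have h8 : e * (2 * (3 * m + 1)) = 2 * (m * (3 * e) + e) by ring.
rewrite mulrDr mulr1 in h7; rewrite h8 in e2.
have h9 : 0 <= m * (3 * e) by rewrite mulr_ge0// mulr_ge0// ltW.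
lra.
Qed.

End Positive.

(** Real induction shows that p does not vanish again: as long as it is
    positive it exceeds kap^2 S^2, and this bound passes to the limit. *)
Lemma sturm (b : R) : 0 < b -> (forall u, 0 < u <= b -> 0 < S u) ->
  forall u, 0 < u <= b -> kap ^+ 2 * S u ^+ 2 < p u.
Proof.
move=> b0 Spos.
have cont (f df : R -> R) u : (forall u, is_derive u (1:R) f (df u)) -> {for u, continuous f}.
  by move=> H; apply/differentiable_continuous/derivable1_diffP; have [] := H u.
have k2 : 0 < kap ^+ 2 by rewrite exprn_gt0.
suff H : forall t, 0 <= t <= b -> 0 < t -> 0 < p t.
  apply: sturm_positive => // u /andP[u0 ub]; apply: H => //.
  by rewrite ltW.
apply: real_ind; first exact: ltW.
- by rewrite ltxx.
- move=> e /andP[e0 eb] H _.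
  have Se : 0 < S e by apply: Spos; rewrite e0.
  rewrite lt_neqAle p_ge0 andbT; apply/eqP => pe.
  have cp : {for e, continuous (fun u => p u - kap ^+ 2 * S u ^+ 2)}.
    apply: (cont _ (fun u => 2 * q u - kap ^+ 2 * (2 * S u * C u))) => u.
    apply: (is_derive_eq (is_deriveB (dp u) (is_deriveZ (kap ^+ 2) (is_derive_sq (dS u))))).
    by rewrite -![_ *: _]/(_ * _); ring.
  have x0 : 0 < kap ^+ 2 * S e ^+ 2 by rewrite mulr_gt0 ?exprn_gt0.
  have [d d0 Hd] := (continuous_epsP _ _).1 cp _ x0.
  pose t := Num.max (e / 2) (e - d / 2).
  have te : t < e by rewrite gt_max; apply/andP; split; lra.
  have t0 : 0 < t by rewrite lt_max divr_gt0.
  have td : e - d / 2 <= t by rewrite le_max lexx orbT.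
  have := Hd t; rewrite -pe sub0r ltr0_norm ?subr_lt0// => /(_ ltac:(lra)).
  rewrite ltr_norml => /andP[_ h].
  have : kap ^+ 2 * S t ^+ 2 < p t.
    apply: (@sturm_positive t) => //.
    - by move=> u /andP[u0 ut]; apply: Spos; rewrite u0/=; lra.
    - by move=> u /andP[u0 ut]; apply: H => //; apply/andP; split; lra.
    - by rewrite t0/=.
  lra.
move=> e /andP[e0 eb] H; move: e0; rewrite le_eqVlt => /orP[/eqP e0|e0].
  have [d d0 Hd] := p_near0; exists d => // t; rewrite -e0 add0r => te _; exact: Hd.
have pe : 0 < p e by apply: H; rewrite ?lexx ?(ltW e0).
have [d d0 Hd] := (continuous_epsP _ _).1 (cont _ _ e dp) _ pe.
exists d => // t /andP[et td] _; have := Hd t; rewrite gtr0_norm ?subr_gt0// => /(_ ltac:(lra)).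
rewrite ltr_norml; lra.
Qed.

End Comparison.

Section SpaceForm.
Context (K : R).

(** The derivative of the space form Jacobi function, that is, the generalized
    cosine. *)
Definition jacobi' (u : R) : R :=
  if 0 < K then cos (Num.sqrt K * u) else if K == 0 then 1 else cosh (Num.sqrt (- K) * u).

Let dlin (k u : R) : is_derive u (1:R) ( *%R k) k.
Proof.
apply: (is_derive_eq (is_deriveZ k (is_derive_id u (1:R)))).
by rewrite -[LHS]/(k * 1) mulr1.
Qed.

Lemma sinh_derive (x : R) : is_derive x (1:R) (@sinh R) (cosh x).
Proof.
have dN : is_derive x (1:R) (fun y : R => expR (- y)) (- expR (- x)).
  have d := is_derive1_comp (f := expR) (g := -%R) (is_derive_expR (- x)) (is_deriveN (is_derive_id x (1:R))).
  by apply: (is_derive_eq d); rewrite mulrN1.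
apply: (is_derive_eq (is_derive_div 2 (is_deriveB (is_derive_expR x) dN))).
by rewrite /cosh ?opprK.
Qed.

Lemma cosh_derive (x : R) : is_derive x (1:R) (@cosh R) (sinh x).
Proof.
have dN : is_derive x (1:R) (fun y : R => expR (- y)) (- expR (- x)).
  have d := is_derive1_comp (f := expR) (g := -%R) (is_derive_expR (- x)) (is_deriveN (is_derive_id x (1:R))).
  by apply: (is_derive_eq d); rewrite mulrN1.
apply: (is_derive_eq (is_derive_div 2 (is_deriveD (is_derive_expR x) dN))).
by rewrite /sinh ?opprK.
Qed.

Lemma jacobi_derive u : is_derive u (1:R) (jacobi K) (jacobi' u).
Proof.
rewrite /jacobi' /jacobi; case: ifPn => K0.
  have k0 : Num.sqrt K != 0 by rewrite gt_eqF// sqrtr_gt0.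
  apply: (is_derive_eq (is_derive_div (Num.sqrt K) (is_derive1_comp (is_derive_sin (Num.sqrt K * u)) (dlin (Num.sqrt K) u)))).
  by rewrite mulfK.
case: ifPn => K1; first exact: is_derive_id.
have k0 : Num.sqrt (- K) != 0 by rewrite gt_eqF// sqrtr_gt0 oppr_gt0 lt_neqAle K1/= leNgt.
apply: (is_derive_eq (is_derive_div (Num.sqrt (- K)) (is_derive1_comp (sinh_derive (Num.sqrt (- K) * u)) (dlin (Num.sqrt (- K)) u)))).
by rewrite mulfK.
Qed.

Lemma jacobi'_derive u : is_derive u (1:R) jacobi' (- K * jacobi K u).
Proof.
rewrite /jacobi' /jacobi; case: ifPn => K0.
  have k0 : Num.sqrt K != 0 by rewrite gt_eqF// sqrtr_gt0.
  have := is_derive1_comp (is_derive_cos (Num.sqrt K * u)) (dlin (Num.sqrt K) u).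
  by move=> D; apply: (is_derive_eq D); rewrite -[K in X in _ = - X * _](sqr_sqrtr (ltW K0)); field.
case: ifPn => K1; first by rewrite (eqP K1) oppr0 mul0r; exact: is_derive_cst.
have k1 : 0 < - K by rewrite oppr_gt0 lt_neqAle K1/= leNgt.
have k0 : Num.sqrt (- K) != 0 by rewrite gt_eqF// sqrtr_gt0.
have := is_derive1_comp (cosh_derive (Num.sqrt (- K) * u)) (dlin (Num.sqrt (- K)) u).
by move=> D; apply: (is_derive_eq D); rewrite -[- K in X in _ = X * _](sqr_sqrtr (ltW k1)); field.
Qed.

Lemma jacobi0 : jacobi K 0 = 0.
Proof. by rewrite /jacobi /sinh !mulr0 sin0 oppr0 subrr !mul0r; do !case: ifP. Qed.

Lemma jacobi'0 : jacobi' 0 = 1.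
Proof. by rewrite /jacobi' /cosh !mulr0 cos0 oppr0 expR0 -mulr2n divff ?pnatr_eq0//; do !case: ifP. Qed.

Lemma jacobi_gt0 (u : R) : 0 < u -> (0 < K -> u < pi / Num.sqrt K) -> 0 < jacobi K u.
Proof.
move=> u0 uK; rewrite /jacobi; case: ifPn => K0.
  have k0 : 0 < Num.sqrt K by rewrite sqrtr_gt0.
  rewrite divr_gt0//; apply: sin_gt0_pi; rewrite mulr_gt0//=.
  by rewrite mulrC -ltr_pdivlMr// uK.
case: ifPn => // K1.
have k0 : 0 < Num.sqrt (- K) by rewrite sqrtr_gt0 oppr_gt0 lt_neqAle K1/= leNgt.
rewrite divr_gt0// /sinh divr_gt0// subr_gt0 ltr_expR.
by have := mulr_gt0 k0 u0; lra.
Qed.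

End SpaceForm.
End Sturm.

(** * Integrals over segments and rectangles *)

Section Measure.
Import HBNNSimple.
Context d (T : measurableType d) {R : realType} (mu : {measure set T -> \bar R}).

Let null_le (D N : set T) (f h : T -> R) : measurable N -> mu N = 0%E ->
  (forall x, D x -> 0 <= f x) -> (forall x, D x -> 0 <= h x) ->
  (forall x, D x -> ~ N x -> f x = h x) ->
  (\int[mu]_(x in D) (f x)%:E <= \int[mu]_(x in D) (h x)%:E)%E.
Proof.
move=> mN N0 f0 h0 fh.
rewrite [leLHS]ge0_integralE; last by move=> x Dx; rewrite lee_fin f0.
apply: ge_ereal_sup => _ [k kf <-].
pose k' := proj_nnsfun k (measurableC mN).
have -> : sintegral mu k = sintegral mu k'.
  rewrite -!integralT_nnsfun; apply: ae_eq_integral => //.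
  - by apply/measurable_EFinP.
  - by apply/measurable_EFinP.
  exists N; split => // x /= H; apply: contrapT => xN; apply: H => _.
  by rewrite /k' /= -[mindic _ _ x]/(\1_(~` N) x) indicE mem_set//= mulr1.
rewrite [leRHS]ge0_integralE; last by move=> x Dx; rewrite lee_fin h0.
apply: ereal_sup_ubound; exists k' => // x; rewrite /k' /= -[mindic _ _ x]/(\1_(~` N) x) indicE.
have [xN|xN] := boolP (x \in ~` N); last first.
  rewrite mulr0 patchE; case: ifPn => // /set_mem Dx.
  by rewrite lee_fin h0.
rewrite mulr1; have := kf x; rewrite !patchE; case: ifPn => // /set_mem Dx.
by rewrite fh//; exact: set_mem xN.
Qed.

(** A nonnegative function may be changed on a null set even if it is not
    measurable: every simple function below the one is, after multiplication by
    the indicator of the complement of the null set, below the other. The area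
    density needs this, since at the two ends of the parameter interval the
    variation field depends on arbitrary values of lambda. *)
Lemma Rintegral_null (D N : set T) (f h : T -> R) : measurable N -> mu N = 0%E ->
  (forall x, D x -> 0 <= f x) -> (forall x, D x -> 0 <= h x) ->
  (forall x, D x -> ~ N x -> f x = h x) ->
  \int[mu]_(x in D) f x = \int[mu]_(x in D) h x.
Proof.
move=> mN N0 f0 h0 fh; rewrite /Rintegral; congr fine; apply/eqP.
by rewrite eq_le !(null_le mN N0)// => x Dx Nx; rewrite fh.
Qed.

(** A lower bound on a subset of positive measure already makes the integral
    positive. *)
Lemma Rintegral_gt0 (D B : set T) (f : T -> R) (c : R) : measurable D -> measurable B ->
  mu.-integrable D (EFin \o f) -> (forall x, D x -> 0 <= f x) ->
  B `<=` D -> (0 < mu B)%E -> 0 < c -> (forall x, B x -> c <= f x) ->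
  0 < \int[mu]_(x in D) f x.
Proof.
move=> mD mB fi f0 BD B0 c0 cf.
have ff := integrable_fin_num mD fi.
rewrite -lte_fin /Rintegral fineK//.
have mf := measurable_int mu fi.
have h1 : (\int[mu]_(x in B) (f x)%:E <= \int[mu]_(x in D) (f x)%:E)%E.
  by apply: ge0_subset_integral => // x Dx; rewrite lee_fin f0.
apply: lt_le_trans h1.
have h2 : (\int[mu]_(x in B) c%:E <= \int[mu]_(x in B) (f x)%:E)%E.
  apply: ge0_le_integral => //.
  - by move=> x _; rewrite lee_fin ltW.
  - exact: (measurable_funS mD BD mf).
by apply: lt_le_trans h2; rewrite integral_cst// mule_gt0// lte_fin.
Qed.

End Measure.

Section Plane.
Context {R : realType}.
Notation mu := (@lebesgue_measure R).
Notation mu2 := (lebesgue_measure \x lebesgue_measure)%E.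

(** An open subset of the plane is the countable union of the squares with
    rational centre and rational size that it contains. *)
Lemma open_measurable2 (O : set (R * R)) : open O -> measurable (O : set (measurableTypeR R * measurableTypeR R)).
Proof.
move=> oO.
pose F (q : rat * rat * rat) : set (R * R) :=
  if `[< forall x y, `|x - ratr q.1.1| < ratr q.2 -> `|y - ratr q.1.2| < ratr q.2 -> O (x, y) >] then
   `](ratr q.1.1 - ratr q.2), (ratr q.1.1 + ratr q.2)[ `*` `](ratr q.1.2 - ratr q.2), (ratr q.1.2 + ratr q.2)[
  else set0.
have -> : O = \bigcup_q F q; last first.
  apply: countable_bigcupT_measurable => // q; rewrite /F; case: asboolP => _; last exact: measurable0.
  by apply: measurableX; exact: measurable_itv.
apply/seteqP; split => [[x y] Oxy|[x y] [q _]]; last first.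
  rewrite /F; case: asboolP => // H [/=]; rewrite !in_itv/= => /andP[h1 h2] /andP[h3 h4].
  by apply: H; rewrite ltr_norml; apply/andP; split; lra.
have /nbhs_ballP[e /= e0 He] : nbhs (x, y) O by exact: open_nbhs_nbhs.
have e4 : e / 8 < e / 4 by lra.
have [r] := rat_in_itvoo e4; rewrite in_itv/= => /andP[r1 r2].
have [p] := rat_in_itvoo (ltac:(lra) : x < x + e / 8); rewrite in_itv/= => /andP[p1 p2].
have [q] := rat_in_itvoo (ltac:(lra) : y < y + e / 8); rewrite in_itv/= => /andP[q1 q2].
exists (p, q, r) => //; rewrite /F /=; case: asboolP => [_|[]].
  by split; rewrite /= in_itv/=; apply/andP; split; lra.
move=> x' y'; rewrite !ltr_norml => /andP[h1 h2] /andP[h3 h4]; apply: He.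
by split; rewrite /ball /= ltr_norml; apply/andP; split; lra.
Qed.

Lemma continuous_measurable2 (f : R * R -> R) : continuous f ->
  measurable_fun setT (f : measurableTypeR R * measurableTypeR R -> R).
Proof.
move=> /continuousP cf; apply: (measurability _ (RGenOpens.measurableE R)).
move=> _ [_ [a [b ->] <-]]; rewrite setTI; apply: open_measurable2.
exact/cf/interval_open.
Qed.

Lemma measurable_rect (a b : R) : measurable (`[0, a] `*` `[0, b] : set (measurableTypeR R * measurableTypeR R)).
Proof. by apply: measurableX; exact: measurable_itv. Qed.

Lemma seg_measure (x x' : R) : x < x' -> mu `[x, x'] = (x' - x)%:E.
Proof. by move=> xx; apply: (etrans (lebesgue_measure_itv `[x, x'])); rewrite /= lte_fin xx. Qed.

Lemma rect_measure (x x' y y' : R) : x < x' -> y < y' ->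
  mu2 (`[x, x'] `*` `[y, y']) = ((x' - x) * (y' - y))%:E.
Proof.
move=> xx yy.
have mI (a b : R) : measurable (`[a, b] : set (measurableTypeR R)) by exact: measurable_itv.
apply: (etrans (product_measure1E _ _ (mI x x') (mI y y'))).
exact: (congr2 mule (seg_measure xx) (seg_measure yy)).
Qed.

Lemma integrable_rect (f : R * R -> R) (a b : R) : 0 < a -> 0 < b -> continuous f ->
  mu2.-integrable (`[0, a] `*` `[0, b]) (EFin \o f).
Proof.
move=> a0 b0 cf; apply: measurable_bounded_integrable.
- exact: measurable_rect.
- exact: (eq_ind_r (fun y => (y < +oo)%E) (ltry _) (rect_measure a0 b0)).
- exact: measurable_funS (continuous_measurable2 cf).
have cK : compact (`[0, a] `*` `[0, b] : set (R * R)) by apply: compact_setX; exact: segment_compact.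
have [C _ HC] := compact_bound cK (fun x _ => cf x).
by exists C; split; [exact: num_real|move=> N /ltW CN x /HC /le_trans; apply].
Qed.

Lemma integrable_seg (f : R -> R) (a : R) : continuous f -> mu.-integrable `[0, a] (EFin \o f).
Proof.
move=> cf; apply: continuous_compact_integrable; first exact: segment_compact.
exact: continuous_subspaceT.
Qed.

(** Fubini for a product of two functions of one variable each. *)
Lemma Rintegral_prod (f h : R -> R) (a b : R) : 0 < a -> 0 < b -> continuous f -> continuous h ->
  (forall s, s \in `[0, a] -> 0 <= f s) -> (forall u, u \in `[0, b] -> 0 <= h u) ->
  \int[mu2]_(x in `[0, a] `*` `[0, b]) (f x.1 * h x.2) =
  \int[mu]_(s in `[0, a]) f s * \int[mu]_(u in `[0, b]) h u.
Proof.
move=> a0 b0 cf ch f0 h0.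
have fi := integrable_seg a cf; have hi := integrable_seg b ch.
have mI (c : R) : measurable (`[0, c] : set (measurableTypeR R)) by exact: measurable_itv.
have ff := integrable_fin_num (mI a) fi; have hf := integrable_fin_num (mI b) hi.
have cfh : continuous (fun x : R * R => f x.1 * h x.2).
  move=> x; apply: cvgM.
    by apply: (@continuous_comp _ _ _ fst f); [exact: cvg_fst|exact: cf].
  by apply: (@continuous_comp _ _ _ snd h); [exact: cvg_snd|exact: ch].
rewrite /Rintegral -fineM//; congr fine.
rewrite integral_mkcond fubini_tonelli1; last 2 first.
- apply/measurable_restrict => //; first exact: measurable_rect.
  rewrite setTI; apply/measurable_EFinP.
  exact: measurable_funS (continuous_measurable2 cfh).
- move=> [s u]; rewrite patchE; case: ifPn => // /set_mem[/= s0 u0].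
  by rewrite lee_fin mulr_ge0 ?f0 ?h0.
transitivity (\int[mu]_s (((EFin \o f) \_ `[0%R, a]) s * \int[mu]_(u in `[0%R, b]) (h u)%:E))%E.
  apply: eq_integral => s _; rewrite /fubini_F [in RHS]patchE; case: ifPn => [/set_mem sa|sa].
    rewrite -(integralZl (mI b) hi) [RHS]integral_mkcond; apply: eq_integral => u _.
    rewrite !patchE; case: ifPn => [/set_mem[/= _ ub]|ub].
      by rewrite mem_set// EFinM.
    case: ifPn => // /set_mem ub'; exfalso; move/negP: ub; apply; exact: mem_set.
  rewrite mul0e; apply: integral0_eq => u _; rewrite patchE; case: ifPn => // /set_mem[/= sa' _].
  by exfalso; move/negP: sa; apply; exact: mem_set.
have /fineK <- : (\int[mu]_(u in `[0%R, b]) (h u)%:E)%E \is a fin_num by exact: hf.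
rewrite [RHS]muleC -(integralZl (mI a) fi) [RHS]integral_mkcond; apply: eq_integral => s _.
by rewrite !patchE; case: ifPn => _; [rewrite muleC|rewrite mul0e].
Qed.

Lemma continuous_lb (V : normedModType R) (f : V -> R) (x : V) : {for x, continuous f} -> 0 < f x ->
  exists2 r, 0 < r & forall y, `|y - x| < r -> f x / 2 <= f y.
Proof.
move=> cf fx; have f2 : 0 < f x / 2 by rewrite divr_gt0.
have [r r0 Hr] := (continuous_epsP _ _).1 cf _ f2; exists r => // y /Hr; rewrite ltr_norml; lra.
Qed.

Lemma rect_gt0 (f : R * R -> R) (a b s u : R) : continuous f -> 0 < s < a -> 0 < u < b ->
  (forall s u, s \in `[0, a] -> u \in `[0, b] -> 0 <= f (s, u)) -> 0 < f (s, u) ->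
  0 < \int[mu2]_(x in `[0, a] `*` `[0, b]) f x.
Proof.
move=> cf /andP[s0 sa] /andP[u0 ub] f0 fsu.
have [r r0 Hr] := continuous_lb (cf (s, u)) fsu.
pose e := Num.min (Num.min (r / 2) (Num.min (s / 2) (u / 2))) (Num.min ((a - s) / 2) ((b - u) / 2)).
have e0 : 0 < e by rewrite !lt_min !divr_gt0 ?subr_gt0.
have er : e <= r / 2 by rewrite /e !ge_min lexx.
have es : e <= s / 2 by rewrite /e !ge_min lexx !orbT.
have eu : e <= u / 2 by rewrite /e !ge_min lexx !orbT.
have ea : e <= (a - s) / 2 by rewrite /e !ge_min lexx !orbT.
have eb : e <= (b - u) / 2 by rewrite /e !ge_min lexx !orbT.
apply: (Rintegral_gt0 (mu := mu2) (B := `[s - e, s + e] `*` `[u - e, u + e]) (c := f (s, u) / 2)).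
- exact: measurable_rect.
- by apply: measurableX; exact: measurable_itv.
- by apply: integrable_rect => //; lra.
- by move=> [x y] [/= h1 h2]; exact: f0.
- move=> [x y]; rewrite /= !in_itv/= => -[/andP[h1 h2] /andP[h3 h4]].
  by split; apply/andP; split; lra.
- have hs : s - e < s + e by lra.
  have hu : u - e < u + e by lra.
  apply: (eq_ind_r (fun y => (0 < y)%E) _ (rect_measure hs hu)).
  by rewrite lte_fin mulr_gt0 ?subr_gt0.
- by rewrite divr_gt0.
move=> [x y]; rewrite /= !in_itv/= => -[/andP[h1 h2] /andP[h3 h4]]; apply: Hr.
rewrite prod_normE /= gt_max !ltr_norml; apply/andP; split; apply/andP; split; lra.
Qed.

Lemma seg_gt0 (f : R -> R) (a s : R) : continuous f -> 0 < s < a ->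
  (forall s, s \in `[0, a] -> 0 <= f s) -> 0 < f s -> 0 < \int[mu]_(x in `[0, a]) f x.
Proof.
move=> cf /andP[s0 sa] f0 fs.
have [r r0 Hr] := continuous_lb (cf s) fs.
pose e := Num.min (Num.min (r / 2) (s / 2)) ((a - s) / 2).
have e0 : 0 < e by rewrite !lt_min !divr_gt0 ?subr_gt0.
have er : e <= r / 2 by rewrite /e !ge_min lexx.
have es : e <= s / 2 by rewrite /e !ge_min lexx !orbT.
have ea : e <= (a - s) / 2 by rewrite /e !ge_min lexx !orbT.
apply: (Rintegral_gt0 (mu := mu) (B := `[s - e, s + e]) (c := f s / 2)).
- exact: measurable_itv.
- exact: measurable_itv.
- exact: integrable_seg.
- by move=> x; exact: f0.
- by move=> x; rewrite /= !in_itv/= => /andP[h1 h2]; apply/andP; split; lra.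
- have hs : s - e < s + e by lra.
  apply: (eq_ind_r (fun y => (0 < y)%E) _ (seg_measure hs)).
  by rewrite lte_fin subr_gt0.
- by rewrite divr_gt0.
by move=> x; rewrite /= !in_itv/= => /andP[h1 h2]; apply: Hr; rewrite ltr_norml; apply/andP; split; lra.
Qed.

Lemma seg_cst (a c : R) : 0 < a -> \int[mu]_(x in `[0, a]) c = c * a.
Proof.
move=> a0; rewrite Rintegral_cst; last exact: measurable_itv.
by apply: (eq_ind_r (fun y => c * fine y = c * a) _ (seg_measure a0)); rewrite /= subr0.
Qed.

(** Jensen's inequality for the length of the vectors (1, f s): by
    Cauchy-Schwarz each of them is at least as long as its component in the
    direction of the mean vector. *)
Lemma sqrt_mean (f : R -> R) (a : R) : 0 < a -> continuous f ->
  Num.sqrt (a ^+ 2 + (\int[mu]_(s in `[0, a]) f s) ^+ 2) <=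
  \int[mu]_(s in `[0, a]) Num.sqrt (1 + f s ^+ 2).
Proof.
move=> a0 cf; set I := \int[mu]_(s in `[0, a]) f s; set N := Num.sqrt _.
have N20 : 0 < a ^+ 2 + I ^+ 2 by rewrite ltr_pwDl ?exprn_gt0// sqr_ge0.
have N0 : 0 < N by rewrite sqrtr_gt0.
have N2 : N ^+ 2 = a ^+ 2 + I ^+ 2 by rewrite sqr_sqrtr// ltW.
have c1 : continuous (fun s => Num.sqrt (1 + f s ^+ 2)).
  move=> s; apply: (@continuous_comp _ _ _ (fun s => 1 + f s ^+ 2) Num.sqrt); last exact: sqrt_continuous.
  by apply: cvgD; [exact: cvg_cst|apply: cvgM; exact: cf].
have c2 : continuous (fun s => I / N * f s) by move=> s; apply: cvgM; [exact: cvg_cst|exact: cf].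
have mI : measurable (`[0, a] : set (measurableTypeR R)) by exact: measurable_itv.
have E : \int[mu]_(s in `[0, a]) (a / N + I / N * f s) = N.
  rewrite RintegralD//; last 2 first.
  - by apply: integrable_seg => s; exact: cvg_cst.
  - exact: integrable_seg.
  rewrite seg_cst// RintegralZl//; last exact: integrable_seg.
  rewrite -/I; have -> : a / N * a + I / N * I = (a ^+ 2 + I ^+ 2) / N by ring.
  by rewrite -N2 expr2 mulfK// gt_eqF.
rewrite -[leLHS]E; apply: le_Rintegral => //.
- by apply: integrable_seg => s; apply: cvgD; [exact: cvg_cst|exact: c2].
- exact: integrable_seg.
move=> s _; set x := f s.
have -> : a / N + I / N * x = (a + I * x) / N by ring.
rewrite ler_pdivrMr//; apply: le_trans (ler_norm _) _.
rewrite -sqrtr_sqr /N -sqrtrM; last by rewrite addr_ge0// sqr_ge0.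
apply: ler_wsqrtr; rewrite -subr_ge0.
have -> : (1 + x ^+ 2) * (a ^+ 2 + I ^+ 2) - (a + I * x) ^+ 2 = (I - a * x) ^+ 2 by ring.
exact: sqr_ge0.
Qed.

End Plane.

(** * Poles that unroll onto one geodesic *)

Section Reparametrization.
Context {R : realType}.
Variables (a sg : R) (sg1 : sg = 1 \/ sg = -1).

Let aff (t : R) : R := a + sg * t.

(** For an affine change of parameter, a difference quotient in the direction v
    is one in the direction sg * v. *)
Lemma is_derive_reparam (W : normedModType R) (f : R -> W) (t v : R) (d : W) :
  is_derive (aff t) (sg * v) f d -> is_derive t v (fun s => f (aff s)) d.
Proof.
move=> /is_derive_epsP H; apply/is_derive_epsP => e /H[r r0 Hr]; exists r => // h /Hr.
suff -> : aff (h *: v + t) = h *: (sg * v) + aff t by [].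
by rewrite /aff -![_ *: _]/(_ * _); ring.
Qed.

Lemma derivable_reparam (W : normedModType R) (f : R -> W) (t v : R) :
  derivable f (aff t) (sg * v) ->
  derivable (fun s => f (aff s)) t v /\ 'D_v (fun s => f (aff s)) t = 'D_(sg * v) f (aff t).
Proof. by move=> /derivableP /is_derive_reparam[]. Qed.

Lemma affine_continuous (t : R) : {for t, continuous aff}.
Proof.
by apply: cvgD; [exact: cvg_cst|apply: cvgM; [exact: cvg_cst|exact: cvg_id]].
Qed.

Lemma affine_open (U : set R) : open U -> open [set t | U (aff t)].
Proof. by move=> oU; apply: (@open_comp _ _ aff) => // t _; exact: affine_continuous. Qed.

Lemma Ck_affine k (W : normedModType R) (U : set R) (f : R -> W) : open U ->
  Ck k U f -> Ck k [set t | U (aff t)] (fun t => f (aff t)).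
Proof.
move=> oU; elim: k f => [|k IH] f /= [fc H]; split=> //.
- move=> t /= Ut; apply: (@continuous_comp _ _ _ aff f); first exact: affine_continuous.
  exact: fc.
- move=> t /= Ut; apply: (@continuous_comp _ _ _ aff f); first exact: affine_continuous.
  exact: fc.
move=> v; have [H1 H2] := H (sg * v); split=> [t /= Ut|].
  by have [] := derivable_reparam (H1 _ Ut).
apply: (Ck_ext (affine_open oU) (f := fun t => 'D_(sg * v) f (aff t)) _ (IH _ H2)) => t /= Ut.
by have [_ ->] := derivable_reparam (H1 _ Ut).
Qed.

Context {n : nat} {M : topologicalType} {A : smooth_manifold R n M} (g : riemannian_metric A).
Context (U : set R) (oU : open U) (c : R -> M).

Lemma curve_dom_open i : @smooth_curve R n M A U c ->
  open [set t | U t /\ chart_dom (s := A) i (c t)].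
Proof.
move=> sc; rewrite openE => t [Ut it].
exact: (curve_near oU (smooth_curve_cont sc Ut) Ut it).
Qed.

Lemma smooth_affine : @smooth_curve R n M A U c ->
  @smooth_curve R n M A [set t | U (aff t)] (fun t => c (aff t)).
Proof.
move=> sc; split=> [t /= Ut|i k].
  apply: (@continuous_comp _ _ _ aff c); first exact: affine_continuous.
  exact: (smooth_curve_cont sc).
have := Ck_affine (U := [set t | U t /\ chart_dom i (c t)]) (f := chart i \o c) (curve_dom_open (i := i) sc) (sc.2 i k).
exact.
Qed.

Lemma vel_affine i t : @smooth_curve R n M A U c -> U (aff t) -> chart_dom (s := A) i (c (aff t)) ->
  vel (A := A) i (fun t => c (aff t)) t = sg *: vel (A := A) i c (aff t).
Proof.
move=> sc Ut it; rewrite velE derive1E.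
have [d E] := vel_derive sc Ut it.
have H := is_deriveZdir sg d; rewrite E in H.
by have [_ ->] := is_derive_reparam (f := chart i \o c) H.
Qed.

Lemma velocity_affine t : @smooth_curve R n M A U c -> U (aff t) ->
  @velocity R n M A (fun t => c (aff t)) t = sg *: @velocity R n M A c (aff t).
Proof. by move=> sc Ut; rewrite !velocityE vel_affine//; exact: chart_atP. Qed.

Lemma acceleration_affine t : @smooth_curve R n M A U c -> U (aff t) ->
  acceleration g (fun t => c (aff t)) t = acceleration g c (aff t).
Proof.
move=> sc Ut; rewrite !accelerationE; set i := chart_at A _.
have it : chart_dom i (c (aff t)) by exact: chart_atP.
have sg2 : sg * sg = 1 by case: sg1 => ->; rewrite ?mulrNN mulr1.
rewrite /acc (vel_affine sc Ut it).
have ix := chart_in_cod it; set x := chart i (c (aff t)) in ix *; set v := vel i c (aff t).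
have -> : christoffel g i x (sg *: v) (sg *: v) = christoffel g i x v v.
  rewrite (christoffelZl g sg v (sg *: v) ix) (christoffelZr g sg v v ix).
  by rewrite scalerA sg2 scale1r.
suff -> : derive1 (vel i (fun t => c (aff t))) t = derive1 (vel i c) (aff t) by [].
have [d _] := acc_derive g sc Ut it.
have [_] := is_deriveZ sg (is_derive_reparam (t := t) (v := 1) (is_deriveZdir sg d)).
rewrite scalerA sg2 scale1r !derive1E => <-; apply: near_eq_derive.
have oW := affine_open oU.
have cc : {for t, continuous (fun t => c (aff t))} := smooth_curve_cont (smooth_affine sc) Ut.
have := curve_near oW cc Ut it; apply: filterS => s [Us is_].
by rewrite (vel_affine sc Us is_).
Qed.

Lemma geodesic_affine : geodesic_on g U c -> geodesic_on g [set t | U (aff t)] (fun t => c (aff t)).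
Proof.
by move=> [sc gc]; split=> [|t /= Ut]; [exact: smooth_affine|rewrite acceleration_affine// gc].
Qed.

End Reparametrization.

Section Local.
Context {R : realType} {n : nat} {M : topologicalType}.
Context {A : smooth_manifold R n M} (g : riemannian_metric A).

Lemma velocity_near (c c' : R -> M) (t : R) : (\forall s \near t, c s = c' s) ->
  @velocity R n M A c t = @velocity R n M A c' t.
Proof.
move=> E; rewrite /velocity (nbhs_singleton E) !derive1E; apply: near_eq_derive.
by apply: filterS E => s /= ->.
Qed.

Lemma acceleration_near (c c' : R -> M) (t : R) : (\forall s \near t, c s = c' s) ->
  acceleration g c t = acceleration g c' t.
Proof.
move=> E; have Et : c t = c' t := nbhs_singleton E.
rewrite !accelerationE -Et; move: (chart_at A (c t)) => i.
have V (s : R) : (\forall s \near s, c s = c' s) -> vel (A := A) i c s = vel (A := A) i c' s.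
  by move=> Es; rewrite !velE !derive1E; apply: near_eq_derive; apply: filterS Es => u /= ->.
have D : derive1 (vel (A := A) i c) t = derive1 (vel (A := A) i c') t.
  rewrite !derive1E; apply: near_eq_derive.
  by have := near_join E; apply: filterS => s /V.
by rewrite /acc D -Et -(V t E).
Qed.

End Local.

Section Unroll.
Context {R : realType} {n : nat} {M : topologicalType}.
Context {A : smooth_manifold R n M} (g : riemannian_metric A).
Context (U : set R) (oU : open U) (gamma : R -> M) (sgamma : @smooth_curve R n M A U gamma).
Context (eps : R) (lam : R -> R -> M).
Context (glam : forall s, U s -> geodesic_on g setT (lam s)).
Context (lam0 : forall s, U s -> lam s 0 = gamma s).
Context (vlam : forall s, U s -> @velocity R n M A (lam s) 0 = eps *: @velocity R n M A gamma s).
Context (eps1 : eps = 1 \/ eps = -1).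
Context (L : R) (L0 : 0 < L) (LU : `[0, L] `<=` U).

Let in_seg s : 0 <= s <= L -> U s.
Proof. by move=> h; apply: LU; rewrite /= in_itv. Qed.

Let rayE (c0 : R -> M) s u : geodesic_on g setT c0 -> U s -> gamma s = c0 s ->
  @velocity R n M A gamma s = @velocity R n M A c0 s -> lam s u = c0 (s + eps * u).
Proof.
move=> g0 Us E V; have g' := geodesic_affine s eps1 openT g0.
suff /(_ u)/agreeP[] : forall u, agree (A := A) (lam s) (fun t => c0 (s + eps * t)) u by [].
apply: (geodesic_uniqueT (glam Us)); first exact: g'.
apply/agreeP; split; first by rewrite (lam0 Us) mulr0 addr0 E.
have := velocity_affine (a := s) (sg := eps) (t := 0) g0.1 I.
by rewrite mulr0 addr0 => ->; rewrite (vlam Us) V.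
Qed.

(** If gamma has no acceleration inside its interval, it coincides there with
    the complete geodesic c0 through its midpoint, and every pole coincides
    with c0 by uniqueness. The end poles follow by continuity of the family in
    s. *)
Lemma poles_unroll : complete_metric g -> (forall s, 0 < s < L -> acceleration g gamma s = 0) ->
  exists c0 : R -> M, [/\ geodesic_on g setT c0, forall s, 0 <= s <= L -> gamma s = c0 s &
    forall s u, 0 <= s <= L -> lam s u = c0 (s + eps * u)].
Proof.
move=> gC a0; pose m := L / 2.
have m0 : 0 < m by rewrite divr_gt0.
have mL : L = m + m by rewrite /m; field.
have [c1 [g1 c10 c1v]] := gC (gamma m) (@velocity R n M A gamma m).
pose c0 t := c1 (- m + 1 * t).
have g0 : geodesic_on g setT c0 := geodesic_affine (- m) (or_introl erefl) openT g1.
have v0 t : @velocity R n M A c0 t = @velocity R n M A c1 (- m + 1 * t).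
  by rewrite (velocity_affine (a := - m) (sg := 1) g1.1 I) scale1r.
pose V := [set t : R | 0 < t < L].
have oV : open V.
  have -> : V = `]0, L[%classic by apply/seteqP; split=> t /=; rewrite in_itv.
  exact: interval_open.
have VU : V `<=` U by move=> t /andP[t1 t2]; apply: in_seg; rewrite !ltW.
have gV : geodesic_on g V gamma.
  split=> [|t /a0//]; split=> [t /VU Ut|i k]; first exact: (smooth_curve_cont sgamma).
  by apply: (Ck_sub _ (sgamma.2 i k)) => t [Vt it]; split=> //; exact: VU.
have ag t : V t -> agree (A := A) gamma c0 t.
  move=> /andP[t0 tL].
  have g2 := geodesic_affine m (or_introl erefl) oV gV.
  have oW : open [set t | V (m + 1 * t)] := affine_open (a := m) (sg := 1) oV.
  have g1' : geodesic_on g [set t | V (m + 1 * t)] c1.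
    by split=> [|s _]; [split=> [s _|i k]; [exact: (g1.1.1 s I)|apply: (Ck_sub _ (g1.1.2 i k)) => s []]|exact: g1.2].
  have ag0 : agree (A := A) (fun t => gamma (m + 1 * t)) c1 0.
    apply/agreeP; split; first by rewrite mulr0 addr0 c10.
    have Vm : V (m + 1 * 0) by rewrite /V /= mulr0 addr0 mL; apply/andP; split; lra.
    rewrite (velocity_affine (a := m) (sg := 1) gV.1 Vm) scale1r mulr0 addr0.
    by rewrite c1v.
  have K (sg b : R) : `|sg| = 1 -> (forall s, 0 <= s <= b -> V (m + 1 * (sg * s))) -> 0 <= b ->
      agree (A := A) (fun t => gamma (m + 1 * t)) c1 (sg * b).
    move=> sg1 HV b0; have := geodesic_unique oW g2 g1' sg1 b0 HV ag0.
    by move=> /(_ b); rewrite b0 lexx; apply.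
  have {}K : agree (A := A) (fun t => gamma (m + 1 * t)) c1 (t - m).
    have [tm|tm] := leP m t.
      rewrite -[t - m]mul1r; apply: K; rewrite ?normr1 ?subr_ge0// => s /andP[s0 st].
      by rewrite !mul1r; apply/andP; split; lra.
    rewrite -opprB -mulN1r; apply: K; rewrite ?normrN ?normr1 ?subr_ge0 ?(ltW tm)// => s /andP[s0 st].
    by rewrite mulN1r mul1r; apply/andP; split; lra.
  move: K => /agreeP[]; have Et : m + 1 * (t - m) = t by ring.
  have Et' : - m + 1 * t = t - m by ring.
  have Vt : V (m + 1 * (t - m)) by rewrite Et; apply/andP.
  rewrite (velocity_affine (a := m) (sg := 1) gV.1 Vt) scale1r Et => E1 E2.
  by apply/agreeP; split; [rewrite /c0 Et' -E1|rewrite v0 Et' -E2].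
have E1 s u : V s -> lam s u = c0 (s + eps * u).
  by move=> Vs; have /agreeP[e1 e2] := ag s Vs; apply: rayE => //; exact: VU.
have E2 s u : 0 <= s <= L -> lam s u = c0 (s + eps * u).
  move=> sL.
  have cl : {for s, continuous (lam^~ u)} := pole_cont oU sgamma glam lam0 vlam (u := u) (in_seg sL).
  have cr : {for s, continuous (fun s => c0 (s + eps * u))}.
    apply: (@continuous_comp _ _ _ (fun s => s + eps * u) c0); last exact: (g0.1.1 _ I).
    by apply: cvgD; [exact: cvg_id|exact: cvg_cst].
  apply: (hausdorff_eq (A := A) cl cr) => d d0.
  by have [t Vt td] := interior_near L0 sL d0; exists t => //; exact: E1.
exists c0; split=> // s sL; have := E2 s 0 sL.
by rewrite mulr0 addr0 lam0//; exact: in_seg.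
Qed.

End Unroll.

(** * Continuity of the curvature and of the variation field *)

Section Continuity.
Context {R : realType}.

Lemma continuous_near (X W : normedModType R) (f h : X -> W) (x : X) :
  (\forall y \near x, f y = h y) -> {for x, continuous f} -> {for x, continuous h}.
Proof.
move=> /[dup] /nbhs_singleton E0 /nbhs_epsP[r r0 Hr] /continuous_epsP cf; apply/continuous_epsP => e /cf[d d0 Hd].
exists (Num.min r d); first by rewrite lt_min r0.
by move=> y; rewrite lt_min -E0 => /andP[yr yd]; rewrite -(Hr y yr); exact: Hd.
Qed.

Lemma bilinear_field_cont n (U : set 'rV[R]_n) f (X : normedModType R) (a b c : X -> 'rV[R]_n) (x : X) :
  open U -> bilinear_field U f -> U (a x) -> {for x, continuous a} ->
  (forall k, {for x, continuous (fun y => b y 0 k)}) ->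
  (forall k, {for x, continuous (fun y => c y 0 k)}) ->
  {for x, continuous (fun y => f (a y) (b y) (c y))}.
Proof.
move=> oU [fE fC] Ux ca cb cc.
apply: (continuous_near (f := fun y => \sum_p \sum_q b y 0 p * c y 0 q * f (a y) (delta_mx 0 p) (delta_mx 0 q))).
  have : \forall y \near x, U (a y) by apply: ca; exact: open_nbhs_nbhs.
  by apply: filterS => y Uy; rewrite [RHS]fE.
apply: (cvg_big (op := +%R)); first exact: add_continuous.
move=> p _; apply: (cvg_big (op := +%R)); first exact: add_continuous.
move=> q _; apply: cvgM; first by apply: cvgM; [exact: cb|exact: cc].
apply: (@continuous_comp _ _ _ a (fun y => f y (delta_mx 0 p) (delta_mx 0 q))) => //.
by case: (fC p q 0%N) => + _; apply.
Qed.

Lemma coord_cont n (X : normedModType R) (a : X -> 'rV[R]_n) (x : X) k :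
  {for x, continuous a} -> {for x, continuous (fun y => a y 0 k)}.
Proof.
move=> ca; apply: (@continuous_comp _ _ _ a (fun y : 'rV_n => y 0 k)) => //.
exact: coord_continuous.
Qed.

End Continuity.

Section GeometricContinuity.
Context {R : realType} {n : nat} {M : topologicalType}.
Context {A : smooth_manifold R n M} (g : riemannian_metric A).
Context (U : set R) (oU : open U).

Lemma geodesic_curvature_cont (c : R -> M) (s : R) : @smooth_curve R n M A U c -> U s ->
  {for s, continuous (geodesic_curvature g c)}.
Proof.
move=> sc Us; pose i := chart_at A (c s); have is_ : chart_dom i (c s) by exact: chart_atP.
have cs := smooth_curve_cont sc Us.
have N := curve_near oU cs Us is_.
have cchart := chart_curve_cont cs is_.
have ix := chart_in_cod is_.
have cvel k : {for s, continuous (fun t => vel i c t 0 k)}.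
  apply: coord_cont; have [d _] := acc_derive g sc Us is_.
  exact/differentiable_continuous/derivable1_diffP.
have cacc k : {for s, continuous (fun t => acc g i c t 0 k)}.
  apply: (continuous_near (f := fun t => 'D_1 ('D_1 (chart i \o c)) t 0 k +
    christoffel g i ((chart i \o c) t) (vel i c t) (vel i c t) 0 k)).
    have -> : 'D_1 (chart i \o c) = vel i c by apply/funext => t; rewrite velE derive1E.
    by apply: filterS N => t _; rewrite /acc derive1E [in RHS]mxE.
  have c2 : {for s, continuous ('D_1 ('D_1 (chart i \o c)))}.
    by case: sc => _ /(_ i 2%N)[_ /(_ 1)[_ [_ /(_ 1)[_ [+ _]]]]]; apply.
  apply: cvgD; first exact: (coord_cont (k := k) c2).
  exact: (bilinear_field_cont (@chart_cod_open _ _ _ A i) (christoffel_field g i k) ix cchart cvel cvel).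
apply: (continuous_near (f := fun t => Num.sqrt (inner g i ((chart i \o c) t) (acc g i c t) (acc g i c t)))).
  apply: filterS N => t [Ut it].
  by rewrite /geodesic_curvature /norm_at (acceleration_inner g oU sc Ut it).
apply: (@continuous_comp _ _ _ (fun t => inner g i ((chart i \o c) t) (acc g i c t) (acc g i c t)) Num.sqrt).
  exact: (bilinear_field_cont (@chart_cod_open _ _ _ A i) (inner_field g i) ix cchart cacc cacc).
exact: sqrt_continuous.
Qed.

Context (gamma : R -> M) (sgamma : @smooth_curve R n M A U gamma).
Context (eps : R) (lam : R -> R -> M).
Context (glam : forall s, U s -> geodesic_on g setT (lam s)).
Context (lam0 : forall s, U s -> lam s 0 = gamma s).
Context (vlam : forall s, U s -> @velocity R n M A (lam s) 0 = eps *: @velocity R n M A gamma s).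

(** In a fixed chart jac_p is the metric applied to the variation field, and
    both are jointly continuous. *)
Lemma jac_p_cont (s0 u0 : R) : U s0 -> {for (s0, u0), continuous (fun x : R * R => jac_p g lam x.1 x.2)}.
Proof.
move=> Us0; pose i := chart_at A (lam s0 u0); have is_ : chart_dom i (lam s0 u0) by exact: chart_atP.
have [[d d0 Hd] Hc] := family_local oU sgamma glam lam0 vlam Us0 is_.
pose ph (x : R * R) := phase i (lam x.1) x.2.
pose Y (x : R * R) := Yd (A := A) lam i x.1 x.2.
have near2 (r : R) (P : R -> R -> Prop) : 0 < r -> (forall s u, `|s - s0| < r -> `|u - u0| < r -> P s u) ->
    forall x : R * R, `|x - (s0, u0)| < r -> P x.1 x.2.
  by move=> r0 HP [s u]; rewrite prod_normE /= gt_max => /andP[h1 h2]; exact: HP.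
have cph : {for (s0, u0), continuous ph}.
  apply/continuous_epsP => e /Hc[r r0 Hr]; exists r => //.
  by apply: (near2 r (fun s u => `|phase i (lam s) u - phase i (lam s0) u0| < e)) => // s u h1 h2; case: (Hr s u h1 h2).
have cY : {for (s0, u0), continuous Y}.
  apply/continuous_epsP => e /Hc[r r0 Hr]; exists r => //.
  by apply: (near2 r (fun s u => `|Yd lam i s u - Yd lam i s0 u0| < e)) => // s u h1 h2; case: (Hr s u h1 h2).
have cl (F : R * R -> 'rV[R]_(n + n)) : {for (s0, u0), continuous F} -> {for (s0, u0), continuous (fun x => lsubmx (F x))}.
  by move=> cF; apply: (continuous_comp cF); exact: (@lsubmx_continuous R n (F (s0, u0))).
apply: (continuous_near (f := fun x => inner g i (lsubmx (ph x)) (lsubmx (Y x)) (lsubmx (Y x)) - 1)).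
  apply/nbhs_epsP; exists d => // x xd.
  have [Us is' _] := near2 d (fun s u => [/\ U s, chart_dom i (lam s u) & _]) d0 Hd x xd.
  by rewrite /jac_p (pole_JJ oU sgamma glam lam0 vlam Us is') /ph /phase row_mxKl.
have ix : chart_cod i (lsubmx (ph (s0, u0))) by rewrite /ph /phase row_mxKl; exact: chart_in_cod.
have cYk k : {for (s0, u0), continuous (fun x => lsubmx (Y x) 0 k)} := coord_cont (k := k) (cl Y cY).
have H := bilinear_field_cont (a := fun x => lsubmx (ph x)) (b := fun x => lsubmx (Y x))
  (c := fun x => lsubmx (Y x)) (@chart_cod_open _ _ _ A i) (inner_field g i) ix (cl ph cph) cYk cYk.
by apply: cvgB; [exact: H|exact: cvg_cst].
Qed.

End GeometricContinuity.

(** * From the pointwise comparison to the integral inequalities *)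

Section Clamp.
Context {R : realType} (L : R) (L0 : 0 < L).

(** The retraction of the line onto [0, L]. Composition with it turns functions
    that are continuous near [0, L] into globally continuous ones with the same
    integrals over [0, L]. *)
Definition clamp (s : R) : R := if s < 0 then 0 else if L < s then L else s.

Lemma clamp_in s : 0 <= clamp s <= L.
Proof.
have L0' := L0; rewrite /clamp.
by case: (ltP s 0) => h; [|case: (ltP L s) => h']; apply/andP; split; lra.
Qed.

Lemma clamp_id s : 0 <= s <= L -> clamp s = s.
Proof. by move=> /andP[s0 sL]; rewrite /clamp; case: (ltP s 0) => h; [|case: (ltP L s) => h' //]; lra. Qed.

Lemma clamp_cont : continuous clamp.
Proof.
move=> s; apply/continuous_epsP => e e0; exists e => // t; apply: le_lt_trans.
have [u1 u2] : t - s <= `|t - s| /\ - (t - s) <= `|t - s| by rewrite ler_norm -normrN ler_norm.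
have L0' := L0; rewrite /clamp ler_norml.
by case: (ltP t 0) => h1; [|case: (ltP L t) => h2]; (case: (ltP s 0) => h3; [|case: (ltP L s) => h4]);
  apply/andP; split; lra.
Qed.

Lemma closed_ge0 (h : R -> R) : continuous h -> (forall s, 0 < s < L -> 0 <= h s) ->
  forall s, 0 <= s <= L -> 0 <= h s.
Proof.
move=> ch H s /andP[s0 sL]; rewrite leNgt; apply/negP => hs.
have hs' : 0 < - h s by rewrite oppr_gt0.
have [d d0 Hd] := (continuous_epsP _ _).1 (ch s) _ hs'.
have [t tL td] := interior_near L0 (introT andP (conj s0 sL)) d0.
have := H t tL; have := Hd t td; rewrite ltr_norml; lra.
Qed.

End Clamp.

Section JacobiIntegral.
Context {R : realType} (K ell : R) (ell0 : 0 < ell).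

Lemma jacobi_cont : continuous (jacobi K).
Proof. by move=> u; apply/differentiable_continuous/derivable1_diffP; have [] := jacobi_derive K u. Qed.

Lemma jacobi_integral (F : R -> R) : (forall u, is_derive u (1:R) F (jacobi K u)) ->
  \int[lebesgue_measure]_(u in `[0, ell]) jacobi K u = F ell - F 0.
Proof.
move=> dF; have cF : continuous F.
  by move=> u; apply/differentiable_continuous/derivable1_diffP; have [] := dF u.
rewrite /Rintegral (@continuous_FTC2 _ _ F)//.
- exact: continuous_subspaceT jacobi_cont.
- split=> [u _| |]; first by have [] := dF u.
    exact: cvg_at_right_filter (cF 0).
  exact: cvg_at_left_filter (cF ell).
- by move=> u _; rewrite derive1E; have [_ ->] := dF u.
Qed.

Lemma jacobi_integral_pos (k : R) : 0 < k -> K = k ^+ 2 ->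
  \int[lebesgue_measure]_(u in `[0, ell]) jacobi K u = (1 - cos (k * ell)) / k ^+ 2.
Proof.
move=> k0 Kk; have kk : Num.sqrt K = k by rewrite Kk sqrtr_sqr gtr0_norm.
have KK : 0 < K by rewrite Kk exprn_gt0.
have kn := lt0r_neq0 k0.
suff D : forall u, is_derive u (1:R) (fun u => - cos (k * u) / k ^+ 2) (jacobi K u).
  rewrite (jacobi_integral D).
  by rewrite mulr0 cos0; field.
move=> u; have D : is_derive u (1:R) (fun u => - cos (k * u)) (k * sin (k * u)).
  have dk : is_derive u (1:R) ( *%R k) k.
    by apply: (is_derive_eq (is_deriveZ k (is_derive_id u (1:R)))); rewrite -[LHS]/(k * 1) mulr1.
  apply: (is_derive_eq (is_deriveN (is_derive1_comp (is_derive_cos (k * u)) dk))).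
  by ring.
apply: (is_derive_eq (is_derive_div (k ^+ 2) D)).
by rewrite /jacobi KK kk; field.
Qed.

Lemma jacobi_integral_zero : K = 0 ->
  \int[lebesgue_measure]_(u in `[0, ell]) jacobi K u = ell ^+ 2 / 2.
Proof.
move=> K0; suff D : forall u, is_derive u (1:R) (fun u => u ^+ 2 / 2) (jacobi K u).
  by rewrite (jacobi_integral D) expr0n mul0r subr0.
move=> u; apply: (is_derive_eq (is_derive_div 2 (is_derive_sq (is_derive_id u (1:R))))).
by rewrite /jacobi K0 ltxx eqxx mulr1; field.
Qed.

Lemma jacobi_integral_neg (k : R) : 0 < k -> K = - k ^+ 2 ->
  \int[lebesgue_measure]_(u in `[0, ell]) jacobi K u = (cosh (k * ell) - 1) / k ^+ 2.
Proof.
move=> k0 Kk; have kk : Num.sqrt (- K) = k by rewrite Kk opprK sqrtr_sqr gtr0_norm.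
have KK : K < 0 by rewrite Kk oppr_lt0 exprn_gt0.
have kn := lt0r_neq0 k0.
suff D : forall u, is_derive u (1:R) (fun u => cosh (k * u) / k ^+ 2) (jacobi K u).
  rewrite (jacobi_integral D).
  by rewrite mulr0 /cosh oppr0 expR0; field.
move=> u; have D : is_derive u (1:R) (fun u => cosh (k * u)) (k * sinh (k * u)).
  have dk : is_derive u (1:R) ( *%R k) k.
    by apply: (is_derive_eq (is_deriveZ k (is_derive_id u (1:R)))); rewrite -[LHS]/(k * 1) mulr1.
  by apply: (is_derive_eq (is_derive1_comp (cosh_derive (k * u)) dk)); rewrite mulrC.
apply: (is_derive_eq (is_derive_div (k ^+ 2) D)).
by rewrite /jacobi (lt_gtF KK) (lt_eqF KK) kk; field.
Qed.

End JacobiIntegral.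

Section Integrals.
Context {R : realType} (L ell : R) (L0 : 0 < L) (ell0 : 0 < ell).
Context (k S : R -> R) (p : R * R -> R).
Context (k_cont : continuous k) (S_cont : continuous S) (p_cont : continuous p).
Context (k_ge0 : forall s, 0 <= k s) (S0 : S 0 = 0) (S_gt0 : forall u, 0 < u <= ell -> 0 < S u).
Context (p_ge0 : forall s u, 0 < s < L -> 0 <= p (s, u)).
Context (kSp : forall s u, 0 < s < L -> 0 < u <= ell -> 0 < k s -> (k s * S u) ^+ 2 < p (s, u)).

Notation mu := (@lebesgue_measure R).
Notation mu2 := (lebesgue_measure \x lebesgue_measure)%E.

Let S_ge0 u : 0 <= u <= ell -> 0 <= S u.
Proof.
move=> /andP[]; rewrite le_eqVlt => /predU1P[<- _|u0 ul]; first by rewrite S0.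
by apply/ltW/S_gt0; rewrite u0.
Qed.

Lemma pair_cont (X : normedModType R) (a b : X -> R) (x : X) :
  {for x, continuous a} -> {for x, continuous b} -> {for x, continuous (fun y => (a y, b y))}.
Proof.
move=> /continuous_epsP ca /continuous_epsP cb; apply/continuous_epsP => e /[dup] /ca[r r0 Hr] /cb[d d0 Hd].
exists (Num.min r d); first by rewrite lt_min r0.
by move=> y; rewrite lt_min prod_normE gt_max /= => /andP[yr yd]; rewrite Hr// Hd.
Qed.

Let ps_cont u : continuous (fun s => p (s, u)).
Proof.
move=> s; have h : {for s, continuous (fun t : R => (t, u))} by apply: pair_cont; [exact: cvg_id|exact: cvg_cst].
by apply: (@continuous_comp _ _ _ (fun t : R => (t, u)) p); [exact: h|exact: p_cont].
Qed.

(* The comparison extends to the two end poles by continuity. *)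
Let compare s u : 0 <= s <= L -> 0 <= u <= ell -> (k s * S u) ^+ 2 <= p (s, u).
Proof.
move=> sL ul; rewrite -subr_ge0; move: s sL; apply: closed_ge0 => //.
  move=> s; apply: cvgB; first exact: ps_cont.
  by apply: cvgM; (apply: cvgM; [exact: k_cont|exact: cvg_cst]).
move=> s sL; rewrite subr_ge0; have := k_ge0 s; rewrite le_eqVlt => /predU1P[<-|k0].
  by rewrite mul0r expr0n p_ge0.
move: ul => /andP[]; rewrite le_eqVlt => /predU1P[<- _|u0 ul].
  by rewrite S0 mulr0 expr0n p_ge0.
by apply/ltW/kSp => //; rewrite u0.
Qed.

Let kS_ge0 s u : 0 <= u <= ell -> 0 <= k s * S u.
Proof. by move=> ul; rewrite mulr_ge0// S_ge0. Qed.

Let compare_sqrt s u : 0 <= s <= L -> 0 <= u <= ell -> k s * S u <= Num.sqrt (p (s, u)).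
Proof.
move=> sL ul; rewrite -[leLHS]ger0_norm ?kS_ge0// -sqrtr_sqr.
exact/ler_wsqrtr/compare.
Qed.

Let sqrt1_cont (f : R -> R) : continuous f -> continuous (fun s => Num.sqrt (1 + f s)).
Proof.
move=> cf s; have h : {for s, continuous (fun t => 1 + f t)} by apply: cvgD; [exact: cvg_cst|exact: cf].
exact: (@continuous_comp _ _ _ (fun t => 1 + f t) Num.sqrt s h (@sqrt_continuous _ _)).
Qed.

Let kS_cont : continuous (fun s => k s * S ell).
Proof. by move=> s; apply: cvgM; [exact: k_cont|exact: cvg_cst]. Qed.

Let closed_eq0 (h : R -> R) : continuous h -> (forall s, 0 < s < L -> h s = 0) ->
  forall s, 0 <= s <= L -> h s = 0.
Proof.
move=> ch H s sL; apply/eqP; rewrite eq_le -oppr_ge0; apply/andP; split.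
  have cN : continuous (fun s => - h s) by move=> t; apply: cvgN; exact: ch.
  by apply: (closed_ge0 L0 cN) => // t /H ->; rewrite oppr0.
by apply: (closed_ge0 L0 ch) => // t /H ->.
Qed.

Lemma flat_mass : (forall s, 0 < s < L -> k s = 0) -> \int[mu]_(s in `[0, L]) k s = 0.
Proof.
move=> H; rewrite (@eq_Rintegral _ _ _ _ _ (fun=> 0)); first by rewrite seg_cst// mul0r.
by move=> s /set_mem; rewrite /= in_itv/=; exact: closed_eq0.
Qed.

Lemma flat_mid : (forall s, 0 < s < L -> k s = 0) ->
  \int[mu]_(s in `[0, L]) Num.sqrt (1 + (k s * S ell) ^+ 2) = L.
Proof.
move=> H; rewrite (@eq_Rintegral _ _ _ _ _ (fun=> 1)); first by rewrite seg_cst// mul1r.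
move=> s /set_mem; rewrite /= in_itv/= => /(closed_eq0 k_cont H) ->.
by rewrite mul0r expr0n addr0 sqrtr1.
Qed.

Let p_closed : (forall s u, 0 < s < L -> p (s, u) = 0) -> forall s u, 0 <= s <= L -> p (s, u) = 0.
Proof. by move=> H s u; apply: (closed_eq0 (h := fun s => p (s, u))); [exact: ps_cont|move=> t; exact: H]. Qed.

Lemma flat_length : (forall s u, 0 < s < L -> p (s, u) = 0) ->
  \int[mu]_(s in `[0, L]) Num.sqrt (1 + p (s, ell)) = L.
Proof.
move=> H; rewrite (@eq_Rintegral _ _ _ _ _ (fun=> 1)); first by rewrite seg_cst// mul1r.
by move=> s /set_mem; rewrite /= in_itv/= => sL; rewrite p_closed// addr0 sqrtr1.
Qed.

Lemma flat_area : (forall s u, 0 < s < L -> p (s, u) = 0) ->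
  \int[mu2]_(x in `[0, L] `*` `[0, ell]) Num.sqrt (p x) = 0.
Proof.
move=> H; rewrite (@eq_Rintegral _ _ _ _ _ (fun=> 0)).
  by rewrite Rintegral_cst ?mul0r//; exact: measurable_rect.
by move=> [s u] /set_mem[/=]; rewrite in_itv/= => sL _; rewrite p_closed// sqrtr0.
Qed.

Lemma length_comparison : \int[mu]_(s in `[0, L]) Num.sqrt (1 + (k s * S ell) ^+ 2) <=
  \int[mu]_(s in `[0, L]) Num.sqrt (1 + p (s, ell)).
Proof.
apply: le_Rintegral.
- exact: measurable_itv.
- apply: integrable_seg; apply: sqrt1_cont => s.
  by apply: cvgM; exact: kS_cont.
- by apply: integrable_seg; apply: (sqrt1_cont (f := fun s : R => p (s, ell))); exact: ps_cont.
move=> s; rewrite /= in_itv/= => sL; apply: ler_wsqrtr; rewrite lerD2l.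
by apply: compare => //; rewrite lexx ltW.
Qed.

(** The curve with velocity (1, k S ell) has length at least that of its chord. *)
Lemma length_mean : Num.sqrt (L ^+ 2 + (S ell * \int[mu]_(s in `[0, L]) k s) ^+ 2) <=
  \int[mu]_(s in `[0, L]) Num.sqrt (1 + (k s * S ell) ^+ 2).
Proof.
have -> : S ell * \int[mu]_(s in `[0, L]) k s = \int[mu]_(s in `[0, L]) (k s * S ell).
  rewrite -RintegralZl; [|exact: measurable_itv|exact: integrable_seg].
  by apply: eq_Rintegral => s _; rewrite mulrC.
exact: sqrt_mean.
Qed.

Let kS2_cont : continuous (fun x : R * R => k x.1 * S x.2).
Proof.
move=> x; have h1 : {for x, continuous (fun x : R * R => k x.1)}.
  by apply: (@continuous_comp _ _ _ fst k); [exact: cvg_fst|exact: k_cont].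
have h2 : {for x, continuous (fun x : R * R => S x.2)}.
  by apply: (@continuous_comp _ _ _ snd S); [exact: cvg_snd|exact: S_cont].
by apply: cvgM; [exact: h1|exact: h2].
Qed.

Let sqrtp_cont : continuous (fun x => Num.sqrt (p x)).
Proof. by move=> x; apply: (@continuous_comp _ _ _ p Num.sqrt); [exact: p_cont|exact: sqrt_continuous]. Qed.

Let area_diff : \int[mu2]_(x in `[0, L] `*` `[0, ell]) Num.sqrt (p x) -
    (\int[mu]_(s in `[0, L]) k s) * (\int[mu]_(u in `[0, ell]) S u) =
  \int[mu2]_(x in `[0, L] `*` `[0, ell]) (Num.sqrt (p x) - k x.1 * S x.2).
Proof.
rewrite -Rintegral_prod//.
rewrite RintegralB//.
- exact: measurable_rect.
- exact: integrable_rect.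
- exact: integrable_rect.
Qed.

Let diff_ge0 s u : s \in `[0, L] -> u \in `[0, ell] -> 0 <= Num.sqrt (p (s, u)) - k s * S u.
Proof. by rewrite !in_itv/= subr_ge0; exact: compare_sqrt. Qed.

Lemma area_comparison : (\int[mu]_(s in `[0, L]) k s) * (\int[mu]_(u in `[0, ell]) S u) <=
  \int[mu2]_(x in `[0, L] `*` `[0, ell]) Num.sqrt (p x).
Proof.
rewrite -subr_ge0 area_diff; apply: Rintegral_ge0 => -[s u] [/= sL ul].
exact: diff_ge0.
Qed.

(** If k is positive somewhere inside, the comparison is strict there up to the
    whole length of the pole, and by continuity on a small rectangle. *)
Lemma area_equality : \int[mu2]_(x in `[0, L] `*` `[0, ell]) Num.sqrt (p x) =
    (\int[mu]_(s in `[0, L]) k s) * (\int[mu]_(u in `[0, ell]) S u) ->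
  forall s, 0 < s < L -> k s = 0.
Proof.
move=> /eqP; rewrite -subr_eq0 area_diff => /eqP E s sL.
apply/eqP; rewrite eq_le k_ge0 andbT leNgt; apply/negP => k0.
have ell0' := ell0; have l2 : 0 < ell / 2 < ell by apply/andP; split; lra.
have l3 : 0 < ell / 2 <= ell by case/andP: l2 => -> /ltW.
suff : 0 < \int[mu2]_(x in `[0, L] `*` `[0, ell]) (Num.sqrt (p x) - k x.1 * S x.2) by rewrite E ltxx.
apply: (@rect_gt0 _ (fun x => Num.sqrt (p x) - k x.1 * S x.2) L ell s (ell / 2)) => //.
  by move=> x; apply: cvgB; [exact: sqrtp_cont|exact: kS2_cont].
rewrite /= subr_gt0.
have kS : 0 < k s * S (ell / 2) by rewrite mulr_gt0// S_gt0.
have H := kSp sL l3 k0.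
rewrite -[ltLHS]gtr0_norm// -sqrtr_sqr ltr_sqrt//.
by apply: lt_trans H; rewrite exprn_gt0.
Qed.

(** A continuous nonnegative function with vanishing integral vanishes; so does
    the curvature if it contributes nothing to the lower bound of the length. *)
Lemma mass_equality : \int[mu]_(s in `[0, L]) k s = 0 -> forall s, 0 < s < L -> k s = 0.
Proof.
move=> E s sL; apply/eqP; rewrite eq_le k_ge0 andbT leNgt; apply/negP => k0.
by have := seg_gt0 k_cont sL (fun s _ => k_ge0 s) k0; rewrite E ltxx.
Qed.

End Integrals.

(** * The tractrix *)

Section Tractrix.
Context {R : realType} {n : nat} {M : topologicalType}.
Context {A : smooth_manifold R n M} (g : riemannian_metric A).
Context (K ell L eps : R) (sK : sectional_lt g K).
Context (ell0 : 0 < ell) (ellK : 0 < K -> ell < pi / Num.sqrt K) (L0 : 0 < L).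
Context (eps1 : eps = 1 \/ eps = -1).
Context (U : set R) (oU : open U) (LU : `[0, L] `<=` U).
Context (gamma : R -> M) (sgamma : @smooth_curve R n M A U gamma).
Context (unit_speed : forall s, 0 <= s <= L -> speed g gamma s = 1).
Context (lam : R -> R -> M).
Context (glam : forall s, U s -> geodesic_on g setT (lam s)).
Context (lam0 : forall s, U s -> lam s 0 = gamma s).
Context (vlam : forall s, U s -> @velocity R n M A (lam s) 0 = eps *: @velocity R n M A gamma s).

Notation mu := (@lebesgue_measure R).
Notation mu2 := (lebesgue_measure \x lebesgue_measure)%E.
Notation S := (jacobi K).

Let in_U s : 0 <= s <= L -> U s.
Proof. by move=> h; apply: LU; rewrite /= in_itv. Qed.

Let inU s : 0 < s < L -> U s.
Proof. by move=> /andP[s0 sL]; apply: in_U; rewrite !ltW. Qed.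

Lemma near_open_seg (s : R) : 0 < s < L -> \forall t \near s, 0 < t < L.
Proof.
move=> sL; have oV : open (`]0, L[%classic : set R) by exact: interval_open.
have : \forall t \near s, `]0, L[%classic t.
  by apply: open_nbhs_nbhs; split=> //=; rewrite in_itv.
by apply: filterS => t; rewrite /= in_itv.
Qed.

Lemma unit_energy s : 0 <= s <= L -> energy g gamma s = 1.
Proof.
move=> /unit_speed E; have h := energy_ge0 g gamma s.
have : Num.sqrt (energy g gamma s) = 1 by exact: E.
by move=> E'; rewrite -[LHS](sqr_sqrtr h) E' expr1n.
Qed.

Let unit_near s : 0 < s < L -> \forall t \near s, energy g gamma t = 1.
Proof.
move=> /near_open_seg; apply: filterS => t /andP[t0 tL].
by apply: unit_energy; rewrite !ltW.
Qed.

Lemma jacobi_seg_gt0 u : 0 < u <= ell -> 0 < S u.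
Proof. by move=> /andP[u0 ul]; apply: jacobi_gt0 => // /ellK; exact: le_lt_trans. Qed.

(** Sturm comparison with the space form, where the normal part is k J^K times
    a parallel field. *)
Lemma pole_comparison s u : 0 < s < L -> 0 < u <= ell -> 0 < geodesic_curvature g gamma s ->
  (geodesic_curvature g gamma s * S u) ^+ 2 < jac_p g lam s u.
Proof.
move=> sL ul k0; have [q [dq [dp dq' q0 dq0 J]]] :=
  jacobi_scalars oU sgamma glam lam0 vlam (inU sL) (unit_near sL) eps1 sK.
have p0 := jac_p0 oU sgamma glam lam0 vlam (inU sL) (unit_near sL) eps1.
have pge := jac_p_ge0 oU sgamma glam lam0 vlam (inU sL) (unit_near sL) eps1.
move: (geodesic_curvature g gamma s) k0 dq0 => kap k0 dq0.
rewrite exprMn.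
exact: (sturm k0 dp dq' (jacobi_derive K) (jacobi'_derive K) pge p0 q0 (jacobi0 K) (jacobi'0 K)
  dq0 J ell0 jacobi_seg_gt0 ul).
Qed.

Section Given.
(* The poles lambda are prescribed over [0, L] only; lam extends them over a
   neighbourhood, which makes the family smooth up to the ends. *)
Context (lambda : R -> R -> M) (lamE : forall s, 0 <= s <= L -> lam s = lambda s).

Let pole_curve u s : 0 < s < L -> \forall t \near s, lambda t u = lam t u.
Proof. by move=> /near_open_seg; apply: filterS => t /andP[t0 tL]; rewrite lamE// !ltW. Qed.

Let N1 : set (measurableTypeR R) := [set 0] `|` [set L].
Let mN1 : measurable N1.
Proof. by apply: measurableU; exact: measurable_set1. Qed.
Let N10 : mu N1 = 0%E.
Proof.
apply: countable_lebesgue_measure0; apply: finite_set_countable.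
by rewrite finite_setU; split; exact: finite_set1.
Qed.

Let interior s : 0 <= s <= L -> ~ N1 s -> 0 < s < L.
Proof.
move=> /andP[s0 sL] /not_orP[/= n1 n2]; rewrite !lt_neqAle s0 sL !andbT.
by apply/andP; split; apply/eqP => // E; apply: n1.
Qed.

Let speed_in s : 0 <= s <= L -> ~ N1 s ->
  speed g (fun s => lambda s ell) s = Num.sqrt (1 + jac_p g lam s ell).
Proof.
move=> sL /(interior sL) sI.
rewrite -(pole_speed g lam s ell) /speed (velocity_near (pole_curve ell sI)).
by rewrite (lamE sL).
Qed.

Let density_in s u : 0 <= s <= L -> ~ N1 s ->
  area_density g lambda (s, u) = Num.sqrt (jac_p g lam s u).
Proof.
move=> sL /(interior sL) sI.
rewrite -(pole_density oU sgamma glam lam0 vlam (inU sI) (unit_near sI) eps1).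
by rewrite /area_density /= (velocity_near (pole_curve u sI)) (lamE sL).
Qed.

(** The geometry enters the integrals through two continuous functions: the
    curvature k of gamma and the squared normal length p of the variation
    field. Only the open interval matters: at its ends the derivatives in s
    involve the values of lambda outside [0, L], but the end points form a null
    set. *)
Lemma tractrix_scalars : exists (k : R -> R) (p : R * R -> R),
  [/\ continuous k, continuous p, forall s, 0 <= k s &
      forall s, 0 <= s <= L -> k s = geodesic_curvature g gamma s] /\
  [/\ forall s u, 0 < s < L -> 0 <= p (s, u),
      forall s u, 0 < s < L -> 0 < u <= ell -> 0 < k s -> (k s * S u) ^+ 2 < p (s, u),
      forall s u, 0 < s < L -> p (s, u) = jac_p g lam s u,
      curve_length g (fun s => lambda s ell) 0 L = \int[mu]_(s in `[0, L]) Num.sqrt (1 + p (s, ell)) &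
      swept_area g lambda L ell = \int[mu2]_(x in `[0, L] `*` `[0, ell]) Num.sqrt (p x)].
Proof.
have cU s : U (clamp L s) by exact/in_U/clamp_in.
have cI s : 0 < s < L -> clamp L s = s by move=> /andP[s0 sL]; rewrite clamp_id// !ltW.
exists (fun s => geodesic_curvature g gamma (clamp L s)), (fun x => jac_p g lam (clamp L x.1) x.2).
split; split.
- move=> s; apply: (@continuous_comp _ _ _ (clamp L) (geodesic_curvature g gamma)).
    exact: clamp_cont.
  exact: (geodesic_curvature_cont oU sgamma (cU s)).
- move=> [s u]; apply: (@continuous_comp _ _ _ (fun x : R * R => (clamp L x.1, x.2))
    (fun x : R * R => jac_p g lam x.1 x.2)).
    apply: pair_cont; last exact: cvg_snd.
    by apply: (@continuous_comp _ _ _ fst (clamp L)); [exact: cvg_fst|exact: clamp_cont].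
  exact: (jac_p_cont oU sgamma glam lam0 vlam (u0 := u) (cU s)).
- by move=> s; exact: sqrtr_ge0.
- by move=> s sL; rewrite clamp_id.
- move=> s u sL; rewrite [clamp _ _]cI//.
  exact: (jac_p_ge0 oU sgamma glam lam0 vlam (inU sL) (unit_near sL) eps1).
- by move=> s u sL; rewrite [clamp _ _]cI//; exact: pole_comparison.
- by move=> s u sL; rewrite [clamp _ _]cI.
- apply: (Rintegral_null mN1 N10) => s /=; rewrite ?in_itv/=.
  + by move=> _; exact: sqrtr_ge0.
  + by move=> _; exact: sqrtr_ge0.
  by move=> sL nN; rewrite (speed_in sL nN) (clamp_id sL).
have mN2 : measurable (N1 `*` setT : set (measurableTypeR R * measurableTypeR R)).
  by apply: measurableX => //; exact: measurableT.
have N20 : mu2 (N1 `*` setT) = 0%E.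
  apply: (etrans (product_measure1E _ _ mN1 measurableT)).
  by apply: (eq_ind_r (fun y => (y * _)%E = 0%E) _ N10); rewrite mul0e.
apply: (Rintegral_null mN2 N20) => -[s u] /= [] /=; rewrite ?in_itv/=.
- by move=> _ _; exact: sqrtr_ge0.
- by move=> _ _; exact: sqrtr_ge0.
move=> sL _ nN; rewrite (clamp_id sL); apply: (density_in u sL) => h; exact: nN.
Qed.

Lemma curvature_eq0 (c : R -> M) (s : R) : geodesic_curvature g c s = 0 -> acceleration g c s = 0.
Proof.
move=> E; apply/eqP; apply/negP => /negP a0.
have ix : chart_cod (chart_at A (c s)) (chart (chart_at A (c s)) (c s)).
  by apply: chart_in_cod; exact: chart_atP.
have h := inner_gt0 g ix a0.
have : 0 < geodesic_curvature g c s by rewrite sqrtr_gt0; exact: h.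
by rewrite E ltxx.
Qed.

(** Along one complete geodesic c0 the poles are lambda s u = c0 (s + eps u),
    so the variation field is the velocity of c0 and has no normal part. *)
Lemma flat_unroll : complete_metric g -> (forall s, 0 < s < L -> geodesic_curvature g gamma s = 0) ->
  (geodesic_segment g gamma 0 L /\ geodesic_segment g (fun s => lambda s ell) 0 L) /\
  forall s u, 0 < s < L -> jac_p g lam s u = 0.
Proof.
move=> gC flat; have a0 s (sL : 0 < s < L) : acceleration g gamma s = 0 := curvature_eq0 (flat s sL).
have [c0 [g0 gE lE]] := poles_unroll oU sgamma glam lam0 vlam eps1 L0 LU gC a0.
have gu u : geodesic_on g setT (fun s => c0 (eps * u + 1 * s)) :=
  geodesic_affine (eps * u) (or_introl erefl) openT g0.
split.
  split.
    by exists setT, c0; split=> //; exact: openT.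
  exists setT, (fun s => c0 (eps * ell + 1 * s)); split=> //; first exact: openT.
  by move=> s; rewrite in_itv/= => sL; rewrite -(lamE sL) lE// mul1r addrC.
move=> s u sL; have e0 t : energy g c0 t = 1.
  have sI : 0 <= s <= L by case/andP: sL => h1 h2; rewrite !ltW.
  rewrite (energy_const g0) -(energy_const g0 s) -(unit_energy sI) /energy.
  have N : \forall t \near s, gamma t = c0 t.
    by move: sL => /near_open_seg; apply: filterS => r /andP[h1 h2]; rewrite gE// !ltW.
  by rewrite (velocity_near N) (gE s sI).
have N : \forall t \near s, lam t u = c0 (eps * u + 1 * t).
  move: sL => /near_open_seg; apply: filterS => r /andP[h1 h2].
  by rewrite lE ?(ltW h1) ?(ltW h2)// mul1r addrC.
have V : @velocity R n M A (fun t => c0 (eps * u + 1 * t)) s = @velocity R n M A c0 (eps * u + 1 * s).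
  by rewrite (velocity_affine (a := eps * u) (sg := 1) g0.1 I) scale1r.
rewrite /jac_p (velocity_near N) V (nbhs_singleton N).
by rewrite -/(energy g c0 (eps * u + 1 * s)) e0 subrr.
Qed.

(** A geodesic segment agrees with a geodesic near every interior point, and
    the curvature depends on the germ of the curve only. *)
Lemma geodesic_flat : geodesic_segment g gamma 0 L ->
  forall s, 0 < s < L -> geodesic_curvature g gamma s = 0.
Proof.
move=> [V [c [oV LV [sc gc] E]]] s sL.
have N : \forall t \near s, gamma t = c t.
  move: sL => /near_open_seg; apply: filterS => r /andP[h1 h2]; apply: E.
  by rewrite in_itv/= !ltW.
have Vs : V s by apply: LV; rewrite /= in_itv/=; case/andP: sL => h1 h2; rewrite !ltW.
rewrite /geodesic_curvature (acceleration_near g N) gc// /norm_at /inner_at inner0r.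
  exact: sqrtr0.
Qed.

End Given.

End Tractrix.

Unset Implicit Arguments.

Theorem corollary6p5 (R : realType) (n : nat) (M : topologicalType)
    (A : smooth_manifold R n M) (g : riemannian_metric A)
    (K ell L eps : R) (T : set R) (gamma eta : R -> M) (lambda : R -> R -> M)
    (g_complete : complete_metric g) (sec_lt_K : sectional_lt g K)
    (ell_gt0 : 0 < ell) (ell_lt : 0 < K -> ell < pi / Num.sqrt K)
    (L_gt0 : 0 < L)
    (gamma_tractrix : tractrix g eps ell L T gamma eta lambda) :
  let tractor := fun s => lambda s ell in
  let kappa := geodesic_curvature g gamma in
  let Ktot := \int[lebesgue_measure]_(s in `[0, L]) kappa s in
  let len_eta := curve_length g tractor 0 L in
  let len_gamma := curve_length g gamma 0 L in
  let mid := \int[lebesgue_measure]_(s in `[0, L])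
               Num.sqrt (1 + (kappa s * jacobi K ell) ^+ 2) in
  let low := Num.sqrt (len_gamma ^+ 2 + (jacobi K ell * Ktot) ^+ 2) in
  let area := swept_area g lambda L ell in
  let intJ := \int[lebesgue_measure]_(u in `[0, ell]) jacobi K u in
  let geodesics :=
    geodesic_segment g gamma 0 L /\ geodesic_segment g tractor 0 L in
  [/\ [/\ len_eta >= mid, mid >= low & low >= len_gamma],
      area >= Ktot * intJ,
      [/\ forall k : R, 0 < k -> K = k ^+ 2 ->
            intJ = (1 - cos (k * ell)) / k ^+ 2,
          K = 0 -> intJ = ell ^+ 2 / 2 &
          forall k : R, 0 < k -> K = - k ^+ 2 ->
            intJ = (cosh (k * ell) - 1) / k ^+ 2],
      [/\ len_eta = mid, mid = low & low = len_gamma] <-> geodesics &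
      area = Ktot * intJ <-> geodesics].
Proof.
move=> tractor kappa Ktot len_eta len_gamma mid low area intJ geodesics.
have [eps1 [[U [oU LU sgamma]] unit0] _ poles] := gamma_tractrix.
have unit_speed s : 0 <= s <= L -> speed g gamma s = 1.
  by move=> sL; apply: unit0; rewrite in_itv.
(* Outside [0, L] completeness provides poles with the same initial condition. *)
have ext s : exists c, [/\ geodesic_on g setT c, c 0 = gamma s,
    @velocity R n M A c 0 = eps *: @velocity R n M A gamma s & 0 <= s <= L -> c = lambda s].
  have [sL|sL] := boolP (0 <= s <= L).
    by have [|h1 h2 h3 _] := poles s; [rewrite in_itv|exists (lambda s)].
  by have [c [h1 h2 h3]] := g_complete (gamma s) (eps *: @velocity R n M A gamma s); exists c.
have [lam lamP] := choice ext.
have glam s : U s -> geodesic_on g setT (lam s) by move=> _; case: (lamP s).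
have lam0 s : U s -> lam s 0 = gamma s by move=> _; case: (lamP s).
have vlam s : U s -> @velocity R n M A (lam s) 0 = eps *: @velocity R n M A gamma s.
  by move=> _; case: (lamP s).
have lamE s : 0 <= s <= L -> lam s = lambda s by case: (lamP s).
have [k [p [[ck cp k0 kE] [p0 kSp pE lenE areaE]]]] :=
  tractrix_scalars sec_lt_K ell_gt0 ell_lt L_gt0 eps1 oU LU sgamma unit_speed glam lam0 vlam lamE.
have unroll := flat_unroll ell L_gt0 eps1 oU LU sgamma unit_speed glam lam0 vlam lamE g_complete.
have Sgt := jacobi_seg_gt0 ell_lt.
have Sc := @jacobi_cont R K; have S0 := jacobi0 K.
have Sl : 0 < jacobi K ell by apply: Sgt; rewrite ell_gt0/=.
have KtotE : Ktot = \int[lebesgue_measure]_(s in `[0, L]) k s.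
  by apply: eq_Rintegral => s /set_mem; rewrite /= in_itv/= => /kE.
have midE : mid = \int[lebesgue_measure]_(s in `[0, L]) Num.sqrt (1 + (k s * jacobi K ell) ^+ 2).
  by apply: eq_Rintegral => s /set_mem; rewrite /= in_itv/= => /kE ->.
have gammaE : len_gamma = L.
  rewrite /len_gamma /curve_length (@eq_Rintegral _ _ _ _ _ (fun=> 1)); first by rewrite seg_cst// mul1r.
  by move=> s /set_mem; rewrite /= in_itv/= => /unit_speed.
have kI s : 0 < s < L -> k s = kappa s by move=> /andP[s0 sL]; rewrite kE// !ltW.
have flat_geo : (forall s, 0 < s < L -> k s = 0) <-> geodesics.
  split=> [flat|[geo _]]; first by apply: (unroll _).1 => s sL; rewrite -/(kappa s) -kI// flat.
  by move=> s sL; rewrite kI//; exact: (geodesic_flat geo).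
have flat_p : (forall s, 0 < s < L -> k s = 0) -> forall s u, 0 < s < L -> p (s, u) = 0.
  move=> flat s u sL; rewrite pE//; apply: (unroll _).2 => // t tL.
  by rewrite -/(kappa t) -kI// flat.
have low_ge : len_gamma <= low.
  rewrite -[leLHS]ger0_norm ?gammaE ?(ltW L_gt0)// -sqrtr_sqr /low gammaE.
  by apply: ler_wsqrtr; rewrite lerDl sqr_ge0.
split.
- split; [| |exact: low_ge].
  + rewrite midE /len_eta lenE.
    exact: (length_comparison (S := jacobi K) L_gt0 ell_gt0 ck cp k0 S0 p0 kSp).
  + by rewrite midE /low gammaE KtotE; exact: (length_mean ell L_gt0 (jacobi K) ck).
- rewrite KtotE /area areaE.
  exact: (area_comparison (S := jacobi K) L_gt0 ell_gt0 ck Sc cp k0 S0 Sgt p0 kSp).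
- split.
  + exact: jacobi_integral_pos.
  + exact: jacobi_integral_zero.
  + exact: jacobi_integral_neg.
- split=> [[_ _ E]|/flat_geo flat].
  + apply/flat_geo; apply: (mass_equality ck k0); rewrite -KtotE.
    have : low ^+ 2 = len_gamma ^+ 2 by rewrite E.
    rewrite /low sqr_sqrtr ?addr_ge0 ?sqr_ge0// -[RHS]addr0 => /addrI/eqP.
    by rewrite sqrf_eq0 mulf_eq0 (gt_eqF Sl) => /eqP.
  + have K0 : Ktot = 0 by rewrite KtotE (flat_mass L_gt0 ck).
    have lowL : low = L by rewrite /low K0 mulr0 expr0n addr0 gammaE sqrtr_sqr gtr0_norm.
    have midL : mid = L by rewrite midE; exact: (flat_mid ell L_gt0 (jacobi K) ck).
    split; [|exact: etrans midL (esym lowL)|exact: etrans lowL (esym gammaE)].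
    rewrite midL /len_eta lenE; exact: (flat_length ell L_gt0 cp (flat_p flat)).
split=> [E|/flat_geo flat].
  apply/flat_geo; apply: (area_equality (S := jacobi K) L_gt0 ell_gt0 ck Sc cp k0 S0 Sgt p0 kSp).
  by rewrite -areaE -KtotE.
rewrite KtotE (flat_mass L_gt0 ck)// mul0r /area areaE.
exact: (flat_area ell L_gt0 cp (flat_p flat)).
Qed.
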